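(* Let $T>0$, $0<\varepsilon<T$, $0<\alpha<1$, $0\le\beta\le1$, $\gamma=\alpha+\beta-\alpha\beta$, $\zeta=1-\gamma+\alpha$, $d,q\in\mathbb{N}$ with $q\ge1$, $\tilde{\mathbf{x}}_0\in\mathbb{R}^d$, $D\subseteq\mathbb{R}^d$ closed and bounded, $\mathbf{f}:(0,T]\times\mathbb{R}^d\to\mathbb{R}^d$, and let $\mathcal{A}$ be a knot collection on $[\varepsilon,T]$ with knot sizes $h_i=t_{i+1}-t_i$, $i=0,\dots,k$, and largest knot size $h:=\sup_{i}h_i$. With the notation of the context, assume: (A.1) $\tilde{\mathbf{x}}_0/\Gamma(\gamma)\in D$ and $\{\mathbf{u}\in C_{1-\gamma}[0,T]:\|\mathbf{u}-\tilde{\mathbf{x}}_0t^{\gamma-1}/\Gamma(\gamma)\|_{C_{1-\gamma}[0,T]}\le\Xi\,\mathbf{m}\}\subseteq X_D[0,T]$, where $\mathbf{m}$ is the vector in (A.2); (A.2) $\mathbf{f}\in C_{1-\gamma}[0,T]$, in the sense that for every $\mathbf{u}\in X_D[0,T]$ the function $t\mapsto\mathbf{f}(t,\mathbf{u}(t))$ is in $C_{1-\gamma}[0,T]$, there is a nonnegative $\mathbf{m}\in\mathbb{R}^d$ with $\|\mathbf{f}(\cdot,\mathbf{u}(\cdot))\|_{C_{1-\gamma}[0,T]}\le\mathbf{m}$ for all $\mathbf{u}\in X_D[0,T]$, and there is $K\in\mathbb{R}^{d\times d}_{\ge0}$ with $|\mathbf{f}(t,\mathbf{u}(t))-\mathbf{f}(t,\mathbf{v}(t))|\le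 K|\mathbf{u}(t)-\mathbf{v}(t)|$ for all $t\in(0,T]$, $\mathbf{u},\mathbf{v}\in X_D[0,T]$; (A.3) $\rho(\Xi K)<1$, where $\rho$ is the spectral radius; and additionally (A.1* ) $\{\mathbf{u}\in C_{1-\gamma}[\varepsilon,T]:\|\mathbf{u}-\tilde{\mathbf{x}}_0t^{\gamma-1}/\Gamma(\gamma)\|_{C_{1-\gamma}[\varepsilon,T]}\le(\Xi+\Omega^q_{\mathcal{A}})\,\mathbf{m}\}\subseteq X_D[\varepsilon,T]$; (A.2* ) the boundedness and Lipschitz conditions of (A.2) also hold for $\mathbf{u},\mathbf{v}\in X_D[\varepsilon,T]$: $t\mapsto\mathbf{f}(t,\mathbf{u}(t))$ is in $C_{1-\gamma}[\varepsilon,T]$, $\|\mathbf{f}(\cdot,\mathbf{u}(\cdot))\|_{C_{1-\gamma}[\varepsilon,T]}\le\mathbf{m}$, and $|\mathbf{f}(t,\mathbf{u}(t))-\mathbf{f}(t,\mathbf{v}(t))|\le K|\mathbf{u}(t)-\mathbf{v}(t)|$ for $t\in(\varepsilon,T]$; (A.3* ) $\rho\big((\Xi+\Omega^q_{\mathcal{A}})K\big)<1$. Then the sequence of functions $\mathbf{x}^{q,\varepsilon}_m:[\varepsilon,T]\to\mathbb{R}^d$ defined by $$\mathbf{x}^{q,\varepsilon}_0(t,\tilde{\mathbf{x}}_0)=\frac{\tilde{\mathbf{x}}_0}{\Gamma(\gamma)}t^{\gamma-1},\qquad \mathbf{x}^{q,\varepsilon}_{m+1}(t,\tilde{\mathbf{x}}_0)=\mathbf{x}^{q,\varepsilon}_0(t,\tilde{\mathbf{x}}_0)+\mathcal{T}^{\varepsilon,q}\{\mathbf{f}(\cdot,\mathbf{x}^{q,\varepsilon}_m(\cdot,\tilde{\mathbf{x}}_0))\}(t),\quad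 m\ge0,$$ converges, with $\lim_{m\to\infty}\mathbf{x}^{q,\varepsilon}_m=:\mathbf{x}^{q,\varepsilon}\in C_{1-\gamma}[\varepsilon,T]$. Furthermore: (C.1* ) $\mathbf{x}^{q,\varepsilon}_m\in C_{1-\gamma}[\varepsilon,T]=C[\varepsilon,T]$ for all $m\ge0$. (C.2* ) $\lim_{q\to\infty}\mathbf{x}^{q,\varepsilon}=\lim_{h\downarrow0}\mathbf{x}^{q,\varepsilon}=\mathbf{x}^{\varepsilon}$, where $\mathbf{x}^\varepsilon$ is the solution (limit) of the same iteration with $\mathcal{T}^{\varepsilon}$ substituted for $\mathcal{T}^{\varepsilon,q}$; and $$\|\mathbf{x}^{q,\varepsilon}-\mathbf{x}^{\varepsilon}\|_{C_{1-\gamma}[\varepsilon,T]}=\mathcal{O}\big((h/\sqrt{q})^{\alpha}\big).$$ (C.3* ) $\lim_{\varepsilon\downarrow0}\mathbf{x}^{\varepsilon}=\mathbf{x}$, where $\mathbf{x}\in C^{\beta(1-\alpha)}_{1-\gamma}[0,T]$ is the analytical perturbed-initial-value-problem solution, i.e. the limit in $C_{1-\gamma}[0,T]$ of the iteration $\mathbf{x}_0(t)=\tilde{\mathbf{x}}_0t^{\gamma-1}/\Gamma(\gamma)$, $\mathbf{x}_{m+1}=\mathbf{x}_0+\mathcal{T}\{\mathbf{f}(\cdot,\mathbf{x}_m(\cdot))\}$ on $(0,T]$; and $$\|\mathbf{x}^{\varepsilon}-\mathbf{x}\|_{C_{1-\gamma}[\varepsilon,T]}=\mathcal{O}(\vare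psilon^{\alpha}).$$
   Context: Operations ${}_aI_b^{\alpha}$, $|\cdot|$, $\|\cdot\|$, $\le$ and the spline operator are applied component-wise to vector-valued functions, and membership of a vector-valued function in a function space is component-wise. Riemann-Liouville integral: for $\alpha>0$, $a\le b\le t$, ${}_aI_b^{\alpha}f(t)=\frac1{\Gamma(\alpha)}\int_a^b(t-s)^{\alpha-1}f(s)\,ds$; ${}_0I_t^0$ is the identity; ${}_0I_0^{\alpha}f(0):=\lim_{t\downarrow0}{}_0I_t^{\alpha}f(t)$. Hilfer derivative of order $\alpha$ and type $\beta$: ${}_0D_t^{\alpha,\beta}={}_0I_t^{\beta(1-\alpha)}\frac{d}{dt}\,{}_0I_t^{(1-\beta)(1-\alpha)}$; ${}_0D_t^{\vartheta,0}=\frac{d}{dt}{}_0I_t^{1-\vartheta}$ is the Riemann-Liouville derivative of order $\vartheta$. Background: the underlying boundary value problem is ${}_0D_t^{\alpha,\beta}\mathbf{x}(t)=\mathbf{f}(t,\mathbf{x}(t))$ for $0<t<T$, with ${}_0I_0^{1-\gamma}\mathbf{x}(0)={}_0I_T^{1-\gamma}\mathbf{x}(T)$; its perturbed initial value problem is ${}_0D_t^{\alpha,\beta}\mathbf{x}(t)=\mathbf{f}(t,\mathbf{x}(t))+\nu$ for $0<t<T$, with ${}_0I_0^{1-\gamma}\mathbf{x}(0)=\tilde{\mathbf{x}}_0$ and $\nu=-\Gamma(\zeta+1)T^{-\zeta}\,{}_0I_T^{\zeta}\mathbf{f}(T,\mathbf{x}(T))$. Spaces: $C_{1-\gamma}[0,T]=\{f:(0,T]\to\mathbb{R}: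 t^{1-\gamma}f\in C[0,T]\}$, $\|f\|_{C_{1-\gamma}[0,T]}=\sup_{t\in(0,T]}|t^{1-\gamma}f(t)|$; $C^{\vartheta}_{1-\gamma}[0,T]=\{f\in C_{1-\gamma}[0,T]:{}_0D_t^{\vartheta,0}f\in C_{1-\gamma}[0,T]\}$; $C_{1-\gamma}[\varepsilon,T]=\{f:(\varepsilon,T]\to\mathbb{R}:t^{1-\gamma}f\in C[\varepsilon,T]\}$, $\|f\|_{C_{1-\gamma}[\varepsilon,T]}=\sup_{t\in(\varepsilon,T]}|t^{1-\gamma}f(t)|$ (membership in $C[\cdot,T]$ meaning that the function extends continuously to the closed interval; thus $C_{1-\gamma}[\varepsilon,T]$ is identified with $C[\varepsilon,T]$). For $a\in\{0,\varepsilon\}$, $X_D[a,T]=\{\mathbf{u}:(a,T]\to\mathbb{R}^d,\ \mathbf{u}\in C_{1-\gamma}[a,T]:\ t^{1-\gamma}\mathbf{u}(t)\in D\}$. Operators: $\mathcal{T}\{\mathbf{y}\}(t)={}_0I_t^{\alpha}\mathbf{y}(t)-\frac{\Gamma(\zeta+1)t^\alpha}{\Gamma(\alpha+1)T^\zeta}{}_0I_T^{\zeta}\mathbf{y}(T)$ and $\mathcal{T}^{\varepsilon}\{\mathbf{y}\}(t)={}_\varepsilon I_t^{\alpha}\mathbf{y}(t)-\frac{\Gamma(\zeta+1)t^\alpha}{\Gamma(\alpha+1)T^\zeta}{}_\varepsilon I_T^{\zeta}\mathbf{y}(T)$ (the last also at $t=\varepsilon$, where the first integral is $0$). Knot collection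 on $[\varepsilon,T]$: $\mathcal{A}=\{A_0,\dots,A_k\}=\{[t_0,t_1),\dots,[t_{k-1},t_k),[t_k,t_{k+1}]\}$, disjoint with union $[\varepsilon,T]$ (so $t_0=\varepsilon$, $t_{k+1}=T$). Bernstein operator on $[a,b]$: $B^qf(t)=\sum_{j=0}^qf\big(a+\tfrac{j(b-a)}q\big)\binom qj\big(\tfrac{t-a}{b-a}\big)^j\big(\tfrac{b-t}{b-a}\big)^{q-j}$. Bernstein spline operator: $S^q_{\mathcal{A}}f(t)$ equals, for $t\in A_i$, the Bernstein operator of order $q$ on the closed interval $\bar A_i$ applied to $f|_{\bar A_i}$, at $t$. Set $\mathcal{T}^{\varepsilon,q}\{\mathbf{y}\}(t)=t^{\gamma-1}\,S^q_{\mathcal{A}}\big[s\mapsto s^{1-\gamma}\mathcal{T}^{\varepsilon}\{\mathbf{y}\}(s)\big](t)$. Constants: with $\mathrm{B}(a,b)=\mathrm{B}_1(a,b)$, $\mathrm{B}_z(a,b)=\int_0^z\vartheta^{a-1}(1-\vartheta)^{b-1}d\vartheta$: $\Xi=\sup_{t\in(0,T]}\xi(t)$, $$\xi(t)=\frac{\Gamma(\gamma)t^\alpha}{\Gamma(\gamma+\alpha)}+\frac{(t/T)^{\zeta}T^\alpha}{\Gamma(\alpha+1)}\Big[(1-\gamma-\alpha)\mathrm{B}_{t/T}(\gamma,\zeta)+\zeta\,\mathrm{B}_{1-t/T}(\zeta,\gamma)\Big];$$ for $\varepsilon\le t\le t'\le T$, $$\Omega(t,t')=\frac{(t'-t)^\alpha}{\Gamma(\alpha+1)}\Big(\alpha\mathrm{B}(\gamma,\alpha)+2\big(\tfrac{t'}t\big)^{1-\gamma}\Big)+\frac{(t'-t)^\zeta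 T^\alpha}{\Gamma(\alpha+1)T^\zeta}\zeta\,\mathrm{B}(\gamma,\zeta),$$ $$\Omega^q_{\mathcal{A}}=\frac54\sup_{A_i\in\mathcal{A}}\ \sup\{\Omega(t,t'):\ t,t'\in A_i,\ t\le t',\ t'-t\le h_i/\sqrt q\}.$$ Asymptotics: the rate in (C.2* ) is for $h/\sqrt q\downarrow0$ and the rate in (C.3* ) is for $\varepsilon\downarrow0$.
   Formalization: In (C.3* ), membership of x in C^{β(1-α)}_{1-γ}[0,T] is asserted only if β=0, or if x̃_0=0 and β(1-α)≤α; as stated it is false (f=0, m=0, K=0, D={x̃_0/Γ(γ)}, x̃_0≠0, β>0 gives a derivative of weighted size t^{-β(1-α)}, unbounded at 0). *)

(* Defs.v *)
From HB Require Import structures.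
From mathcomp Require Import all_boot all_order all_algebra.
From mathcomp Require Import all_classical all_reals all_analysis.
From mathcomp.real_closed Require Import complex.

Set Implicit Arguments.
Unset Strict Implicit.
Unset Printing Implicit Defensive.

Import Order.TTheory GRing.Theory Num.Theory.
Import numFieldNormedType.Exports.

Local Open Scope classical_set_scope.
Local Open Scope ring_scope.

Section special_functions.
Context {R : realType}.
Implicit Types (x z a b t T alpha gamma zeta : R).

Definition Gamma x : R :=
  \int[lebesgue_measure]_(t in `]0, +oo[) (t `^ (x - 1) * expR (- t)).

Definition inc_beta z a b : R :=
  \int[lebesgue_measure]_(t in `[0, z]) (t `^ (a - 1) * (1 - t) `^ (b - 1)).

Definition beta_fn a b : R := inc_beta 1 a b.

Definition xi T alpha gamma zeta t : R :=
  Gamma gamma * t `^ alpha / Gamma (gamma + alpha)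
  + (t / T) `^ zeta * T `^ alpha / Gamma (alpha + 1)
    * ((1 - gamma - alpha) * inc_beta (t / T) gamma zeta
       + zeta * inc_beta (1 - t / T) zeta gamma).

Definition Xi T alpha gamma zeta : R :=
  sup [set xi T alpha gamma zeta t | t in `]0, T]].

Definition Omega T alpha gamma zeta t t' : R :=
  (t' - t) `^ alpha / Gamma (alpha + 1)
    * (alpha * beta_fn gamma alpha + 2 * (t' / t) `^ (1 - gamma))
  + (t' - t) `^ zeta * T `^ alpha / (Gamma (alpha + 1) * T `^ zeta)
    * (zeta * beta_fn gamma zeta).

End special_functions.

Section knots.
Context {R : realType}.

(* [knot A 0 < ... < knot A k.+1] with [k = nknot A]; only the values of [knot]
   at indices [<= k.+1] matter. *)
Record knots (eps T : R) := Knots {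
  nknot : nat;
  knot : nat -> R;
  knot_first : knot 0%N = eps;
  knot_last : knot nknot.+1 = T;
  knot_lt : forall i, (i <= nknot)%N -> knot i < knot i.+1 }.

Variables (eps T : R) (A : knots eps T).

Definition cell (i : nat) : set R :=
  if i == nknot A then `[knot A i, knot A i.+1]%classic
  else `[knot A i, knot A i.+1[%classic.

Definition cell_size (i : nat) : R := knot A i.+1 - knot A i.

Definition mesh : R := sup [set cell_size i | i in [set i | (i <= nknot A)%N]].

Definition Omega_knots (alpha gamma zeta : R) (q : nat) : R :=
  5 / 4 * sup [set sup [set Omega T alpha gamma zeta p.1 p.2 |
                  p in [set p | [/\ cell i p.1, cell i p.2, p.1 <= p.2 &
                         p.2 - p.1 <= cell_size i / Num.sqrt q%:R]]] |
              i in [set i | (i <= nknot A)%N]].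

Definition bernstein (q : nat) (a b : R) (f : R -> R) (t : R) : R :=
  \sum_(j < q.+1) f (a + j%:R * (b - a) / q%:R) * 'C(q, j)%:R
    * ((t - a) / (b - a)) ^+ j * ((b - t) / (b - a)) ^+ (q - j).

(* The cells are disjoint, so at most one summand is nonzero. *)
Definition spline (q : nat) (f : R -> R) (t : R) : R :=
  \sum_(i < (nknot A).+1)
    \1_(cell i) t * bernstein q (knot A i) (knot A i.+1) f t.

End knots.

Section operators.
Context {R : realType}.
Implicit Types (a b t T alpha gamma zeta : R) (y : R -> R).

Definition RLint a b alpha y t : R :=
  (Gamma alpha)^-1
  * \int[lebesgue_measure]_(s in `[a, b]) ((t - s) `^ (alpha - 1) * y s).

(* The case [a = 0] is the operator on the whole interval. *)
Definition Top T alpha zeta a y t : R :=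
  RLint a t alpha y t
  - Gamma (zeta + 1) * t `^ alpha / (Gamma (alpha + 1) * T `^ zeta)
    * RLint a T zeta y T.

Definition Top_spline T alpha gamma zeta eps (q : nat) (A : knots eps T) y t : R :=
  t `^ (gamma - 1)
  * spline A q (fun s => s `^ (1 - gamma) * Top T alpha zeta eps y s) t.

End operators.

Section weighted_spaces.
Context {R : realType}.
Implicit Types (a T gamma theta : R) (u g : R -> R).

(* Functions on [`]a, T]] are total functions whose values outside it are
   ignored. *)
Definition Cw gamma a T u : Prop :=
  exists2 g, {within `[a, T], continuous g} &
    forall t, t \in `]a, T] -> t `^ (1 - gamma) * u t = g t.

(* Real-valued [sup]: meaningful only for members of [Cw gamma a T]. *)
Definition normw gamma a T u : R :=
  sup [set `|t `^ (1 - gamma) * u t| | t in `]a, T]].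

(* The derivative is one-sided at the right endpoint [T]. *)
Definition is_RLderiv T theta u g : Prop :=
  forall t, t \in `]0, T] ->
    (RLint 0 s (1 - theta) u s - RLint 0 t (1 - theta) u t) / (s - t)
      @[s --> within `]0, T] (t^')] --> g t.

(* [t `^ (gamma - 1)] is not in this space when [0 < theta = gamma - alpha]: its
   derivative is a nonzero multiple of [t `^ (alpha - 1)]. *)
Definition Cw_RL gamma theta T u : Prop :=
  Cw gamma 0 T u /\ exists2 g, Cw gamma 0 T g & is_RLderiv T theta u g.

End weighted_spaces.

Section vector_valued.
Context {R : realType} {d : nat}.
Implicit Types (a T gamma theta : R) (u v : R -> 'cV[R]_d).

Definition lev (m n : 'cV[R]_d) : Prop := forall i, m i 0 <= n i 0.

Definition absv (m : 'cV[R]_d) : 'cV[R]_d := \col_i `|m i 0|.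

Definition entry u (i : 'I_d) : R -> R := fun t => u t i 0.

Definition lift_op (op : (R -> R) -> R -> R) u : R -> 'cV[R]_d :=
  fun t => \col_i op (entry u i) t.

Definition Cwv gamma a T u : Prop := forall i, Cw gamma a T (entry u i).

Definition Cwv_RL gamma theta T u : Prop :=
  forall i, Cw_RL gamma theta T (entry u i).

Definition contv a T u : Prop :=
  forall i, {within `[a, T], continuous (entry u i)}.

Definition normwv gamma a T u : 'cV[R]_d :=
  \col_i normw gamma a T (entry u i).

Definition cvgwv gamma a T (u_ : nat -> R -> 'cV[R]_d) u : Prop :=
  [/\ forall n, Cwv gamma a T (u_ n), Cwv gamma a T u &
      forall i, normwv gamma a T (u_ n \- u) i 0 @[n --> \oo] --> 0].

Definition XD gamma a T (D : set 'cV[R]_d) u : Prop :=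
  Cwv gamma a T u /\ forall t, t \in `]a, T] -> D (t `^ (1 - gamma) *: u t).

Definition init_sol gamma (x0 : 'cV[R]_d) (t : R) : 'cV[R]_d :=
  (t `^ (gamma - 1) / Gamma gamma) *: x0.

Definition ball_in_XD gamma a T (D : set 'cV[R]_d) (x0 r : 'cV[R]_d) : Prop :=
  forall u, Cwv gamma a T u -> lev (normwv gamma a T (u \- init_sol gamma x0)) r ->
    XD gamma a T D u.

Definition superpos (f : R -> 'cV[R]_d -> 'cV[R]_d) u : R -> 'cV[R]_d :=
  fun t => f t (u t).

Definition bounded_on_XD gamma a T (D : set 'cV[R]_d) f (m : 'cV[R]_d) : Prop :=
  forall u, XD gamma a T D u ->
    Cwv gamma a T (superpos f u) /\ lev (normwv gamma a T (superpos f u)) m.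

Definition lipschitz_on_XD gamma a T (D : set 'cV[R]_d) f (K : 'M[R]_d) : Prop :=
  forall u v, XD gamma a T D u -> XD gamma a T D v ->
    forall t, t \in `]a, T] ->
      lev (absv (f t (u t) - f t (v t))) (K *m absv (u t - v t)).

Definition picard (op : (R -> R) -> R -> R) f (x0 : R -> 'cV[R]_d) :
    nat -> R -> 'cV[R]_d :=
  fix x n := if n is n'.+1 then x0 \+ lift_op op (superpos f (x n')) else x0.

(* The eigenvalues are taken over [R[i]]; the supremum is 0 when [d = 0]. *)
Definition spectral_radius (M : 'M[R]_d) : R :=
  sup [set Normc.normc l |
    l in [set l | eigenvalue (map_mx (real_complex R) M) l]].

End vector_valued.

(* Main.v *)
(* With the weight t^(1-gamma) every operator has a kernel dominated by a Beta
   integrand: this gives the bound Xi for T^eps, the modulus Omega for its image,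
   hence (5/4 being the constant of the Bernstein operators at the scale
   1/sqrt q) the spline error Omega^q_A, and a truncation error O(eps^alpha).
   Since rho(Xi K) < 1 there are w > 0 and r < 1 with Xi K w <= r w, so that the
   iterations are contractions for the norm max_i |u_i| / w_i.  Their fixed points
   then differ by at most 1/(1-r) times the distance between the operators: the
   spline error, of order (h/sqrt q)^alpha, for C.2 and the truncation error
   for C.3.  A function on ]eps,T] is extended to ]0,T] with constant weight,
   and D is closed, so the hypotheses on [0,T] hold on every [e,T]. *)
Require Import Defs.
From mathcomp Require Import all_boot all_order all_algebra.
From mathcomp Require Import all_classical all_reals all_analysis.
From mathcomp Require Import measurable_realfun ring lra.
From mathcomp.real_closed Require Import complex.

Set Implicit Arguments.
Unset Strict Implicit.
Unset Printing Implicit Defensive.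

Import Order.TTheory GRing.Theory Num.Theory.
Import numFieldNormedType.Exports.

Local Open Scope classical_set_scope.
Local Open Scope ring_scope.

(** * Power kernels, Beta and Gamma functions *)

(** Integrals are evaluated in the extended reals with nonnegative integrands, where Tonelli's
    theorem and substitutions are unconditional. Real integrals and real [sup]s have default values,
    so finiteness and boundedness must be proved before a constant such as [Gamma] or [Xi] can be
    used; signed functions enter only through domination by [M * kpow g]. Two weights occur. The one
    of [(Xi + Omega) K] serves only for the convergence of the spline iterations. Every comparison
    uses the one of [Xi K]: the spline limit, and likewise the limit [x] on []0, T]], is an
    approximate fixed point of T^eps, so only T^eps has to contract. Hence the constants depend
    neither on [q] and the knots nor, in the truncation estimate, on [eps]. The spline hypotheses
    are given for a single pair [(A, q)]. They pass to every pair with a smaller Omega; since Omega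
    is positive and is bounded by a multiple of the power [alpha] of [h / sqrt q], all sufficiently
    fine pairs are covered. *)

Section affine_substitution.
Context {R : realType}.
Local Notation mu := (@lebesgue_measure R).
Local Open Scope ereal_scope.

Lemma measurable_affine (c b : R) :
  measurable_fun [set: R] (fun x : R => c * x + b)%R.
Proof. by apply: measurable_funD => //; exact: measurable_funM. Qed.

(** Lebesgue measure is determined by its values on the intervals []x, y]], whose preimages under an
    increasing affine map are explicit. *)
Lemma pushforward_affine (c b : R) (A : set R) : (0 < c)%R -> measurable A ->
  c%:E * mu ((fun x : R => c * x + b)%R @^-1` A) = mu A.
Proof.
move=> c0 mA.
pose phi := (fun x : measurableTypeR R => c * x + b : measurableTypeR R)%R.
have mphi : measurable_fun setT phi by exact: measurable_affine.
pose cnn : {nonneg R} := NngNum (ltW c0).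
pose nu := mscale cnn (pushforward mu phi).
apply/esym; apply: (@lebesgue_measure_unique R (nu mphi)) => // _ [[x y]] _ <-.
transitivity (c%:E * mu (phi @^-1` `]x, y])); last by [].
rewrite (_ : phi @^-1` _ = [set` `](c^-1 * (x - b)), (c^-1 * (y - b))]%R]); last first.
  apply/seteqP; split => z /=; rewrite !in_itv/= ltr_pdivrMl// ler_pdivlMl// /phi;
  by rewrite ltrBlDr lerBrDr.
rewrite !lebesgue_measure_itv /= !lte_fin ltr_pM2l ?invr_gt0// ltrD2r.
case: ifPn => _; last by rewrite mule0.
by rewrite -!EFinB -EFinM; congr (_%:E); field; rewrite gt_eqF.
Qed.

Lemma ge0_integral_affine (c b : R) (f : R -> \bar R) : (0 < c)%R ->
  measurable_fun [set: R] f -> (forall x, 0 <= f x) ->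
  \int[mu]_x f (c * x + b)%R = c^-1%:E * \int[mu]_x f x.
Proof.
move=> c0 mf f0.
pose phi := (fun x : measurableTypeR R => c * x + b : measurableTypeR R)%R.
have mphi : measurable_fun setT phi by exact: measurable_affine.
pose cnn : {nonneg R} := NngNum (ltW c0).
pose nu := mscale cnn (pushforward mu phi).
transitivity (c^-1%:E * \int[nu mphi]_x f x).
  rewrite ge0_integral_mscale// ge0_integral_pushforward// muleA -EFinM.
  by rewrite mulVf ?gt_eqF// mul1e.
congr (_ * _); apply: eq_measure_integral => A mA _.
exact: pushforward_affine.
Qed.

Lemma ge0_integral_opp (f : R -> \bar R) :
  measurable_fun [set: R] f -> (forall x, 0 <= f x) ->
  \int[mu]_x f (- x)%R = \int[mu]_x f x.
Proof.
move=> mf f0.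
transitivity (\int[pushforward mu (-%R : _ -> measurableTypeR R)]_x f x).
  by rewrite ge0_integral_pushforward//; exact: measurable_funS mf.
by apply: eq_measure_integral => A mA _; exact: lebesgue_measureN.
Qed.

Lemma ge0_integral_reflect (t : R) (f : R -> \bar R) :
  measurable_fun [set: R] f -> (forall x, 0 <= f x) ->
  \int[mu]_x f (t - x)%R = \int[mu]_x f x.
Proof.
move=> mf f0.
rewrite -[RHS](@ge0_integral_opp f)//.
have mg : measurable_fun [set: R] (fun x => f (- x)%R).
  by apply: measurableT_comp => //; exact: measurable_funN.
transitivity (\int[mu]_x f (- (1 * x + - t))%R).
  by apply: eq_integral => x _; congr f; ring.
by rewrite (@ge0_integral_affine 1 (- t) (fun x => f (- x)%R))// invr1 mul1e.
Qed.

End affine_substitution.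

Section power_kernel.
Context {R : realType}.
Local Notation mu := (@lebesgue_measure R).

(* The kernel of the Riemann-Liouville integral, extended by 0: operators on
   intervals become convolutions on the whole line. *)
Definition kpow (p x : R) : R := if 0 < x then x `^ (p - 1) else 0.

Lemma kpow_ge0 p x : 0 <= kpow p x.
Proof. by rewrite /kpow; case: ifP => // _; exact: powR_ge0. Qed.

Lemma kpow_le0 p x : x <= 0 -> kpow p x = 0.
Proof. by rewrite /kpow ltNge => ->. Qed.

Lemma kpow_gt0 p x : 0 < x -> kpow p x = x `^ (p - 1).
Proof. by rewrite /kpow => ->. Qed.

Lemma kpowZ p c x : 0 < c -> kpow p (c * x) = c `^ (p - 1) * kpow p x.
Proof.
move=> c0; have [x0|x0] := ltP 0 x.
  by rewrite !kpow_gt0 ?mulr_gt0// powRM// ltW.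
by rewrite !kpow_le0 ?mulr0// pmulr_rle0.
Qed.

Lemma measurable_kpow p : measurable_fun [set: R] (kpow p).
Proof.
rewrite (_ : kpow p = (fun x : R => x `^ (p - 1)) \_ `]0, +oo[%classic).
  apply/(measurable_restrictT (fun x : R => x `^ (p - 1))) => //.
  by apply: measurable_funTS; exact: measurable_powR.
apply/funext => x; rewrite patchE /kpow; case: ifPn => x0.
  by rewrite ifT// inE/= in_itv/= x0.
by rewrite ifF//; apply/negbTE; rewrite notin_setE/= in_itv/= andbT; exact/negP.
Qed.

Lemma measurable_kpow_sub p (t : R) :
  measurable_fun [set: R] (fun s => kpow p (t - s)).
Proof.
apply: measurableT_comp; first exact: measurable_kpow.
by apply: measurable_funB.
Qed.

Lemma le0_ger_powR (e x y : R) : e <= 0 -> 0 < x -> x <= y -> y `^ e <= x `^ e.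
Proof.
move=> e0 x0 xy; have y0 := lt_le_trans x0 xy.
rewrite -(opprK e) powRN [leRHS]powRN lef_pV2 ?posrE ?powR_gt0//.
by apply: ge0_ler_powR; rewrite ?nnegrE ?oppr_ge0// ltW.
Qed.

Lemma cvg_powR (p x : R) : 0 < x -> s `^ p @[s --> x] --> x `^ p.
Proof.
move=> x0; have : {for x, continuous (fun s : R => s `^ p)}; last by [].
apply: differentiable_continuous; apply/derivable1_diffP.
by apply: derivable_powR; rewrite in_itv/= x0.
Qed.

(** The power is singular at 0 when [r < 1], so the fundamental theorem of calculus is applied on
    [[t / i.+2, t]], and monotone convergence exhausts []0, t]]. The index [i.+2] keeps even the
    first interval nondegenerate. *)
Lemma integral_powR (r t : R) : 0 < r -> 0 < t ->
  (\int[mu]_(s in `]0%R, t]) (s `^ (r - 1))%:E = (t `^ r / r)%:E)%E.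
Proof.
move=> r0 t0.
pose F (i : nat) := `[t / i.+2%:R, t]%classic.
have Fgt0 i : 0 < t / i.+2%:R :> R by rewrite divr_gt0.
have UF : `]0, t]%classic = \bigcup_i F i.
  apply/seteqP; split => x /=; rewrite in_itv/=.
    move=> /andP[x0 xt].
    have [n xn] : exists n : nat, t / x < n.+2%:R.
      exists (Num.trunc (t / x)).
      by rewrite (lt_trans (truncnS_gt _))// ltr_nat.
    exists n => //; rewrite /F/= in_itv/= xt andbT ler_pdivrMr//.
    by rewrite -ler_pdivrMl// mulrC ltW.
  by move=> [n _]; rewrite /F/= in_itv/= => /andP[/(lt_le_trans (Fgt0 n)) -> ->].
have cF i : {within F i, continuous (fun s : R => s `^ (r - 1))}.
  apply: continuous_in_subspaceT => x; rewrite inE /F/= in_itv/= => /andP[xi _].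
  apply: differentiable_continuous; apply/derivable1_diffP.
  by apply: derivable_powR; rewrite in_itv/= andbT (lt_le_trans (Fgt0 i)).
have IF i : (\int[mu]_(s in F i) (s `^ (r - 1))%:E =
    (t `^ r / r - (t / i.+2%:R) `^ r / r)%:E)%E.
  have dP (x : R) : 0 < x -> derivable (fun s : R => s `^ r / r) x 1.
    by move=> x0; apply: derivableM => //; apply: derivable_powR; rewrite in_itv/= x0.
  rewrite (@continuous_FTC2 _ _ (fun s => s `^ r / r))//.
  - by rewrite ltr_pdivrMr// ltr_pMr// ltr1n.
  - exact: cF.
  - split.
    + by move=> x; rewrite in_itv/= => /andP[xi _]; apply: dP; exact: lt_trans xi.
    + by apply: cvg_at_right_filter; apply: cvgM; [exact: cvg_powR|exact: cvg_cst].
    + by apply: cvg_at_left_filter; apply: cvgM; [exact: cvg_powR|exact: cvg_cst].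
  - move=> x; rewrite in_itv/= => /andP[xi _].
    have x0 : 0 < x by exact: lt_trans xi.
    rewrite derive1E (_ : (fun s : R => s `^ r / r) = r^-1 \*: (fun s : R => s `^ r)); last first.
      by apply/funext => y /=; rewrite mulrC.
    rewrite deriveZ/=; last by apply: derivable_powR; rewrite in_itv/= x0.
    have [_ ->] := is_derive1_powR r x0.
    by rewrite /GRing.scale/= mulKf// gt_eqF.
have nd : nondecreasing_seq F.
  move=> i j ij; rewrite subsetEset => x; rewrite /F/= !in_itv/= => /andP[xi ->].
  rewrite andbT (le_trans _ xi)// ler_pM2l// lef_pV2 ?posrE ?ltr0n// ler_nat.
  by rewrite !ltnS.
have H := @ge0_nondecreasing_set_cvg_integral _ (measurableTypeR R) _ F
  (fun s : R => (s `^ (r - 1))%:E) mu nd.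
have {}H : (\int[mu]_(s in F i) (s `^ (r - 1))%:E @[i --> \oo] -->
    \int[mu]_(s in `]0%R, t]) (s `^ (r - 1))%:E)%E.
  rewrite UF; apply: H.
  - by move=> i; exact: measurable_itv.
  - by move=> i; apply/measurable_EFinP; apply: measurable_funTS; exact: measurable_powR.
  - by move=> i x _; rewrite lee_fin powR_ge0.
suff H2 : (\int[mu]_(s in F i) (s `^ (r - 1))%:E @[i --> \oo] -->
    (t `^ r / r)%:E)%E by rewrite -(cvg_lim _ H)// -(cvg_lim _ H2).
under eq_fun do rewrite IF.
apply: cvg_EFin; first by near=> n.
rewrite [X in _ --> X](_ : _ = t `^ r / r - 0 / r); last by rewrite mul0r subr0.
apply: cvgB; first exact: cvg_cst.
apply: cvgM; last exact: cvg_cst.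
have /cvg_at_rightP := powR_cvg0 r0; apply; split => //.
have Hh : (n.+2%:R^-1 : R) @[n --> \oo] --> 0.
  by rewrite (cvg_shiftS (fun n => n.+1%:R^-1 : R)); exact: cvg_harmonic.
by rewrite -[X in _ --> X](mulr0 t); apply: cvgM; [exact: cvg_cst|exact: Hh].
Unshelve. all: by end_near.
Qed.

Lemma measurable_kpow_conv p r (t : R) :
  measurable_fun [set: R] (fun s => (kpow p (t - s) * kpow r s)%:E).
Proof.
apply/measurable_EFinP; apply: measurable_funM; last exact: measurable_kpow.
exact: measurable_kpow_sub.
Qed.

Lemma integral_kpow (r t : R) : 0 < r -> 0 < t ->
  (\int[mu]_s (kpow r s * \1_(`]0, t]%classic) s)%:E = (t `^ r / r)%:E)%E.
Proof.
move=> r0 t0; rewrite -integral_powR// [in RHS]integral_mkcond.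
apply: eq_integral => s _; rewrite patchE indicE; case: ifPn => [si|_].
  rewrite mulr1 kpow_gt0//.
  by move: si; rewrite inE/= in_itv/= => /andP[].
by rewrite mulr0.
Qed.

(** The Beta function [B(r, p)], in this argument order because it arises as the convolution of two
    power kernels at 1; see [beta_fnE]. *)
Definition kbeta (p r : R) : R :=
  \int[mu]_s (kpow p (1 - s) * kpow r s).

Lemma ge0_integral_scale (c : R) (f : R -> R) : 0 <= c ->
  measurable_fun [set: R] f -> (forall x, 0 <= f x) ->
  (\int[mu]_x (c * f x)%:E = c%:E * \int[mu]_x (f x)%:E)%E.
Proof.
move=> c0 mf f0; under eq_integral do rewrite EFinM.
rewrite ge0_integralZl//.
- by apply/measurable_EFinP; exact: mf.
- by move=> x _; rewrite lee_fin.
Qed.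

Lemma ge0_integral_add (f g : R -> R) :
  measurable_fun [set: R] f -> measurable_fun [set: R] g ->
  (forall x, 0 <= f x) -> (forall x, 0 <= g x) ->
  (\int[mu]_x (f x + g x)%:E = \int[mu]_x (f x)%:E + \int[mu]_x (g x)%:E)%E.
Proof.
move=> mf mg f0 g0; under eq_integral do rewrite EFinD.
rewrite ge0_integralD//.
- by move=> x _; rewrite lee_fin.
- by apply/measurable_EFinP; exact: mf.
- by move=> x _; rewrite lee_fin.
- by apply/measurable_EFinP; exact: mg.
Qed.

(** The content is finiteness, a real integral being [fine] of the extended one. On each side of 1/2
    one factor is bounded and the other is an integrable power. *)
Lemma kbetaE (p r : R) : 0 < p -> 0 < r ->
  (\int[mu]_s (kpow p (1 - s) * kpow r s)%:E = (kbeta p r)%:E)%E.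
Proof.
move=> p0 r0; rewrite /kbeta /Rintegral fineK//.
(* A bound of [x ^ (p - 1)] on [[1/2, 1]] for every [p]: the summand 1 covers [p >= 1], the other
   one [p < 1]. *)
pose C (p : R) := 1 + (2^-1 : R) `^ (p - 1).
have C0 q : 0 <= C q by rewrite addr_ge0// powR_ge0.
have CE q x : 2^-1 <= x <= 1 -> x `^ (q - 1) <= C q.
  move=> /andP[x2 x1]; rewrite /C; have [q1|q1] := leP 1 q.
    rewrite (le_trans (ge0_ler_powR _ _ _ x1)) ?subr_ge0// ?nnegrE//.
    - by rewrite (le_trans _ x2).
    - by rewrite powR1 lerDl powR_ge0.
  rewrite (@le_trans _ _ (2^-1 `^ (q - 1)))// ?lerDr//.
  by apply: le0_ger_powR; rewrite ?x2 ?subr_le0 ?invr_gt0 ?ltW.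
pose h q (s : R) := kpow q s * \1_(`]0, 1]%classic) s.
have h0 q s : 0 <= h q s by rewrite mulr_ge0// kpow_ge0.
have mh q : measurable_fun [set: R] (h q).
  by apply: measurable_funM; [exact: measurable_kpow|exact: measurable_indic].
have mh1 q : measurable_fun [set: R] (fun s => h q (1 - s)).
  by apply: measurableT_comp => //; apply: measurable_funB.
rewrite ge0_fin_numE; last first.
  by apply: integral_ge0 => s _; rewrite lee_fin mulr_ge0// kpow_ge0.
apply: (@le_lt_trans _ _ (\int[mu]_s (C p * h r s + C r * h p (1 - s))%:E)%E).
  apply: ge0_le_integral => //.
  - by move=> s _; rewrite lee_fin mulr_ge0// kpow_ge0.
  - exact: measurable_kpow_conv.
  - apply/measurable_EFinP; apply: measurable_funD; apply: measurable_funM => //.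
    + exact: mh.
    + exact: mh1.
  move=> s _; rewrite lee_fin.
  have [s0|s0] := leP s 0.
    by rewrite (kpow_le0 _ s0) mulr0 addr_ge0// mulr_ge0.
  have [s1|s1] := leP 1 s.
    by rewrite (@kpow_le0 _ (1 - s)) ?subr_le0// mul0r addr_ge0// mulr_ge0.
  have s1' : 0 < 1 - s by rewrite subr_gt0.
  rewrite /h !indicE !mem_set/= ?in_itv/= ?s0 ?s1' ?(ltW s1) ?lerBlDr ?lerDl ?(ltW s0)//.
  rewrite !mulr1 !kpow_gt0//.
  have [s2|s2] := leP s 2^-1.
    rewrite (le_trans _ (_ : C p * s `^ (r - 1) <= _))//.
      rewrite ler_wpM2r ?powR_ge0// CE//; apply/andP; split; lra.
    by rewrite lerDl mulr_ge0// powR_ge0.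
  rewrite mulrC (le_trans _ (_ : C r * (1 - s) `^ (p - 1) <= _))//.
    rewrite ler_wpM2r ?powR_ge0// CE//; apply/andP; split; lra.
  by rewrite lerDr mulr_ge0// powR_ge0.
have mC q (g : R -> R) : measurable_fun [set: R] g ->
  measurable_fun [set: R] (fun s => C q * g s) by move=> mg; exact: measurable_funM.
rewrite ge0_integral_add; [|exact: (mC _ _ (mh _))|exact: (mC _ _ (mh1 _))|by move=> s; exact: mulr_ge0..].
rewrite !ge0_integral_scale//.
rewrite (@ge0_integral_reflect R 1 (fun s => (h p s)%:E)); last 2 first.
- by apply/measurable_EFinP; exact: mh.
- by move=> s; rewrite lee_fin.
by rewrite /h !integral_kpow// -!EFinM -EFinD ltry.
Qed.

(** The kernels are homogeneous, so the substitution [s -> t * s] reduces the convolution to its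
    value at 1. *)
Lemma integral_kpow_conv (p r t : R) : 0 < p -> 0 < r ->
  (\int[mu]_s (kpow p (t - s) * kpow r s)%:E = (kbeta p r * kpow (p + r) t)%:E)%E.
Proof.
move=> p0 r0; have [t0|t0] := leP t 0.
  rewrite (kpow_le0 _ t0) mulr0 integral0_eq// => s _.
  have [s0|s0] := leP s 0; first by rewrite (kpow_le0 _ s0) mulr0.
  by rewrite (@kpow_le0 _ (t - s)) ?mul0r// subr_le0 (le_trans t0)// ltW.
have := @ge0_integral_affine R t 0 (fun s => (kpow p (t - s) * kpow r s)%:E) t0.
move=> /(_ (measurable_kpow_conv _ _ _)) H.
transitivity (t%:E * (t^-1%:E * \int[mu]_s (kpow p (t - s) * kpow r s)%:E))%E.
  by rewrite muleA -EFinM mulfV ?gt_eqF// mul1e.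
rewrite -H; last by move=> x; rewrite lee_fin mulr_ge0// kpow_ge0.
under eq_integral => s _.
  rewrite addr0 (_ : t - t * s = t * (1 - s)); last by rewrite mulrBr mulr1.
  rewrite !kpowZ// (_ : _ * _ = (t `^ (p - 1) * t `^ (r - 1)) * (kpow p (1 - s) * kpow r s)); last by ring.
over.
rewrite ge0_integral_scale//; last 3 first.
- by rewrite mulr_ge0// powR_ge0.
- by apply: measurable_funM; [exact: measurable_kpow_sub|exact: measurable_kpow].
- by move=> x; rewrite mulr_ge0// kpow_ge0.
rewrite kbetaE// -!EFinM; congr (_%:E).
rewrite kpow_gt0// -powRD ?(gt_eqF t0) ?implybT//.
rewrite (_ : p + r - 1 = 1 + (p - 1 + (r - 1))); last by ring.
by rewrite [in RHS]powRD ?(gt_eqF t0) ?implybT// powRr1 ?ltW//; ring.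
Qed.

End power_kernel.

(** * Convolutions by Tonelli's theorem and the Gamma integral *)

Section tonelli_convolution.
Context {R : realType}.
Local Notation mu := (@lebesgue_measure R).
Local Notation R2 := (measurableTypeR R * measurableTypeR R)%type.

Lemma measurable_fst_comp (f : R -> R) : measurable_fun [set: R] f ->
  measurable_fun [set: R2] (fun z => f z.1).
Proof.
by move=> mf; apply: (measurableT_comp (f := f)) => //; exact: measurable_fst.
Qed.

Lemma measurable_snd_comp (f : R -> R) : measurable_fun [set: R] f ->
  measurable_fun [set: R2] (fun z => f z.2).
Proof.
by move=> mf; apply: (measurableT_comp (f := f)) => //; exact: measurable_snd.
Qed.

Lemma measurable_sub_comp (f : R -> R) : measurable_fun [set: R] f ->
  measurable_fun [set: R2] (fun z => f (z.1 - z.2)).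
Proof.
move=> mf; apply: (measurableT_comp (f := f)) => //.
by apply: measurable_funB; [exact: (measurable_fst_comp (f := id))|
                            exact: (measurable_snd_comp (f := id))].
Qed.

Lemma measurable_comp_subr (f : R -> R) (s : R) : measurable_fun [set: R] f ->
  measurable_fun [set: R] (fun t => f (t - s)).
Proof. by move=> mf; apply: measurableT_comp => //; exact: measurable_funB. Qed.

Lemma integral_kpow_conv_shift (p q s t : R) : 0 < p -> 0 < q ->
  (\int[mu]_r (kpow p (t - r) * kpow q (r - s))%:E =
   (kbeta p q * kpow (p + q) (t - s))%:E)%E.
Proof.
move=> p0 q0; rewrite -(integral_kpow_conv (t - s) p0 q0).
pose F r : \bar R := (kpow p (t - s - r) * kpow q r)%:E.
transitivity (\int[mu]_r F (1 * r + - s)%R)%E.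
  apply: eq_integral => r _; congr (kpow p _ * kpow q _)%:E; ring.
rewrite ge0_integral_affine ?invr1 ?mul1e//.
- exact: measurable_kpow_conv.
- by move=> x; rewrite lee_fin mulr_ge0// kpow_ge0.
Qed.

(** The semigroup law of fractional integrals for nonnegative densities: after exchanging the
    integrals, the inner one is the convolution of two power kernels. *)
Lemma integral_kpow_conv2 (p q t : R) (Y : R -> R) : 0 < p -> 0 < q ->
  measurable_fun [set: R] Y -> (forall s, 0 <= Y s) ->
  (\int[mu]_r ((kpow p (t - r))%:E * \int[mu]_s (kpow q (r - s) * Y s)%:E) =
   (kbeta p q)%:E * \int[mu]_s (kpow (p + q) (t - s) * Y s)%:E)%E.
Proof.
move=> p0 q0 mY Y0.
pose F (z : R2) : \bar R := (kpow p (t - z.1) * (kpow q (z.1 - z.2) * Y z.2))%:E.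
have mF : measurable_fun [set: R2] F.
  apply/measurable_EFinP; apply: measurable_funM.
    exact: (measurable_fst_comp (measurable_kpow_sub p t)).
  apply: measurable_funM; last exact: measurable_snd_comp.
  exact: (measurable_sub_comp (measurable_kpow q)).
have F0 z : (0 <= F z)%E by rewrite lee_fin !mulr_ge0// kpow_ge0.
transitivity (\int[mu]_r \int[mu]_s F (r, s))%E.
  apply: eq_integral => r _; rewrite -ge0_integral_scale ?kpow_ge0//.
  - apply: measurable_funM => //; exact: measurable_kpow_sub.
  - by move=> s; rewrite mulr_ge0// kpow_ge0.
rewrite fubini_tonelli//.
transitivity (\int[mu]_s (kbeta p q * (kpow (p + q) (t - s) * Y s))%:E)%E.
  apply: eq_integral => s _; rewrite /F/=.
  transitivity (\int[mu]_r (Y s * (kpow p (t - r) * kpow q (r - s)))%:E)%E.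
    by apply: eq_integral => r _; congr (_%:E); ring.
  rewrite ge0_integral_scale//.
  - by rewrite integral_kpow_conv_shift// -EFinM; congr (_%:E); ring.
  - apply: measurable_funM; first exact: measurable_kpow_sub.
    exact: (measurable_comp_subr s (measurable_kpow q)).
  - by move=> r; rewrite mulr_ge0// kpow_ge0.
rewrite ge0_integral_scale//.
- by rewrite /kbeta Rintegral_ge0// => s _; rewrite mulr_ge0// kpow_ge0.
- apply: measurable_funM => //; exact: measurable_kpow_sub.
- by move=> s; rewrite mulr_ge0// kpow_ge0.
Qed.

Lemma mem_itv0y (t : R) : (t \in `]0, +oo[%classic) = (0 < t).
Proof. by rewrite mem_setE in_itv/= andbT. Qed.

Lemma mem_itvc0y (t : R) : (t \in `[0, +oo[%classic) = (0 <= t).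
Proof. by rewrite mem_setE in_itv/= andbT. Qed.

(** Kept in the extended reals, so that the Beta-Gamma relation can be proved before finiteness is
    known. *)
Definition gamma_integral (x : R) : \bar R :=
  (\int[mu]_t (expR (- t) * kpow x t)%:E)%E.

Lemma GammaE (x : R) : Gamma x = fine (gamma_integral x).
Proof.
rewrite /Gamma /gamma_integral Rintegral_mkcond; congr fine.
apply: eq_integral => t _; rewrite patchE /kpow mem_itv0y.
by case: ifPn => _; rewrite ?mulr0// mulrC.
Qed.

Lemma measurable_expRN : measurable_fun [set: R] (fun t : R => expR (- t)).
Proof. by apply: measurableT_comp => //; exact: measurable_funN. Qed.

Lemma measurable_gamma_integrand (x : R) :
  measurable_fun [set: R] (fun t => expR (- t) * kpow x t).
Proof.
by apply: measurable_funM; [exact: measurable_expRN|exact: measurable_kpow].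
Qed.

Lemma gamma_integral_ge0 (x : R) : (0 <= gamma_integral x)%E.
Proof.
by apply: integral_ge0 => t _; rewrite lee_fin mulr_ge0 ?expR_ge0// kpow_ge0.
Qed.

(** Both sides integrate the convolution of [exp(-t) t^(p-1)] and [exp(-t) t^(q-1)]: the
    exponentials combine to [exp(-t)] and leave a power convolution, while in the other order the
    integral splits into a product. *)
Lemma gamma_integralM (p q : R) : 0 < p -> 0 < q ->
  ((kbeta p q)%:E * gamma_integral (p + q) = gamma_integral p * gamma_integral q)%E.
Proof.
move=> p0 q0.
pose F (z : R2) : \bar R := ((expR (- (z.1 - z.2)) * kpow p (z.1 - z.2)) *
   (expR (- z.2) * kpow q z.2))%:E.
have mF : measurable_fun [set: R2] F.
  apply/measurable_EFinP; apply: measurable_funM.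
    exact: (measurable_sub_comp (measurable_gamma_integrand p)).
  exact: (measurable_snd_comp (measurable_gamma_integrand q)).
have G0 (x t : R) : 0 <= expR (- t) * kpow x t by rewrite mulr_ge0 ?expR_ge0// kpow_ge0.
have F0 z : (0 <= F z)%E by rewrite lee_fin mulr_ge0.
transitivity (\int[mu]_t \int[mu]_s F (t, s))%E.
  rewrite /gamma_integral -ge0_integral_scale//; last 2 first.
  - by rewrite /kbeta Rintegral_ge0// => s _; rewrite mulr_ge0// kpow_ge0.
  - exact: measurable_gamma_integrand.
  apply: eq_integral => t _; rewrite /F/=.
  transitivity (\int[mu]_s (expR (- t) * (kpow p (t - s) * kpow q s))%:E)%E.
    rewrite ge0_integral_scale ?expR_ge0// ?integral_kpow_conv//.
    - by rewrite -EFinM; congr (_%:E); ring.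
    - by apply: measurable_funM; [exact: measurable_kpow_sub|exact: measurable_kpow].
    - by move=> s; rewrite mulr_ge0// kpow_ge0.
  apply: eq_integral => s _; congr (_%:E).
  rewrite (_ : - t = - (t - s) + - s); last by ring.
  by rewrite expRD; ring.
rewrite fubini_tonelli//.
rewrite muleC.
transitivity (\int[mu]_s ((expR (- s) * kpow q s)%:E * gamma_integral p))%E.
  apply: eq_integral => s _; rewrite /F/=.
  transitivity ((expR (- s) * kpow q s)%:E *
      \int[mu]_t (expR (- (t - s)) * kpow p (t - s))%:E)%E.
    rewrite -(@ge0_integral_scale R _
      (fun t => expR (- (t - s)) * kpow p (t - s)) (G0 q s)); first 1 last.
    - exact: (measurable_comp_subr s (measurable_gamma_integrand p)).
    - by move=> t; exact: G0.
    by apply: eq_integral => t _; congr (_%:E); ring.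
  apply: (congr1 (mule _)).
  transitivity (\int[mu]_t (expR (- (1 * t + - s)) * kpow p (1 * t + - s))%:E)%E.
    by apply: eq_integral => t _; rewrite mul1r.
  rewrite (@ge0_integral_affine R 1 (- s) (fun t => (expR (- t) * kpow p t)%:E))//.
  - by rewrite invr1 mul1e.
  - by apply/measurable_EFinP; exact: measurable_gamma_integrand.
  - by move=> x; rewrite lee_fin.
rewrite ge0_integralZr//.
- by apply/measurable_EFinP; exact: measurable_gamma_integrand.
- by move=> x _; rewrite lee_fin.
- exact: gamma_integral_ge0.
Qed.

(** The integrand is the density of the exponential law of rate 1. *)
Lemma gamma_integral1 : gamma_integral 1 = 1%E.
Proof.
rewrite /gamma_integral.
rewrite -(integral_exponential_pdf (@ltr01 R)).
transitivity (\int[mu]_(t in `]0%R, +oo[) (exponential_pdf 1 t)%:E)%E.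
  rewrite [RHS]integral_mkcond; apply: eq_integral => t _; rewrite patchE /kpow mem_itv0y.
  case: ifPn => [t0|_].
    rewrite subrr powRr0 mulr1 exponential_pdfE; last exact: ltW.
    by rewrite mul1r mulN1r.
  by rewrite mulr0.
rewrite integral_itv_obnd_cbnd; last first.
  by apply/measurable_EFinP; apply: measurable_funTS; exact: measurable_exponential_pdf.
rewrite [LHS]integral_mkcond; apply: eq_integral => t _.
rewrite patchE mem_itvc0y; case: ifPn => // t0.
by rewrite /exponential_pdf patchE mem_itvc0y (negbTE t0).
Qed.

End tonelli_convolution.

Section gamma_function.
Context {R : realType}.
Local Notation mu := (@lebesgue_measure R).

Lemma ge0_integral_mono (f g : R -> R) :
  measurable_fun [set: R] f -> measurable_fun [set: R] g ->
  (forall x, 0 <= f x) -> (forall x, f x <= g x) ->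
  (\int[mu]_x (f x)%:E <= \int[mu]_x (g x)%:E)%E.
Proof.
move=> mf mg f0 fg; apply: ge0_le_integral => //.
- by move=> x _; rewrite lee_fin.
- by apply/measurable_EFinP; exact: mf.
- by apply/measurable_EFinP; exact: mg.
- by move=> x _; rewrite lee_fin.
Qed.

Lemma kbeta_ge0 (p q : R) : 0 <= kbeta p q.
Proof. by rewrite /kbeta Rintegral_ge0// => s _; rewrite mulr_ge0// kpow_ge0. Qed.

Lemma kbetaC (p q : R) : kbeta p q = kbeta q p.
Proof.
rewrite /kbeta /Rintegral; congr fine.
rewrite -(@ge0_integral_reflect R 1 (fun s => (kpow p (1 - s) * kpow q s)%:E)).
- by apply: eq_integral => s _; congr (_%:E); rewrite subKr mulrC.
- exact: measurable_kpow_conv.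
- by move=> s; rewrite lee_fin mulr_ge0// kpow_ge0.
Qed.

Lemma kbeta1 (p : R) : 0 < p -> kbeta p 1 = p^-1.
Proof.
move=> p0; rewrite kbetaC; apply: EFin_inj; rewrite -kbetaE//.
transitivity (\int[mu]_(s in `]0%R, 1%R[) (s `^ (p - 1))%:E)%E.
  rewrite [RHS]integral_mkcond; apply: eq_integral => s _; rewrite patchE /kpow.
  rewrite mem_setE in_itv/= subr_gt0 subrr powRr0.
  by case: (ltP 0 s); case: (ltP s 1); rewrite ?mul1r ?mul0r.
rewrite integral_itv_bndo_bndc; last first.
  by apply/measurable_EFinP; apply: measurable_funTS; exact: measurable_powR.
by rewrite integral_powR// powR1 div1r.
Qed.

(** The upper bound takes the bare power on []0, 1]] and the bare exponential beyond, where
    [s^(x-1) <= 1]; the lower bound replaces the exponential by [exp(-1)] on []0, 1]]. The orders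
    [alpha], [gamma], [zeta] lie in this range; larger arguments are reached through [kbeta_Gamma]
    and [GammaS]. *)
Lemma gamma_integralE (x : R) : 0 < x <= 1 ->
  gamma_integral x = (Gamma x)%:E /\ 0 < Gamma x.
Proof.
move=> /andP[x0 x1].
have mK (g : R -> R) : measurable_fun [set: R] g ->
    measurable_fun [set: R] (fun s => g s * \1_(`]0, 1]%classic) s).
  by move=> mg; apply: measurable_funM => //; exact: measurable_indic.
have mk := mK _ (measurable_kpow x).
have k0 s : 0 <= kpow x s * \1_(`]0, 1]%classic) s by rewrite mulr_ge0// kpow_ge0.
have g0 (y s : R) : 0 <= expR (- s) * kpow y s by rewrite mulr_ge0 ?expR_ge0// kpow_ge0.
have fin : (gamma_integral x < +oo)%E.
  apply: (@le_lt_trans _ _ (\int[mu]_s (kpow x s * \1_(`]0, 1]%classic) s +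
      expR (- s) * kpow 1 s)%:E)%E).
    apply: ge0_integral_mono; first exact: measurable_gamma_integrand.
    - by apply: measurable_funD; [exact: mk|exact: measurable_gamma_integrand].
    - exact: g0.
    move=> s.
    have [s0|s0] := leP s 0; first by rewrite !(kpow_le0 _ s0) !mulr0 mul0r addr0.
    have [s1|s1] := leP s 1.
      rewrite indicE mem_set/= ?in_itv/= ?s0// mulr1.
      rewrite (@le_trans _ _ (kpow x s))//; last by rewrite lerDl.
      by rewrite ler_piMl ?kpow_ge0// -expR0 ler_expR oppr_le0 ltW.
    rewrite (@le_trans _ _ (expR (- s) * kpow 1 s))//; last by rewrite lerDr.
    rewrite ler_wpM2l ?expR_ge0// !kpow_gt0// subrr powRr0.
    apply: (@le_trans _ _ (1 `^ (x - 1))); last by rewrite powR1.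
    by apply: le0_ger_powR => //; [rewrite subr_le0|exact: ltW].
  rewrite ge0_integral_add//; last exact: measurable_gamma_integrand.
  by rewrite integral_kpow// -[X in (_ + X)%E]/(gamma_integral 1) gamma_integral1 ltry.
have finN : gamma_integral x \is a fin_num.
  by rewrite ge0_fin_numE// gamma_integral_ge0.
split; first by rewrite GammaE fineK.
rewrite GammaE -lte_fin fineK//.
apply: (@lt_le_trans _ _ (\int[mu]_s (expR (- 1) * (kpow x s * \1_(`]0, 1]%classic) s))%:E)%E).
  rewrite ge0_integral_scale ?expR_ge0// integral_kpow// -EFinM lte_fin.
  by rewrite mulr_gt0 ?expR_gt0// powR1 div1r invr_gt0.
apply: ge0_integral_mono; first by apply: measurable_funM => //; exact: mk.
- exact: measurable_gamma_integrand.
- by move=> s; rewrite mulr_ge0// expR_ge0.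
move=> s.
have [s0|s0] := leP s 0; first by rewrite !(kpow_le0 _ s0) mul0r !mulr0.
have [s1|s1] := leP s 1; last first.
  by rewrite indicE memNset ?mulr0//= in_itv/= s0/= leNgt s1.
rewrite indicE mem_set/= ?in_itv/= ?s0// mulr1.
by rewrite ler_wpM2r ?kpow_ge0// ler_expR lerN2.
Qed.

(** If it vanished, the product of two positive Gamma values would be 0, whatever
    [gamma_integral (p + q)] is, since [0 * +oo = 0]. *)
Lemma kbeta_gt0 (p q : R) : 0 < p <= 1 -> 0 < q <= 1 -> 0 < kbeta p q.
Proof.
move=> hp hq; have [p0 _] := andP hp; have [q0 _] := andP hq.
have [Ep Gp] := gamma_integralE hp; have [Eq Gq] := gamma_integralE hq.
have := gamma_integralM p0 q0; rewrite Ep Eq => H.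
rewrite lt_neqAle kbeta_ge0 andbT; apply/eqP => b0; move: H.
rewrite -b0 mul0e -EFinM => -[] /eqP; rewrite eq_sym mulf_eq0.
by rewrite (gt_eqF Gp) (gt_eqF Gq).
Qed.

(** A positive [kbeta p q] times [gamma_integral (p + q)] is finite, which forces the latter to be
    finite: no separate estimate is made on []1, 2]]. *)
Lemma kbeta_Gamma (p q : R) : 0 < p <= 1 -> 0 < q <= 1 ->
  kbeta p q * Gamma (p + q) = Gamma p * Gamma q /\ 0 < Gamma (p + q).
Proof.
move=> hp hq; have [p0 _] := andP hp; have [q0 _] := andP hq.
have [Ep Gp] := gamma_integralE hp; have [Eq Gq] := gamma_integralE hq.
have b0 := kbeta_gt0 hp hq.
have := gamma_integralM p0 q0; rewrite Ep Eq => H.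
have fin : gamma_integral (p + q) \is a fin_num.
  rewrite ge0_fin_numE ?gamma_integral_ge0// ltey; apply/eqP => E.
  by move: H; rewrite E gt0_muley ?lte_fin// -EFinM.
have GE : (Gamma (p + q))%:E = gamma_integral (p + q) by rewrite GammaE (fineK fin).
have {}H : kbeta p q * Gamma (p + q) = Gamma p * Gamma q.
  by apply: EFin_inj; rewrite [LHS]EFinM GE [RHS]EFinM H.
split; first exact: H.
by have := mulr_gt0 Gp Gq; rewrite -H (pmulr_rgt0 _ b0).
Qed.

Lemma Gamma_gt0 (p : R) : 0 < p <= 1 -> 0 < Gamma p.
Proof. by move=> /gamma_integralE[]. Qed.

Lemma Gamma1 : Gamma 1 = 1 :> R.
Proof. by rewrite GammaE gamma_integral1. Qed.

(** The Beta-Gamma relation at [q = 1], where the Beta integral is [1 / p]; no integration by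
    parts. *)
Lemma GammaS (p : R) : 0 < p <= 1 -> Gamma (p + 1) = p * Gamma p.
Proof.
move=> hp; have [p0 _] := andP hp.
have h1 : (0 < 1 :> R) && (1 <= 1 :> R) by rewrite ltr01 lexx.
have [+ _] := kbeta_Gamma hp h1; rewrite (kbeta1 p0) Gamma1 mulr1 => <-.
by rewrite (mulVKf (lt0r_neq0 p0)).
Qed.

End gamma_function.

(** * Integrals bounded by nonnegative majorants *)

Section dominated_integrals.
Context {R : realType}.
Local Notation mu := (@lebesgue_measure R).
Implicit Types (f g h : R -> R) (B : R).

Lemma integrable_of_bound h g B :
  measurable_fun [set: R] h -> measurable_fun [set: R] g ->
  (forall s, `|h s| <= g s) -> (\int[mu]_s (g s)%:E <= B%:E)%E ->
  mu.-integrable [set: R] (EFin \o h).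
Proof.
move=> mh mg hg gB; apply/integrableP; split.
  by apply/measurable_EFinP; exact: mh.
apply: le_lt_trans (ltry B); apply: le_trans gB.
have := @ge0_integral_mono R (fun s => `|h s|) g _ mg (fun s => normr_ge0 _) hg.
by apply; exact: measurableT_comp.
Qed.

(* The second majorant [g2] lets a bound be split as [g1 - g2] without ever
   integrating a function of variable sign. *)
Lemma norm_Rintegral_le h g1 g2 B1 B2 :
  measurable_fun [set: R] h -> measurable_fun [set: R] g1 ->
  measurable_fun [set: R] g2 -> (forall s, 0 <= g2 s) ->
  (forall s, `|h s| + g2 s <= g1 s) ->
  (\int[mu]_s (g1 s)%:E <= B1%:E)%E -> (\int[mu]_s (g2 s)%:E = B2%:E)%E ->
  `|\int[mu]_s h s| <= B1 - B2.
Proof.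
move=> mh m1 m2 g20 hg g1B g2B.
have hg1 s : `|h s| <= g1 s by apply: le_trans (hg s); rewrite lerDl.
have ih := integrable_of_bound mh m1 hg1 g1B.
have mah : measurable_fun [set: R] (fun s => `|h s|) by exact: measurableT_comp.
have iah : mu.-integrable [set: R] (EFin \o (fun s => `|h s|)).
  by apply: (integrable_of_bound mah m1 _ g1B) => s; rewrite normr_id.
rewrite lerBrDr (le_trans (lerD (le_normr_Rintegral _ ih) (lexx _)))//.
rewrite -lee_fin EFinD -g2B; apply: le_trans g1B.
rewrite /Rintegral fineK; last exact: integrable_fin_num.
rewrite -ge0_integral_add//.
apply: ge0_integral_mono => //; first exact: measurable_funD.
by move=> s; rewrite addr_ge0.
Qed.

Lemma norm_Rintegral_le1 h g B :
  measurable_fun [set: R] h -> measurable_fun [set: R] g ->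
  (forall s, `|h s| <= g s) -> (\int[mu]_s (g s)%:E <= B%:E)%E ->
  `|\int[mu]_s h s| <= B.
Proof.
move=> mh mg hg gB; rewrite -[leRHS]subr0.
apply: (@norm_Rintegral_le h g (fun=> 0) B 0) => //.
- by move=> s; rewrite addr0.
- by rewrite integral0.
Qed.

Lemma integral_indic_lt_le f (x : R) : measurable_fun [set: R] f ->
  (\int[mu]_s (f s * (s <= x)%R%:R)%:E = \int[mu]_s (f s * (s < x)%R%:R)%:E)%E.
Proof.
move=> mf; transitivity (\int[mu]_(s in `]-oo, x]) (f s)%:E)%E.
  rewrite [RHS]integral_mkcond; apply: eq_integral => s _.
  by rewrite patchE mem_setE in_itv/=; case: (s <= x); rewrite ?mulr1 ?mulr0.
rewrite -integral_itv_bndo_bndc; last first.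
  by apply/measurable_EFinP; apply: measurable_funTS; exact: mf.
rewrite [LHS]integral_mkcond; apply: eq_integral => s _.
by rewrite patchE mem_setE in_itv/=; case: (s < x); rewrite ?mulr1 ?mulr0.
Qed.

Lemma measurable_ltr (x : R) : measurable_fun [set: R] (fun s : R => (s < x)%R%:R : R).
Proof.
rewrite (_ : (fun _ => _) = \1_(`]-oo, x[%classic)); first exact: measurable_indic.
by apply/funext => s; rewrite indicE mem_setE in_itv.
Qed.

Lemma measurable_ler (x : R) : measurable_fun [set: R] (fun s : R => (s <= x)%R%:R : R).
Proof.
rewrite (_ : (fun _ => _) = \1_(`]-oo, x]%classic)); first exact: measurable_indic.
by apply/funext => s; rewrite indicE mem_setE in_itv.
Qed.

Lemma measurable_ger (x : R) : measurable_fun [set: R] (fun s : R => (x <= s)%R%:R : R).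
Proof.
rewrite (_ : (fun _ => _) = \1_(`[x, +oo[%classic)); first exact: measurable_indic.
by apply/funext => s; rewrite indicE mem_setE in_itv/= andbT.
Qed.

End dominated_integrals.

(** * Incomplete Beta integrals *)

Section incomplete_beta.
Context {R : realType}.
Local Notation mu := (@lebesgue_measure R).
Implicit Types p q x t T : R.

Lemma measurable_beta_kernel p q t :
  measurable_fun [set: R] (fun s => kpow p (t - s) * kpow q s).
Proof. by apply: measurable_funM; [exact: measurable_kpow_sub|exact: measurable_kpow]. Qed.

Lemma beta_kernel_ge0 p q t s : 0 <= kpow p (t - s) * kpow q s :> R.
Proof. by rewrite mulr_ge0// kpow_ge0. Qed.

(** [inc_beta] integrates over a closed interval, where powers of 0 take default values that differ
    from the kernels; these endpoints are null sets. *)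
Lemma inc_betaE p q x : 0 < p -> 0 < q -> 0 <= x <= 1 ->
  (\int[mu]_s (kpow q (1 - s) * kpow p s * (s < x)%R%:R)%:E = (inc_beta x p q)%:E)%E.
Proof.
move=> p0 q0 /andP[x0 x1].
have fin : (\int[mu]_s (kpow q (1 - s) * kpow p s * (s < x)%R%:R)%:E \is a fin_num)%E.
  rewrite ge0_fin_numE; last first.
    by apply: integral_ge0 => s _; rewrite lee_fin mulr_ge0// beta_kernel_ge0.
  apply: le_lt_trans (ltry (kbeta q p)); rewrite -kbetaE//.
  apply: ge0_integral_mono.
  - by apply: measurable_funM; [exact: measurable_beta_kernel|exact: measurable_ltr].
  - exact: measurable_beta_kernel.
  - by move=> s; rewrite mulr_ge0// beta_kernel_ge0.
  - by move=> s; rewrite ler_piMr ?beta_kernel_ge0// lern1 leq_b1.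
rewrite -(fineK fin); congr (_%:E); rewrite /inc_beta /Rintegral; congr fine.
have mF : measurable_fun [set: R] (fun t => t `^ (p - 1) * (1 - t) `^ (q - 1)).
  apply: measurable_funM; first exact: measurable_powR.
  apply: (measurableT_comp (f := fun t => t `^ (q - 1))); first exact: measurable_powR.
  exact: measurable_funB.
rewrite -integral_itv_bndo_bndc; last first.
  by apply/measurable_EFinP; apply: measurable_funTS; exact: mF.
rewrite -integral_itv_obnd_cbnd; last first.
  by apply/measurable_EFinP; apply: measurable_funTS; exact: mF.
rewrite [RHS]integral_mkcond; apply: eq_integral => s _.
rewrite patchE mem_setE in_itv/=.
have [s0|s0] := leP s 0; first by rewrite (kpow_le0 _ s0) mulr0 mul0r.
have [sx|sx] := ltP s x; last by rewrite mulr0.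
rewrite mulr1 mulrC !kpow_gt0// subr_gt0.
exact: lt_le_trans x1.
Qed.

(** The complete integral is cut at [x], and the part beyond [x] is reflected by [s -> 1 - s]; this
    is how the second incomplete integral of [xi] arises. *)
Lemma inc_beta_compl p q x : 0 < p -> 0 < q -> 0 <= x <= 1 ->
  inc_beta x p q + inc_beta (1 - x) q p = kbeta q p.
Proof.
move=> p0 q0 /andP[x0 x1]; apply: EFin_inj; rewrite EFinD -kbetaE// -!inc_betaE//; last 2 first.
- by rewrite subr_ge0 x1 lerBlDr lerDl.
- by rewrite x0.
have mb r r' t := measurable_beta_kernel r r' t.
transitivity (\int[mu]_s (kpow q (1 - s) * kpow p s * (s <= x)%R%:R)%:E +
   \int[mu]_s (kpow q (1 - s) * kpow p s * (x < s)%R%:R)%:E)%E.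
  congr (_ + _)%E; first by rewrite integral_indic_lt_le.
  rewrite -(@ge0_integral_reflect R 1); last 2 first.
  - apply/measurable_EFinP; apply: measurable_funM; [exact: mb|exact: measurable_ltr].
  - by move=> s; rewrite lee_fin mulr_ge0// beta_kernel_ge0.
  by apply: eq_integral => s _; rewrite subKr ltrD2l ltrN2 (mulrC (kpow p _)).
rewrite -ge0_integral_add.
- apply: eq_integral => s _; rewrite -mulrDr; case: leP => _; by rewrite ?addr0 ?add0r mulr1.
- by apply: measurable_funM; [exact: mb|exact: measurable_ler].
- apply: measurable_funM; first exact: mb.
  rewrite (_ : (fun _ => _) = \1_(`]x, +oo[%classic)); first exact: measurable_indic.
  by apply/funext => s; rewrite indicE mem_setE in_itv/= andbT.
- by move=> s; rewrite mulr_ge0// beta_kernel_ge0.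
- by move=> s; rewrite mulr_ge0// beta_kernel_ge0.
Qed.

Lemma inc_beta_ge0 p q x : 0 <= inc_beta x p q.
Proof. by rewrite /inc_beta Rintegral_ge0// => s _; rewrite mulr_ge0// powR_ge0. Qed.

Lemma inc_beta_le p q x : 0 < p -> 0 < q -> 0 <= x <= 1 -> inc_beta x p q <= kbeta q p.
Proof. by move=> p0 q0 x01; rewrite -(inc_beta_compl p0 q0 x01) lerDl inc_beta_ge0. Qed.

Lemma beta_fnE p q : 0 < p -> 0 < q -> beta_fn p q = kbeta q p.
Proof.
move=> p0 q0; rewrite /beta_fn -(@inc_beta_compl p q 1)// ?ler01 ?lexx// subrr.
rewrite [X in _ + X](_ : _ = 0) ?addr0//.
by rewrite /inc_beta set_itv1 Rintegral_set1.
Qed.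

Lemma integral_inc_beta p q t T : 0 < p -> 0 < q -> 0 < t <= T ->
  (\int[mu]_s (kpow q (T - s) * kpow p s * (s < t)%R%:R)%:E =
   (T `^ (p + q - 1) * inc_beta (t / T) p q)%:E)%E.
Proof.
move=> p0 q0 /andP[t0 tT]; have T0 := lt_le_trans t0 tT.
pose F (s : R) := kpow q (T - s) * kpow p s * (s < t)%R%:R.
have mF : measurable_fun [set: R] F.
  by apply: measurable_funM; [exact: measurable_beta_kernel|exact: measurable_ltr].
have F0 s : 0 <= F s by rewrite mulr_ge0// beta_kernel_ge0.
transitivity (T%:E * (T^-1%:E * \int[mu]_s (F s)%:E))%E.
  by rewrite muleA -EFinM mulfV ?gt_eqF// mul1e.
rewrite -(@ge0_integral_affine R T 0 (fun s => (F s)%:E) T0); last 2 first.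
- by apply/measurable_EFinP; exact: mF.
- by move=> s; rewrite lee_fin.
transitivity (T%:E * \int[mu]_s ((T `^ (p - 1) * T `^ (q - 1)) *
    (kpow q (1 - s) * kpow p s * (s < t / T)%R%:R))%:E)%E.
  congr (_ * _)%E; apply: eq_integral => s _; rewrite /F addr0.
  rewrite (_ : T - T * s = T * (1 - s)); last by rewrite mulrBr mulr1.
  by rewrite !kpowZ// ltr_pdivlMr// (mulrC T s); congr (_%:E); ring.
rewrite ge0_integral_scale; last 3 first.
- by rewrite mulr_ge0// powR_ge0.
- by apply: measurable_funM; [exact: measurable_beta_kernel|exact: measurable_ltr].
- by move=> s; rewrite mulr_ge0// beta_kernel_ge0.
rewrite inc_betaE//; last by rewrite ler_pdivrMr// mul1r tT divr_ge0// ltW.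
rewrite -!EFinM; congr (_%:E); rewrite mulrA; congr (_ * _).
rewrite (_ : p + q - 1 = 1 + ((p - 1) + (q - 1))); last by ring.
by rewrite !powRD ?(gt_eqF T0) ?implybT// powRr1// ltW.
Qed.

End incomplete_beta.

(** * Riemann-Liouville integrals as convolutions on the line *)

Section convolution.
Context {R : realType}.
Local Notation mu := (@lebesgue_measure R).
Implicit Types (p a g z s t T M : R) (Y : R -> R).

(** The Riemann-Liouville integral without its factor [1 / Gamma p]. The lower limit is encoded in
    [Y], by truncation. *)
Definition rconv p Y t : R := \int[mu]_s (kpow p (t - s) * Y s).

(** A weighted sup bound [M] for a function extended by 0: [kpow g] vanishes on the nonpositive
    reals, so [Y] does as well. *)
Definition dominated g M Y : Prop :=
  measurable_fun [set: R] Y /\ forall s, `|Y s| <= M * kpow g s.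

Lemma dominated_npos g M Y s : dominated g M Y -> s <= 0 -> Y s = 0.
Proof. by move=> [_ /(_ s)] h s0; move: h; rewrite kpow_le0// mulr0 normr_le0 => /eqP. Qed.

Lemma dominated_kpow g : dominated g 1 (kpow g).
Proof.
split; first exact: measurable_kpow.
by move=> s; rewrite mul1r ger0_norm ?kpow_ge0.
Qed.

Lemma measurable_rconv_integrand p Y t : measurable_fun [set: R] Y ->
  measurable_fun [set: R] (fun s => kpow p (t - s) * Y s).
Proof. by move=> mY; apply: measurable_funM => //; exact: measurable_kpow_sub. Qed.

Lemma rconv_integrand_le p g M Y t s : dominated g M Y ->
  `|kpow p (t - s) * Y s| <= M * (kpow p (t - s) * kpow g s).
Proof.
move=> [_ hY]; rewrite normrM ger0_norm ?kpow_ge0// mulrCA.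
by rewrite ler_wpM2l ?kpow_ge0.
Qed.

Lemma integral_beta_kernelZ p g t M : 0 < p -> 0 < g -> 0 <= M ->
  (\int[mu]_s (M * (kpow p (t - s) * kpow g s))%:E =
   (M * (kbeta p g * kpow (p + g) t))%:E)%E.
Proof.
move=> p0 g0 M0; rewrite ge0_integral_scale//.
- by rewrite integral_kpow_conv.
- exact: measurable_beta_kernel.
- by move=> s; exact: beta_kernel_ge0.
Qed.

Lemma measurable_beta_kernelZ p g t M :
  measurable_fun [set: R] (fun s => M * (kpow p (t - s) * kpow g s)).
Proof. by apply: measurable_funM => //; exact: measurable_beta_kernel. Qed.

Lemma integrable_rconv p g M Y t : 0 < p -> 0 < g -> 0 <= M -> dominated g M Y ->
  mu.-integrable [set: R] (EFin \o (fun s => kpow p (t - s) * Y s)).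
Proof.
move=> p0 g0 M0 hY.
apply: (@integrable_of_bound R _ (fun s => M * (kpow p (t - s) * kpow g s))
  (M * (kbeta p g * kpow (p + g) t))).
- by apply: measurable_rconv_integrand; case: hY.
- exact: measurable_beta_kernelZ.
- by move=> s; exact: rconv_integrand_le.
- by rewrite integral_beta_kernelZ.
Qed.

Lemma rconv_le p g M Y t : 0 < p -> 0 < g -> 0 <= M -> dominated g M Y ->
  `|rconv p Y t| <= M * (kbeta p g * kpow (p + g) t).
Proof.
move=> p0 g0 M0 hY.
apply: (@norm_Rintegral_le1 R _ (fun s => M * (kpow p (t - s) * kpow g s))).
- by apply: measurable_rconv_integrand; case: hY.
- exact: measurable_beta_kernelZ.
- by move=> s; exact: rconv_integrand_le.
- by rewrite integral_beta_kernelZ.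
Qed.

Lemma rconvB p g M M' Y Y' t : 0 < p -> 0 < g -> 0 <= M -> 0 <= M' ->
  dominated g M Y -> dominated g M' Y' ->
  rconv p (fun s => Y s - Y' s) t = rconv p Y t - rconv p Y' t.
Proof.
move=> p0 g0 M0 M0' hY hY'; rewrite /rconv -RintegralB//.
- by apply: eq_Rintegral => s _; rewrite mulrBr.
- exact: (integrable_rconv t p0 g0 M0 hY).
- exact: (integrable_rconv t p0 g0 M0' hY').
Qed.

Lemma rconvZ p g M Y c t : 0 < p -> 0 < g -> 0 <= M -> dominated g M Y ->
  rconv p (fun s => c * Y s) t = c * rconv p Y t.
Proof.
move=> p0 g0 M0 hY; rewrite /rconv -RintegralZl//.
- by apply: eq_Rintegral => s _; rewrite mulrCA.
- exact: (integrable_rconv t p0 g0 M0 hY).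
Qed.

Lemma eq_rconv p Y Y' t : (forall s, s < t -> Y s = Y' s) -> rconv p Y t = rconv p Y' t.
Proof.
move=> e; apply: eq_Rintegral => s _; have [st|st] := ltP s t; first by rewrite e.
by rewrite kpow_le0 ?mul0r// subr_le0.
Qed.

Lemma rconv_npos p g M Y t : dominated g M Y -> t <= 0 -> rconv p Y t = 0.
Proof.
move=> hY t0; rewrite (@eq_rconv _ _ (fun=> 0)).
  by rewrite /rconv /Rintegral integral0_eq// => s _; rewrite mulr0.
by move=> s st; apply: (dominated_npos hY); rewrite (le_trans _ t0)// ltW.
Qed.

Lemma rconv_kpow p g t : 0 < p -> 0 < g -> rconv p (kpow g) t = kbeta p g * kpow (p + g) t.
Proof. by move=> p0 g0; rewrite /rconv /Rintegral integral_kpow_conv. Qed.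

End convolution.

Lemma ler_powR_base (R : realType) (r x y : R) :
  0 <= r -> 0 <= x -> x <= y -> x `^ r <= y `^ r.
Proof.
move=> r0 x0 xy; apply: ge0_ler_powR; rewrite ?nnegrE//.
exact: le_trans xy.
Qed.

(** With [x = t / t'] in []0, 1[] and an exponent at most 1, [x <= x^z] and [1 - x <= (1 - x)^z];
    adding them gives the claim after scaling by [t']. *)
Lemma powR_subD (R : realType) (z t t' : R) : 0 < z -> z <= 1 -> 0 <= t ->
  t <= t' -> t' `^ z - t `^ z <= (t' - t) `^ z.
Proof.
move=> z0 z1 t0 tt'; have [t'0|t'0] := leP t' 0.
  have -> : t' = 0 by apply/eqP; rewrite eq_le t'0 (le_trans t0).
  by rewrite powR0 ?gt_eqF// sub0r (le_trans _ (powR_ge0 _ _))// oppr_le0 powR_ge0.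
have := t0; rewrite le_eqVlt => /predU1P[<-|t00].
  by rewrite powR0 ?gt_eqF// !subr0.
have := tt'; rewrite le_eqVlt => /predU1P[->|tt'1].
  by rewrite !subrr powR_ge0.
have x0 : 0 < t / t' by rewrite divr_gt0.
have x1 : t / t' < 1 by rewrite ltr_pdivrMr// mul1r.
have y0 : 0 < 1 - t / t' by rewrite subr_gt0.
rewrite lerBlDr [X in X `^ _ + _](_ : _ = t' * (1 - t / t')); last first.
  by rewrite mulrBr mulr1 mulrCA divff ?mulr1// gt_eqF.
rewrite [X in _ <= _ + X `^ _](_ : _ = t' * (t / t')); last first.
  by rewrite mulrCA divff ?mulr1// gt_eqF.
rewrite (@powRM _ t' (1 - t / t')) ?(ltW t'0) ?(ltW y0)//.
rewrite (@powRM _ t' (t / t')) ?(ltW t'0) ?(ltW x0)// -mulrDr ler_peMr ?powR_ge0//.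
rewrite -[leLHS](subrK (t / t') 1).
by apply: lerD; apply: ger1_powR => //; rewrite ?x0 ?y0 ?(ltW x1)// gerBl ltW.
Qed.

(** * Moduli of continuity of weighted convolutions *)

Section weighted_convolution.
Context {R : realType}.
Local Notation mu := (@lebesgue_measure R).
Variables (p g : R).
Hypotheses (p0 : 0 < p) (pg : p <= g) (g1 : g <= 1).
Implicit Types (s t e M : R) (Y : R -> R).

Let g0 : 0 < g. Proof. exact: lt_le_trans pg. Qed.

(** The weighted kernel is [(t / (t - s))^(1-g) * (t - s)^(p-g)], and both factors decrease in [t]
    because [p <= g <= 1]. *)
Lemma weighted_kernel_decr s t t' : 0 < s -> s < t -> t <= t' ->
  t' `^ (1 - g) * kpow p (t' - s) <= t `^ (1 - g) * kpow p (t - s).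
Proof.
move=> s0 st tt'; have t0 := lt_trans s0 st.
have t'0 := lt_le_trans t0 tt'.
have ts0 : 0 < t - s by rewrite subr_gt0.
have t's0 : 0 < t' - s by rewrite subr_gt0 (lt_le_trans st).
have E x : 0 < x -> 0 < x - s ->
    x `^ (1 - g) * kpow p (x - s) = (x / (x - s)) `^ (1 - g) * (x - s) `^ (p - g).
  move=> x0 xs0; rewrite kpow_gt0// powRM ?invr_ge0 ?ltW//.
  rewrite -(powR_inv1 (ltW xs0)) -powRrM -mulrA -powRD ?(gt_eqF xs0) ?implybT//.
  by congr (_ * _ `^ _); ring.
rewrite !E//; apply: ler_pM; rewrite ?powR_ge0//.
  apply: ler_powR_base; rewrite ?subr_ge0 ?divr_ge0 ?(ltW t'0) ?(ltW t's0)//.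
  rewrite ler_pdivrMr// mulrAC ler_pdivlMr//; nra.
by apply: le0_ger_powR => //; [rewrite subr_le0|rewrite lerD2r].
Qed.

Lemma integral_kpow_tail t t' : t <= t' ->
  (\int[mu]_s (kpow p (t' - s) * (t <= s)%R%:R)%:E = ((t' - t) `^ p / p)%:E)%E.
Proof.
move=> tt'.
transitivity (\int[mu]_s (kpow p s * (s <= t' - t)%R%:R)%:E)%E.
  rewrite -[RHS](@ge0_integral_reflect R t'); last 2 first.
  - apply/measurable_EFinP; apply: measurable_funM; first exact: measurable_kpow.
    exact: measurable_ler.
  - by move=> s; rewrite lee_fin mulr_ge0// kpow_ge0.
  by apply: eq_integral => s _; rewrite lerD2l lerN2.
move: tt'; rewrite le_eqVlt => /predU1P[->|tt'].
  rewrite subrr powR0 ?gt_eqF// mul0r integral0_eq// => s _.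
  by case: leP => [/kpow_le0 ->|_]; rewrite ?mul0r ?mulr0.
rewrite -integral_kpow ?subr_gt0//; apply: eq_integral => s _.
rewrite indicE mem_setE in_itv/=; have [s0|s0] := leP s 0; last by [].
by rewrite kpow_le0// !mul0r.
Qed.

Lemma beta_kernel_tail t t' : 0 < t -> t <= t' ->
  (\int[mu]_s (kpow p (t' - s) * kpow g s * (t <= s)%R%:R)%:E <=
   (t `^ (g - 1) * ((t' - t) `^ p / p))%:E)%E.
Proof.
move=> t0 tt'; rewrite EFinM -integral_kpow_tail// -ge0_integral_scale ?powR_ge0//.
- apply: ge0_integral_mono.
  + by apply: measurable_funM; [exact: measurable_beta_kernel|exact: measurable_ger].
  + apply: measurable_funM => //; apply: measurable_funM; last exact: measurable_ger.
    exact: measurable_kpow_sub.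
  + by move=> s; rewrite mulr_ge0// beta_kernel_ge0.
  + move=> s; have [ts|ts] := leP t s; last by rewrite !mulr0.
    rewrite !mulr1 mulrC ler_wpM2r ?kpow_ge0// kpow_gt0; last exact: lt_le_trans ts.
    by apply: le0_ger_powR => //; rewrite subr_le0.
- by apply: measurable_funM; [exact: measurable_kpow_sub|exact: measurable_ger].
- by move=> s; rewrite mulr_ge0// kpow_ge0.
Qed.

Lemma weighted_beta t : 0 < t -> t `^ (1 - g) * kpow (p + g) t = t `^ p.
Proof.
by move=> t0; rewrite kpow_gt0// -powRD ?(gt_eqF t0) ?implybT//; congr (_ `^ _); ring.
Qed.

(* The weighted kernel decreases in [t] for [s < t]: its variation there is a
   difference of complete Beta integrals, and only the tail [t <= s] is left. *)
Lemma weighted_rconv_diff M Y t t' B : 0 <= M -> dominated g M Y ->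
  0 <= t -> t <= t' ->
  (\int[mu]_s (kpow p (t' - s) * kpow g s * (t <= s)%R%:R)%:E <= B%:E)%E ->
  `|t' `^ (1 - g) * rconv p Y t' - t `^ (1 - g) * rconv p Y t| <=
  2 * M * (t' `^ (1 - g) * B).
Proof.
move=> M0 hY t0 tt' hB; have [mY hYs] := hY.
pose w := t `^ (1 - g); pose w' := t' `^ (1 - g).
have w0 : 0 <= w by exact: powR_ge0.
have w'0 : 0 <= w' by exact: powR_ge0.
pose h s := w' * (kpow p (t' - s) * Y s) - w * (kpow p (t - s) * Y s).
have hE : \int[mu]_s h s = w' * rconv p Y t' - w * rconv p Y t.
  rewrite /rconv -RintegralZl//; last exact: (integrable_rconv t' p0 g0 M0 hY).
  rewrite -RintegralZl//; last exact: (integrable_rconv t p0 g0 M0 hY).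
  rewrite -RintegralB//.
  - exact: (integrableZl _ _ (integrable_rconv t' p0 g0 M0 hY)).
  - exact: (integrableZl _ _ (integrable_rconv t p0 g0 M0 hY)).
rewrite -/w -/w' -hE.
pose k1 s := (M * w) * (kpow p (t - s) * kpow g s).
pose k2 s := (2 * M * w') * (kpow p (t' - s) * kpow g s * (t <= s)%R%:R).
pose g2 s := (M * w') * (kpow p (t' - s) * kpow g s).
have Mw : 0 <= M * w by rewrite mulr_ge0.
have Mw' : 0 <= M * w' by rewrite mulr_ge0.
have Mw2 : 0 <= 2 * M * w' by rewrite mulr_ge0// mulr_ge0.
have mt : measurable_fun [set: R] (fun s => kpow p (t' - s) * kpow g s * (t <= s)%R%:R).
  by apply: measurable_funM; [exact: measurable_beta_kernel|exact: measurable_ger].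
have tt0 s : 0 <= kpow p (t' - s) * kpow g s * (t <= s)%R%:R.
  by rewrite mulr_ge0// beta_kernel_ge0.
have key : `|\int[mu]_s h s| <=
    (M * w * (kbeta p g * kpow (p + g) t) + 2 * M * w' * B)
    - M * w' * (kbeta p g * kpow (p + g) t').
  apply: (@norm_Rintegral_le R h (fun s => k1 s + k2 s) g2).
  - apply: measurable_funB; apply: measurable_funM => //; exact: measurable_rconv_integrand.
  - apply: measurable_funD; first exact: measurable_beta_kernelZ.
    by apply: measurable_funM => //; exact: mt.
  - exact: measurable_beta_kernelZ.
  - by move=> s; rewrite /g2 mulr_ge0// beta_kernel_ge0.
  - move=> s; have [s0|s0] := leP s 0.
      rewrite /h /g2 /k1 /k2 (dominated_npos hY s0) (kpow_le0 _ s0).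
      by rewrite !(mulr0, mul0r) subrr normr0 addr0.
    have k0 : 0 <= kpow g s by exact: kpow_ge0.
    rewrite (_ : h s = (w' * kpow p (t' - s) - w * kpow p (t - s)) * Y s); last first.
      by rewrite /h; move: (kpow _ _) (kpow _ _) => x y; ring.
    rewrite normrM (le_trans (lerD (ler_wpM2l (normr_ge0 _) (hYs s)) (lexx _)))//.
    have A'0 : 0 <= w' * kpow p (t' - s) by rewrite mulr_ge0// kpow_ge0.
    have [ts|st] := leP t s.
      have -> : kpow p (t - s) = 0 by rewrite kpow_le0// subr_le0.
      rewrite mulr0 subr0 ger0_norm// /g2 /k1 /k2 ts mulr1.
      rewrite (_ : kpow p (t - s) = 0) ?mul0r ?mulr0 ?add0r; last first.
        by rewrite kpow_le0// subr_le0.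
      by move: (kpow _ _) (kpow _ _) => x y; rewrite le_eqVlt; apply/orP; left; apply/eqP; ring.
    have dec : w' * kpow p (t' - s) <= w * kpow p (t - s) by exact: weighted_kernel_decr.
    rewrite distrC ger0_norm ?subr_ge0// /k2 (leNgt t s) st/= !mulr0 addr0 /g2 /k1.
    by move: (kpow _ _) (kpow _ _) (kpow _ _) => x y u; rewrite le_eqVlt; apply/orP; left; apply/eqP; ring.
  - rewrite ge0_integral_add.
    + rewrite integral_beta_kernelZ// ge0_integral_scale// EFinD leeD2l//.
      by rewrite [leRHS]EFinM lee_wpmul2l// lee_fin.
    + exact: measurable_beta_kernelZ.
    + by apply: measurable_funM => //; exact: mt.
    + by move=> s; rewrite mulr_ge0// beta_kernel_ge0.
    + by move=> s; exact: mulr_ge0.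
  - by rewrite integral_beta_kernelZ.
apply: (le_trans key).
(* The complete Beta integrals contribute [M * kbeta p g] times [t^p - t'^p], which is at most 0, so
   only the tail term remains. *)
rewrite [2 * M * (w' * B)]mulrA lerBlDr addrC lerD2l -!mulrA ler_wpM2l//.
rewrite mulrCA [leRHS]mulrCA ler_wpM2l ?kbeta_ge0//.
have [t00|t00] := leP t 0.
  by rewrite (kpow_le0 _ t00) mulr0 mulr_ge0// kpow_ge0.
rewrite !weighted_beta//; last exact: lt_le_trans tt'.
by apply: ler_powR_base => //; exact: ltW.
Qed.

Definition holder_cst : R := 2 * (2 / p + 2 * kbeta p g).

(** The estimate [beta_kernel_tail] brings in the factor [(t' / t)^(1-g)], unbounded near [t = 0].
    It is at most 2 if [t' <= 2 t]. Otherwise [t' < 2 (t' - t)], and the complete Beta integral is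
    already of order [(t' - t)^p]. The constant [holder_cst] adds both cases. *)
Lemma weighted_rconv_holder M Y t t' : 0 <= M -> dominated g M Y ->
  0 <= t -> t <= t' ->
  `|t' `^ (1 - g) * rconv p Y t' - t `^ (1 - g) * rconv p Y t| <=
  M * holder_cst * (t' - t) `^ p.
Proof.
move=> M0 hY t0 tt'.
suff [B [hB wB]] : exists B,
    (\int[mu]_s (kpow p (t' - s) * kpow g s * (t <= s)%R%:R)%:E <= B%:E)%E /\
    t' `^ (1 - g) * B <= (2 / p + 2 * kbeta p g) * (t' - t) `^ p.
  apply: (le_trans (weighted_rconv_diff M0 hY t0 tt' hB)).
  rewrite /holder_cst [leRHS](_ : _ = 2 * M * ((2 / p + 2 * kbeta p g) * (t' - t) `^ p)); last by ring.
  by rewrite ler_wpM2l// mulr_ge0.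
have X0 : 0 <= (t' - t) `^ p by exact: powR_ge0.
have p1 : p <= 1 by exact: le_trans g1.
have [t2|t2] := ltP t (t' / 2); last first.
  have [t00|t00] := leP t 0.
    have t'0 : t' <= 0 by lra.
    have te0 : t = 0 by apply/eqP; rewrite eq_le t00 t0.
    exists 0; split; last by rewrite mulr0 mulr_ge0// addr_ge0// ?divr_ge0 ?mulr_ge0 ?kbeta_ge0// ltW.
    rewrite integral0_eq// => s _; have [ts|_] := leP t s; last by rewrite mulr0.
    by rewrite (@kpow_le0 _ p (t' - s)) ?mul0r//; lra.
  exists (t `^ (g - 1) * ((t' - t) `^ p / p)); split; first exact: beta_kernel_tail.
  apply: (@le_trans _ _ (2 / p * (t' - t) `^ p)); last first.
    by rewrite ler_wpM2r// lerDl mulr_ge0// kbeta_ge0.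
  rewrite mulrA [leRHS](_ : _ = 2 * ((t' - t) `^ p / p)); last by rewrite mulrAC mulrA.
  rewrite ler_wpM2r ?divr_ge0 ?(ltW p0)//.
  rewrite (_ : g - 1 = -1 * (1 - g)); last by ring.
  rewrite powRrM powR_inv1// -powRM ?invr_ge0//; last exact: le_trans tt'.
  apply: (@le_trans _ _ (2 `^ (1 - g))).
    apply: ler_powR_base; rewrite ?subr_ge0 ?divr_ge0//; first exact: le_trans tt'.
    by rewrite ler_pdivrMr// mulrC -ler_pdivrMr.
  by apply: ler1_powR; rewrite ?ler1n// gerBl ltW.
have t'0 : 0 < t' by lra.
exists (kbeta p g * kpow (p + g) t'); split.
  rewrite -integral_kpow_conv//; apply: ge0_integral_mono.
  - by apply: measurable_funM; [exact: measurable_beta_kernel|exact: measurable_ger].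
  - exact: measurable_beta_kernel.
  - by move=> s; rewrite mulr_ge0// beta_kernel_ge0.
  - by move=> s; rewrite ler_piMr ?beta_kernel_ge0// lern1 leq_b1.
rewrite mulrCA weighted_beta//.
apply: (@le_trans _ _ (2 * kbeta p g * (t' - t) `^ p)); last first.
  by rewrite ler_wpM2r// lerDr divr_ge0// ltW.
rewrite -mulrA mulrCA ler_wpM2l ?kbeta_ge0//.
apply: (@le_trans _ _ ((2 * (t' - t)) `^ p)).
  by apply: ler_powR_base; rewrite ?(ltW p0) ?(ltW t'0)//; lra.
rewrite powRM// ?subr_ge0// ler_wpM2r//.
by apply: ler1_powR; rewrite ?ler1n.
Qed.

(** The weighted kernel decreases in [t], so a source supported in []0, e]] has at [t >= e] at most
    the bound it has at [e], where the weighted complete Beta integral is [kbeta p g * e^p]. *)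
Lemma weighted_rconv_trunc M Y e t : 0 <= M -> dominated g M Y ->
  (forall s, e < s -> Y s = 0) -> 0 < e -> e <= t ->
  `|t `^ (1 - g) * rconv p Y t| <= M * kbeta p g * e `^ p.
Proof.
move=> M0 hY Ye e0 et; have t0 := lt_le_trans e0 et.
pose F s := kpow p (t - s) * kpow g s.
have mF : measurable_fun [set: R] F by exact: measurable_beta_kernel.
have mF1 : measurable_fun [set: R] (fun s => F s * (s <= e)%R%:R).
  by apply: measurable_funM; [exact: mF|exact: measurable_ler].
have mF2 : measurable_fun [set: R] (fun s => F s * (s < e)%R%:R).
  by apply: measurable_funM; [exact: mF|exact: measurable_ltr].
have F0 s : 0 <= F s by exact: beta_kernel_ge0.
have w0 : 0 <= t `^ (1 - g) by exact: powR_ge0.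
have wi0 : t `^ (1 - g) > 0 by exact: powR_gt0.
rewrite normrM ger0_norm// -ler_pdivlMl//.
apply: (@norm_Rintegral_le1 R _ (fun s => M * (F s * (s <= e)%R%:R))).
- by apply: measurable_rconv_integrand; case: hY.
- by apply: measurable_funM => //; exact: mF1.
- move=> s; have [se|se] := leP s e; last by rewrite Ye// !mulr0 normr0.
  by rewrite mulr1; exact: rconv_integrand_le.
rewrite ge0_integral_scale//; last by move=> s; rewrite mulr_ge0.
(* At [s = e] the kernel [kpow p (e - s)] is 0 and cannot dominate; this null point is dropped. *)
rewrite integral_indic_lt_le//.
rewrite (_ : ((t `^ (1 - g))^-1 * _)%R =
  M * (t `^ (1 - g))^-1 * (e `^ (1 - g) * (kbeta p g * kpow (p + g) e))); last first.
  rewrite [e `^ (1 - g) * _]mulrCA weighted_beta//.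
  by move: (t `^ _)^-1 (kbeta _ _) (e `^ _) => x y u; ring.
rewrite -mulrA EFinM lee_wpmul2l ?lee_fin//.
rewrite 2!EFinM -integral_kpow_conv//.
have ei0 : 0 <= (t `^ (1 - g))^-1 * e `^ (1 - g) by rewrite mulr_ge0 ?invr_ge0 ?powR_ge0.
rewrite muleA -EFinM -ge0_integral_scale//; first last.
- by move=> s; exact: beta_kernel_ge0.
- exact: measurable_beta_kernel.
apply: ge0_integral_mono; first exact: mF2.
- by apply: measurable_funM => //; exact: measurable_beta_kernel.
- by move=> s; rewrite mulr_ge0.
move=> s; have [se|_] := ltP s e; last by rewrite mulr0 mulr_ge0// beta_kernel_ge0.
rewrite mulr1 /F; have [s0|s0] := leP s 0; first by rewrite (kpow_le0 _ s0) !mulr0.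
rewrite mulrA ler_wpM2r ?kpow_ge0// -mulrA ler_pdivlMl//.
exact: weighted_kernel_decr.
Qed.

End weighted_convolution.

(** * The periodic operator *)

Lemma norm_sub_add2_le (R : realDomainType) (A b x : R) :
  b <= x -> b <= A -> `|A - x| + 2 * b <= A + x.
Proof. by move=> *; case: (ger0P (A - x)) => *; lra. Qed.

Section periodic_operator.
Context {R : realType}.
Local Notation mu := (@lebesgue_measure R).
Variables (T a g z : R).
Hypotheses (T0 : 0 < T) (a01 : 0 < a < 1) (ag : a <= g) (g1 : g <= 1)
  (zE : z = 1 - g + a).
Implicit Types (p s t M : R) (Y : R -> R).

Let a0 : 0 < a. Proof. by case/andP: a01. Qed.
Let a1 : a < 1. Proof. by case/andP: a01. Qed.
Let g0 : 0 < g. Proof. exact: lt_le_trans ag. Qed.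
Let z0 : 0 < z. Proof. by rewrite zE ltr_wpDl// subr_ge0. Qed.
Let az : a <= z. Proof. by rewrite zE lerDr subr_ge0. Qed.
Let z1 : z <= 1. Proof. by rewrite zE -addrA gerDl addrC subr_le0. Qed.
Let Ga0 : 0 < Gamma a. Proof. by apply: Gamma_gt0; rewrite a0 ltW. Qed.

(** [Top] on truncated functions, with [Gamma (z + 1) / (Gamma (a + 1) * Gamma z)] simplified to
    [z / a / Gamma a]. All lower limits share this operator; see [TopE]. *)
Definition periodic_op Y t : R :=
  (Gamma a)^-1 * (rconv a Y t - z / a * (t `^ a / T `^ z) * rconv z Y T).

Lemma periodic_opB M M' Y Y' t : 0 <= M -> 0 <= M' ->
  dominated g M Y -> dominated g M' Y' ->
  periodic_op (fun s => Y s - Y' s) t = periodic_op Y t - periodic_op Y' t.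
Proof.
move=> M0 M0' hY hY'; rewrite /periodic_op.
rewrite (rconvB t a0 g0 M0 M0' hY hY') (rconvB T z0 g0 M0 M0' hY hY').
move: (rconv a Y t) (rconv a Y' t) (rconv z Y T) (rconv z Y' T) => u u' v v'.
by move: (Gamma a)^-1 (t `^ a / T `^ z) => x y; ring.
Qed.

(* So the kernel [A - z / a * B] of [periodic_op], with [B <= A] for [s < t], is at most
   [A + z / a * B - 2 * B]: the two incomplete Beta integrals of [xi]. *)
Lemma kernel_order s t : 0 < s -> s < t -> t <= T ->
  t `^ a / T `^ z * kpow z (T - s) <= kpow a (t - s).
Proof.
move=> s0 st tT; have t0 := lt_trans s0 st.
have ts0 : 0 < t - s by rewrite subr_gt0.
have Ts : t - s <= T - s by rewrite lerD2r.
have Ts0 : 0 < T - s by exact: lt_le_trans Ts.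
rewrite !kpow_gt0// -powRN.
apply: (@le_trans _ _ (t `^ a * t `^ (- z) * (t - s) `^ (z - 1))).
  rewrite -!mulrA ler_wpM2l ?powR_ge0//; apply: ler_pM; rewrite ?powR_ge0//.
    by apply: le0_ger_powR => //; rewrite oppr_le0 ltW.
  by apply: le0_ger_powR => //; rewrite subr_le0.
rewrite -powRD ?(gt_eqF t0) ?implybT//.
rewrite (_ : a - 1 = (a - z) + (z - 1)); last by ring.
rewrite [leRHS]powRD ?(gt_eqF ts0) ?implybT// ler_wpM2r ?powR_ge0//.
apply: le0_ger_powR => //; first by rewrite subr_le0.
by rewrite gerBl ltW.
Qed.

Lemma beta_kernel_scale q t x : 0 < q -> 0 < x -> x `^ (1 - q) * kpow (t + q) x = x `^ t.
Proof.
move=> q0 x0; rewrite kpow_gt0// -powRD ?(gt_eqF x0) ?implybT//; congr (_ `^ _); ring.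
Qed.

(** The integral of the majorant is exactly [xi]: the part [s < t] carries the coefficient
    [z / a - 2], and [1 / Gamma a = a / Gamma (a + 1)] turns it into [z - 2 a = 1 - g - a]. *)
Lemma periodic_op_bound M Y t : 0 <= M -> dominated g M Y -> 0 < t <= T ->
  `|t `^ (1 - g) * periodic_op Y t| <= xi T a g z t * M.
Proof.
move=> M0 hY /andP[t0 tT]; have [mY hYs] := hY.
pose c := t `^ a / T `^ z.
have c0 : 0 <= c by rewrite divr_ge0// powR_ge0.
have za0 : 0 <= z / a by rewrite divr_ge0 ?(ltW z0)// ltW.
have za1 : 1 <= z / a by rewrite ler_pdivlMr// mul1r.
pose K s := kpow z (T - s) * kpow g s.
pose K1 s := K s * (s < t)%R%:R.
have mK : measurable_fun [set: R] K by exact: measurable_beta_kernel.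
have K0 s : 0 <= K s by exact: beta_kernel_ge0.
have K10 s : 0 <= K1 s by rewrite mulr_ge0.
have cM2 : 0 <= M * (2 * c) by rewrite mulr_ge0// mulr_ge0.
have cMz : 0 <= M * (z / a * c) by rewrite mulr_ge0// mulr_ge0.
have mK1 : measurable_fun [set: R] K1.
  by apply: measurable_funM; [exact: mK|exact: measurable_ltr].
pose h s := kpow a (t - s) * Y s - z / a * c * (kpow z (T - s) * Y s).
have mh : measurable_fun [set: R] h.
  apply: measurable_funB; first exact: measurable_rconv_integrand.
  by apply: measurable_funM => //; exact: measurable_rconv_integrand.
pose k1 s := M * (kpow a (t - s) * kpow g s).
pose k2 s := M * (z / a * c) * K s.
pose g2 s := M * (2 * c) * K1 s.
have hE : \int[mu]_s h s = rconv a Y t - z / a * c * rconv z Y T.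
  rewrite /rconv -RintegralZl//; last exact: (integrable_rconv T z0 g0 M0 hY).
  rewrite -RintegralB//; first exact: (integrable_rconv t a0 g0 M0 hY).
  exact: (integrableZl _ _ (integrable_rconv T z0 g0 M0 hY)).
pose I1 := T `^ a * inc_beta (t / T) g z.
pose I2 := T `^ a * inc_beta (1 - t / T) z g.
have tT01 : 0 <= t / T <= 1.
  by apply/andP; split; [rewrite divr_ge0// ltW|rewrite ler_pdivrMr// mul1r].
have KE : (\int[mu]_s (K s)%:E = (I1 + I2)%:E)%E.
  rewrite integral_kpow_conv// kpow_gt0// /I1 /I2 -mulrDr inc_beta_compl//.
  by rewrite (_ : z + g - 1 = a) 1?mulrC// zE; ring.
have K1E : (\int[mu]_s (K1 s)%:E = I1%:E)%E.
  rewrite integral_inc_beta ?t0// (_ : g + z - 1 = a)// zE; ring.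
have key : `|\int[mu]_s h s| <=
   (M * (kbeta a g * kpow (a + g) t) + M * (z / a * c) * (I1 + I2)) - M * (2 * c) * I1.
  apply: (@norm_Rintegral_le R h (fun s => k1 s + k2 s) g2); first exact: mh.
  - apply: measurable_funD; first exact: measurable_beta_kernelZ.
    by apply: measurable_funM => //; exact: mK.
  - by apply: measurable_funM => //; exact: mK1.
  - by move=> s; exact: mulr_ge0.
  - move=> s.
    have [s0|s0] := leP s 0.
      rewrite /h /g2 /k1 /k2 /K1 /K (dominated_npos hY s0) (kpow_le0 _ s0).
      by rewrite !(mulr0, mul0r) subrr normr0 addr0.
    rewrite (_ : h s = (kpow a (t - s) - z / a * (c * kpow z (T - s))) * Y s); last first.
      rewrite /h; ring.
    rewrite normrM.
    have B0 : 0 <= c * kpow z (T - s) by rewrite mulr_ge0// kpow_ge0.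
    have Mk : 0 <= M * kpow g s by rewrite mulr_ge0// kpow_ge0.
    have A0 : 0 <= kpow a (t - s) by exact: kpow_ge0.
    rewrite /g2 /K1 /k1 /k2 /K.
    set A := kpow a (t - s) in A0 *; set B := kpow z (T - s) in B0 *.
    apply: (@le_trans _ _ ((`|A - z / a * (c * B)| + 2 * (c * B) * (s < t)%R%:R) * (M * kpow g s))).
      rewrite [leRHS]mulrDl [X in _ <= _ + X](_ : _ =
        M * (2 * c) * (B * kpow g s * (s < t)%R%:R)); last by ring.
      by rewrite lerD2r ler_wpM2l.
    rewrite [leRHS](_ : _ = (A + z / a * (c * B)) * (M * kpow g s)); last by ring.
    rewrite ler_wpM2r//.
    have zB : c * B <= z / a * (c * B) by rewrite ler_peMl.
    have [st|st] := ltP s t.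
      have : c * B <= A by exact: kernel_order.
      by move=> BA; rewrite mulr1; exact: norm_sub_add2_le.
    rewrite (_ : A = 0); last by rewrite /A kpow_le0// subr_le0.
    by rewrite mulr0 addr0 sub0r add0r normrN ger0_norm// mulr_ge0.
  - rewrite ge0_integral_add.
    + rewrite integral_beta_kernelZ// ge0_integral_scale//.
      by rewrite KE -EFinM -EFinD.
    + exact: measurable_beta_kernelZ.
    + by apply: measurable_funM => //; exact: mK.
    + by move=> s; rewrite mulr_ge0// beta_kernel_ge0.
    + by move=> s; exact: mulr_ge0.
  - by rewrite (@ge0_integral_scale R (M * (2 * c)) K1 cM2 mK1 K10) K1E -EFinM.
rewrite /periodic_op -/c -hE.
have tg : 0 <= t `^ (1 - g) by rewrite powR_ge0.
rewrite mulrA normrM ger0_norm; last by rewrite mulr_ge0// invr_ge0 ltW.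
apply: le_trans (ler_wpM2l _ key) _; first by rewrite mulr_ge0// invr_ge0 ltW.
have a01' : 0 < a <= 1 by rewrite a0 ltW.
have g01' : 0 < g <= 1 by rewrite g0.
have [bG Gag] := kbeta_Gamma a01' g01'.
have bE : kbeta a g = Gamma a * Gamma g / Gamma (g + a).
  by rewrite -bG (addrC g) mulfK ?gt_eqF.
rewrite le_eqVlt; apply/orP; left; apply/eqP.
rewrite /xi GammaS// bE.
have E1 : t `^ (1 - g) * kpow (a + g) t = t `^ a by exact: beta_kernel_scale.
have E2 : (t / T) `^ z = t `^ (1 - g) * c.
  rewrite /c mulrA -powRD; last by rewrite (gt_eqF t0) implybT.
  rewrite -zE (powRM _ (ltW t0)); last by rewrite invr_ge0 (ltW T0).
  by rewrite -(powR_inv1 (ltW T0)) -powRrM mulN1r powRN.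
rewrite E2 -E1 /I1 /I2.
rewrite (_ : 1 - g - a = z - 2 * a); last by rewrite zE; ring.
rewrite addrC in Gag; move: (gt_eqF Ga0) (gt_eqF Gag) (gt_eqF a0).
move: (inc_beta _ _ _) (inc_beta _ _ _) (t `^ _) (kpow _ _) (T `^ _) => u v w x y.
move: (Gamma a) (Gamma (g + a)) (Gamma g) => G1 G2 G3 h1 h2 h3.
by field; rewrite h1 h2 h3.
Qed.

Lemma weighted_periodicE Y t : 0 <= t -> t `^ (1 - g) * periodic_op Y t =
  (Gamma a)^-1 * (t `^ (1 - g) * rconv a Y t - z / a * (t `^ z / T `^ z) * rconv z Y T).
Proof.
move=> t0; have E : t `^ z = t `^ (1 - g) * t `^ a.
  by rewrite -powRD -zE// gt_eqF.
rewrite /periodic_op E.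
move: (Gamma a)^-1 (rconv _ _ _) (rconv _ _ _) (t `^ (1 - g)) (t `^ a) (T `^ z)^-1 => *; ring.
Qed.

Lemma weighted_periodic_diff M Y t t' B : 0 <= M -> dominated g M Y ->
  0 <= t -> t <= t' ->
  `|t' `^ (1 - g) * rconv a Y t' - t `^ (1 - g) * rconv a Y t| <= M * B ->
  `|t' `^ (1 - g) * periodic_op Y t' - t `^ (1 - g) * periodic_op Y t| <=
  M * ((Gamma a)^-1 * (B + z / a * ((t' - t) `^ z / T `^ z) * (kbeta z g * T `^ a))).
Proof.
move=> M0 hY t0 tt' hB.
rewrite !weighted_periodicE//; last exact: le_trans tt'.
have V := rconv_le T z0 g0 M0 hY.
have EV : kpow (z + g) T = T `^ a by rewrite kpow_gt0//; congr (_ `^ _); rewrite zE; ring.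
rewrite EV in V.
move: hB V; move: (rconv z Y T) => v.
set w' := t' `^ (1 - g) * _; set w := t `^ (1 - g) * _ => hB V.
rewrite [X in `|X|](_ : _ =
  (Gamma a)^-1 * ((w' - w) - z / a * ((t' `^ z - t `^ z) / T `^ z) * v)); last first.
  move: (Gamma a)^-1 (T `^ z)^-1 => x y; ring.
have G0 : 0 <= (Gamma a)^-1 by rewrite invr_ge0 ltW.
rewrite normrM (ger0_norm G0) [leRHS]mulrCA ler_wpM2l//.
rewrite [leRHS]mulrDr (le_trans (ler_normB _ _))// lerD//.
have za0 : 0 <= z / a by rewrite divr_ge0 ?(ltW z0)// ltW.
have Ti0 : 0 <= (T `^ z)^-1 by rewrite invr_ge0 powR_ge0.
have d0 : 0 <= t' `^ z - t `^ z by rewrite subr_ge0 ler_powR_base// ltW.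
have X0 : 0 <= z / a * ((t' `^ z - t `^ z) / T `^ z).
  by apply: mulr_ge0 => //; exact: mulr_ge0.
rewrite normrM (ger0_norm X0) [leRHS]mulrCA; apply: ler_pM => //.
by rewrite ler_wpM2l// ler_wpM2r// powR_subD.
Qed.

Lemma weighted_periodic_Omega M Y t t' : 0 <= M -> dominated g M Y ->
  0 < t -> t <= t' ->
  `|t' `^ (1 - g) * periodic_op Y t' - t `^ (1 - g) * periodic_op Y t| <=
  Omega T a g z t t' * M.
Proof.
move=> M0 hY t0 tt'; have t'0 := lt_le_trans t0 tt'.
have hB := weighted_rconv_diff a0 ag g1 M0 hY (ltW t0) tt'
  (@beta_kernel_tail _ a g a0 g1 _ _ t0 tt').
rewrite (mulrC 2 M) -[leRHS]mulrA in hB.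
apply: (le_trans (weighted_periodic_diff M0 hY (ltW t0) tt' hB)).
rewrite mulrC ler_wpM2r// /Omega GammaS; last by rewrite a0 ltW.
rewrite !beta_fnE//.
have -> : t `^ (g - 1) = (t `^ (1 - g))^-1 by rewrite -powRN opprB.
have -> : (t' / t) `^ (1 - g) = t' `^ (1 - g) / t `^ (1 - g).
  rewrite powRM ?invr_ge0 ?(ltW t'0) ?(ltW t0)//; congr (_ * _).
  by rewrite -(powR_inv1 (ltW t0)) -powRrM mulN1r powRN.
have b0 : 0 <= kbeta a g by exact: kbeta_ge0.
have D0 : 0 <= (t' - t) `^ a by exact: powR_ge0.
have Tz0 : T `^ z != 0 by rewrite gt_eqF// powR_gt0.
have tg0 : t `^ (1 - g) != 0 by rewrite gt_eqF// powR_gt0.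
move: b0 D0 Tz0 tg0 Ga0 a0.
move: (kbeta a g) (kbeta z g) ((t' - t) `^ a) ((t' - t) `^ z) (T `^ z) (T `^ a)
  (t `^ (1 - g)) (t' `^ (1 - g)) (Gamma a).
clear; move=> b c D E x y w w' G b0 D0 x0 w0 G0 a0.
rewrite -subr_ge0 [X in _ <= X](_ : _ = D * b / G); last first.
  by field; rewrite x0 w0 (gt_eqF a0) (gt_eqF G0).
by rewrite divr_ge0 ?mulr_ge0// ltW.
Qed.

Definition periodic_holder : R :=
  (Gamma a)^-1 * (holder_cst a g + z / a * (kbeta z g * T `^ a) / T `^ a).

(** [Omega] degenerates at 0 through [t' / t]; this bound is uniform down to 0 and gives continuity
    of the weighted image on [[0, T]]. The two powers merge because
    [((t' - t) / T)^z <= ((t' - t) / T)^a] for [a <= z]. *)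
Lemma weighted_periodic_holder M Y t t' : 0 <= M -> dominated g M Y ->
  0 <= t -> t <= t' -> t' <= T ->
  `|t' `^ (1 - g) * periodic_op Y t' - t `^ (1 - g) * periodic_op Y t| <=
  M * periodic_holder * (t' - t) `^ a.
Proof.
move=> M0 hY t0 tt' t'T.
have hB := weighted_rconv_holder a0 ag g1 M0 hY t0 tt'.
rewrite -mulrA in hB.
apply: (le_trans (weighted_periodic_diff M0 hY t0 tt' hB)).
rewrite [leRHS](_ : _ = M * ((Gamma a)^-1 * (holder_cst a g * (t' - t) `^ a +
    z / a * ((t' - t) `^ a / T `^ a) * (kbeta z g * T `^ a)))); last first.
  rewrite /periodic_holder.
  by move: (Gamma a)^-1 (holder_cst _ _) (kbeta _ _) (T `^ a) (T `^ a)^-1 (_ `^ _) => *; ring.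
rewrite ler_wpM2l// ler_wpM2l ?invr_ge0 ?(ltW Ga0)// lerD2l.
rewrite ler_wpM2r ?mulr_ge0 ?kbeta_ge0 ?powR_ge0//.
rewrite ler_wpM2l ?divr_ge0 ?(ltW z0) ?(ltW a0)//.
have E x : (t' - t) `^ x / T `^ x = ((t' - t) / T) `^ x.
  rewrite powRM ?subr_ge0 ?invr_ge0 ?(ltW T0)//; congr (_ * _).
  by rewrite -(powR_inv1 (ltW T0)) -powRrM mulN1r powRN.
rewrite !E; have := tt'; rewrite le_eqVlt => /predU1P[->|tt'1].
  by rewrite subrr mul0r !powR0 ?gt_eqF.
apply: ger_powR => //; rewrite divr_gt0 ?subr_gt0//= ler_pdivrMr// mul1r.
by rewrite lerBlDr (le_trans t'T)// lerDl.
Qed.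

Definition periodic_trunc : R := (Gamma a)^-1 * ((1 + z / a) * kbeta a g).

Lemma weighted_periodic_trunc M Y e t : 0 <= M -> dominated g M Y ->
  (forall s, e < s -> Y s = 0) -> 0 < e -> e <= t -> t <= T ->
  `|t `^ (1 - g) * periodic_op Y t| <= M * periodic_trunc * e `^ a.
Proof.
move=> M0 hY Ye e0 et tT; have t0 := lt_le_trans e0 et.
have eT := le_trans et tT.
have h1 := weighted_rconv_trunc a0 ag g1 M0 hY Ye e0 et.
have h2 : `|rconv z Y T| <= M * kbeta a g * e `^ a.
  (* Since [z - 1 = (1 - g) + (a - 1)], the kernel of order [z] at [T] is at most [T^(1-g)] times
     that of order [a]. The truncation estimate at [T] then applies to the nonnegative majorant [Ya]
     of [Y]. *)
  pose Ya s := M * kpow g s * (s <= e)%R%:R.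
  have mYa : measurable_fun [set: R] Ya.
    apply: measurable_funM; last exact: measurable_ler.
    by apply: measurable_funM => //; exact: measurable_kpow.
  have Ya0 s : 0 <= Ya s by rewrite !mulr_ge0// kpow_ge0.
  have dYa : dominated g M Ya.
    split => // s; rewrite ger0_norm// /Ya ler_piMr ?mulr_ge0 ?kpow_ge0//.
    by rewrite lern1 leq_b1.
  have Yae s : e < s -> Ya s = 0 by move=> es; rewrite /Ya leNgt es mulr0.
  have {}h1 := weighted_rconv_trunc a0 ag g1 M0 dYa Yae e0 eT.
  apply: le_trans h1; apply: le_trans (ler_norm _).
  rewrite /rconv -RintegralZl//; last exact: (integrable_rconv T a0 g0 M0 dYa).
  pose k s := T `^ (1 - g) * (kpow a (T - s) * Ya s).
  have ik := integrableZl measurableT (T `^ (1 - g)) (integrable_rconv T a0 g0 M0 dYa).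
  have mk : measurable_fun [set: R] k.
    by apply: measurable_funM => //; exact: measurable_rconv_integrand.
  apply: (@norm_Rintegral_le1 R _ k) => //.
  - by apply: measurable_rconv_integrand; case: hY.
  - move=> s; rewrite /k normrM ger0_norm ?kpow_ge0//.
    have [s0|s0] := leP s 0.
      rewrite (dominated_npos hY s0) normr0 mulr0.
      by rewrite mulr_ge0 ?powR_ge0// mulr_ge0// kpow_ge0.
    have [Ts|Ts] := leP (T - s) 0.
      by rewrite kpow_le0// mul0r mulr_ge0 ?powR_ge0// mulr_ge0// kpow_ge0.
    rewrite mulrA; apply: ler_pM; rewrite ?kpow_ge0 ?normr_ge0//.
      rewrite !kpow_gt0// (_ : z - 1 = (1 - g) + (a - 1)); last by rewrite zE; ring.
      rewrite [leLHS]powRD ?(gt_eqF Ts) ?implybT// ler_wpM2r ?powR_ge0//.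
      by apply: ler_powR_base; rewrite ?(ltW Ts) ?subr_ge0// gerBl ltW.
    rewrite /Ya; have [es|es] := ltP e s; first by rewrite Ye// normr0 mulr0.
    by rewrite mulr1; case: hY.
  - by rewrite fineK//; exact: (integrable_fin_num measurableT ik).
rewrite weighted_periodicE; last exact: ltW.
have G0 : 0 <= (Gamma a)^-1 by rewrite invr_ge0 ltW.
rewrite normrM (ger0_norm G0) /periodic_trunc.
rewrite [leRHS](_ : _ = (Gamma a)^-1 *
  (M * kbeta a g * e `^ a + z / a * (M * kbeta a g * e `^ a))); last first.
  move: (Gamma a)^-1 (kbeta a g) (e `^ a) => *; ring.
rewrite ler_wpM2l// (le_trans (ler_normB _ _))// lerD// normrM.
have za0 : 0 <= z / a by rewrite divr_ge0 ?(ltW z0)// ltW.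
apply: ler_pM => //; rewrite normrM (ger0_norm za0) ler_piMr//.
rewrite ger0_norm ?divr_ge0 ?powR_ge0// ler_pdivrMr ?powR_gt0// mul1r.
by apply: ler_powR_base; rewrite ?(ltW z0) ?(ltW t0).
Qed.

End periodic_operator.

(** * Continuity on closed intervals and weighted spaces *)

Section within_interval.
Context {R : realType}.
Implicit Types (a b s t e M : R) (h u v : R -> R).

Lemma continuous_itv_distP a b h : {within `[a, b], continuous h} <->
  forall s, a <= s <= b -> forall e, 0 < e -> exists2 del, 0 < del &
    forall t, a <= t <= b -> `|s - t| < del -> `|h s - h t| < e.
Proof.
rewrite subspace_continuousP; split => H s.
  move=> sab e e0; have := H s; rewrite /= in_itv/= => /(_ sab)/cvgrPdist_lt/(_ _ e0).
  rewrite near_withinE => /nbhs_ballP[del /= del0 B]; exists del => // t tab st.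
  by apply: B => //=; rewrite in_itv.
rewrite /= in_itv/= => sab; apply/cvgrPdist_lt => e e0.
have [del del0 B] := H s sab e e0.
rewrite near_withinE; apply/nbhs_ballP; exists del => //= t st.
by rewrite in_itv/= => tab; exact: B.
Qed.

Lemma holder_within_continuous a b h (C p : R) : 0 < p ->
  (forall s t, a <= s -> s <= t -> t <= b -> `|h t - h s| <= C * (t - s) `^ p) ->
  {within `[a, b], continuous h}.
Proof.
move=> p0 H; apply/continuous_itv_distP => s /andP[sa sb] e e0.
pose C' := `|C| + 1.
have C'0 : 0 < C' by rewrite ltr_pwDr.
have CC' : C <= C' by rewrite (le_trans (ler_norm _))// lerDl.
have d0 : 0 < (e / C') `^ p^-1 by rewrite powR_gt0// divr_gt0.
exists ((e / C') `^ p^-1) => // t /andP[ta tb] st.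
have key x : 0 <= x -> x < (e / C') `^ p^-1 -> C * x `^ p < e.
  move=> x0 xd; apply: (@le_lt_trans _ _ (C' * x `^ p)); first by rewrite ler_wpM2r// powR_ge0.
  rewrite -ltr_pdivlMl// mulrC.
  have -> : e / C' = ((e / C') `^ p^-1) `^ p.
    by rewrite -powRrM mulVf ?gt_eqF// powRr1// ltW// divr_gt0.
  by apply: gt0_ltr_powR => //; rewrite nnegrE// ltW.
have [le_st|le_ts] := leP s t.
  rewrite distrC (le_lt_trans (H _ _ sa le_st tb))//; apply: key; first by rewrite subr_ge0.
  by rewrite -[ltLHS]ger0_norm ?subr_ge0// distrC.
rewrite (le_lt_trans (H _ _ ta (ltW le_ts) sb))//; apply: key; first by rewrite subr_ge0 ltW.
by rewrite -[ltLHS]ger0_norm ?subr_ge0// ltW.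
Qed.

Lemma within_continuous_bounded a b h : a <= b -> {within `[a, b], continuous h} ->
  exists2 M, 0 <= M & forall t, a <= t <= b -> `|h t| <= M.
Proof.
move=> ab ch.
have [c cab Hc] := EVT_max ab ch; have [c' c'ab Hc'] := EVT_min ab ch.
exists (`|h c| + `|h c'|); first by rewrite addr_ge0.
move=> t tab; rewrite ler_norml; apply/andP; split.
  rewrite opprD (le_trans _ (Hc' _ _)) ?in_itv//= (@le_trans _ _ (- `|h c'|))//.
    by rewrite gerDr oppr_le0.
  by rewrite lerNl -normrN ler_norm.
rewrite (le_trans (Hc _ _)) ?in_itv//= (le_trans (ler_norm _))//.
by rewrite lerDl.
Qed.

End within_interval.

Section weighted_functions.
Context {R : realType}.
Local Notation mu := (@lebesgue_measure R).
Variables (g a T : R).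
Hypotheses (g1 : g <= 1) (a0 : 0 <= a) (aT : a < T).
Implicit Types (s t M : R) (u v y : R -> R).

Lemma eq_Cw u v : (forall t, a < t <= T -> u t = v t) -> Cw g a T u -> Cw g a T v.
Proof.
by move=> e [h ch hu]; exists h => // t; rewrite in_itv/= => tT; rewrite -e// hu// in_itv.
Qed.

Lemma Cw_of_continuous y : {within `[a, T], continuous (fun t => t `^ (1 - g) * y t)} ->
  Cw g a T y.
Proof. by move=> cy; exists (fun t => t `^ (1 - g) * y t). Qed.

Lemma CwB u v : Cw g a T u -> Cw g a T v -> Cw g a T (u \- v).
Proof.
move=> [h ch hu] [k ck kv]; exists (fun t => h t - k t).
  by move=> t; apply: cvgB; [exact: ch|exact: ck].
by move=> t tT /=; rewrite mulrBr hu// kv.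
Qed.

Lemma CwD u v : Cw g a T u -> Cw g a T v -> Cw g a T (u \+ v).
Proof.
move=> [h ch hu] [k ck kv]; exists (fun t => h t + k t).
  by move=> t; apply: cvgD; [exact: ch|exact: ck].
by move=> t tT /=; rewrite mulrDr hu// kv.
Qed.

Lemma Cw_bounded u : Cw g a T u ->
  exists2 M, 0 <= M & forall t, a < t <= T -> `|t `^ (1 - g) * u t| <= M.
Proof.
move=> [h ch hu]; have [M M0 hM] := within_continuous_bounded (ltW aT) ch.
exists M => // t /andP[ta tT]; rewrite hu ?in_itv/= ?ta// hM//.
by rewrite ltW.
Qed.

Lemma normw_le u M : (forall t, a < t <= T -> `|t `^ (1 - g) * u t| <= M) ->
  normw g a T u <= M.
Proof.
move=> H; apply: ge_sup.
  by exists `|T `^ (1 - g) * u T|, T => //=; rewrite in_itv/= aT lexx.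
by move=> _ [t /= tT <-]; apply: H; move: tT; rewrite in_itv.
Qed.

Lemma le_normw u t : Cw g a T u -> a < t <= T -> `|t `^ (1 - g) * u t| <= normw g a T u.
Proof.
move=> cu tT; have [M M0 hM] := Cw_bounded cu.
apply: ub_le_sup; last by exists t => //=; rewrite in_itv.
by exists M => _ [s /= sT <-]; apply: hM; move: sT; rewrite in_itv.
Qed.

(** True for every [u], because the real [sup] of an unbounded set is 0. *)
Lemma normw_ge0 u : 0 <= normw g a T u.
Proof.
rewrite /normw; set E := [set _ | _ in _].
have [sE|/sup_out -> //] := pselect (has_sup E).
apply: (@le_trans _ _ `|T `^ (1 - g) * u T|) => //.
apply: (sup_upper_bound sE); exists T => //=; by rewrite in_itv/= aT lexx.
Qed.

Definition trunc y s : R := if a < s <= T then y s else 0.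

Lemma trunc_id y s : a < s <= T -> trunc y s = y s.
Proof. by rewrite /trunc => ->. Qed.

Lemma truncB y y' : trunc (y \- y') = (fun s => trunc y s - trunc y' s).
Proof. by apply/funext => s; rewrite /trunc; case: ifP; rewrite ?subr0. Qed.

Lemma measurable_trunc y : Cw g a T y -> measurable_fun [set: R] (trunc y).
Proof.
move=> [h ch hy].
have -> : trunc y = (fun s => s `^ (g - 1) * h s) \_ `]a, T]%classic.
  apply/funext => s; rewrite patchE mem_setE in_itv/= /trunc; case: ifPn => // sT.
  have s0 : 0 < s by case/andP: sT => /(le_lt_trans a0).
  rewrite -hy ?in_itv// mulrA -powRD ?(gt_eqF s0) ?implybT//.
  by rewrite (_ : g - 1 + (1 - g) = 0) ?powRr0 ?mul1r//; ring.
apply/(measurable_restrictT (fun s => s `^ (g - 1) * h s)) => //.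
apply: measurable_funM; first by apply: measurable_funTS; exact: measurable_powR.
apply: (@measurable_funS _ _ _ _ `[a, T]%classic) => //.
  by move=> s /=; rewrite !in_itv/= => /andP[/ltW -> ->].
exact: subspace_continuous_measurable_fun.
Qed.

Lemma dominated_trunc y M : Cw g a T y -> 0 <= M ->
  (forall t, a < t <= T -> `|t `^ (1 - g) * y t| <= M) -> dominated g M (trunc y).
Proof.
move=> cy M0 hM; split; first exact: measurable_trunc.
move=> s; rewrite /trunc; case: ifPn => sT; last by rewrite normr0 mulr_ge0// kpow_ge0.
have s0 : 0 < s by case/andP: sT => /(le_lt_trans a0).
have := hM _ sT; rewrite normrM ger0_norm ?powR_ge0// kpow_gt0//.
by rewrite -ler_pdivlMl ?powR_gt0// -powRN opprB mulrC.
Qed.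

(** The closed interval is replaced by the open one: at [a] the value of [y] is arbitrary, and at
    [t] the power of 0 can differ from [kpow] (when [p = 1]). The degenerate interval [t = a] is
    treated apart. *)
Lemma RLintE p y t : Cw g a T y -> a <= t <= T ->
  RLint a t p y t = (Gamma p)^-1 * rconv p (trunc y) t.
Proof.
move=> cy /andP[at_ tT]; congr (_ * _); rewrite /rconv /Rintegral; congr fine.
have mf : measurable_fun `]a, t[%classic (fun s => (t - s) `^ (p - 1) * y s).
  apply: measurable_funM.
    apply: measurable_funTS; apply: (measurableT_comp (f := fun x => x `^ (p - 1))).
      exact: measurable_powR.
    exact: measurable_funB.
  apply: (eq_measurable_fun (trunc y)).
    move=> s; rewrite inE/= in_itv/= => /andP[sa st].
    by rewrite trunc_id// sa (le_trans (ltW st)).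
  by apply: measurable_funTS; exact: measurable_trunc.
have [ta|ta] := eqVneq t a.
  rewrite {}ta set_itv1 integral_set1 integral0_eq// => s _.
  rewrite /trunc; case: ifPn => [/andP[sa _]|_]; last by rewrite mulr0.
  by rewrite kpow_le0 ?mul0r// subr_le0 ltW.
rewrite (@integral_itv_bndoo _ a t _ true false); last exact/measurable_EFinP.
rewrite [LHS]integral_mkcond; apply: eq_integral => s _.
rewrite patchE mem_setE in_itv/=; case: ifPn => [/andP[sa st]|].
  rewrite trunc_id ?kpow_gt0 ?subr_gt0//.
  by rewrite sa (le_trans (ltW st)).
rewrite negb_and -!leNgt => /orP[sa|ts].
  by rewrite /trunc ltNge sa mulr0.
by rewrite kpow_le0 ?mul0r// subr_le0.
Qed.

End weighted_functions.

(** * The periodic operator on weighted spaces *)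

Section top_operator.
Context {R : realType}.
Variables (T a g z : R).
Hypotheses (T0 : 0 < T) (a01 : 0 < a < 1) (ag : a <= g) (g1 : g <= 1)
  (zE : z = 1 - g + a).
Implicit Types (b s t M : R) (y : R -> R).

Let a0 : 0 < a. Proof. by case/andP: a01. Qed.
Let g0 : 0 < g. Proof. exact: lt_le_trans ag. Qed.
Let z0 : 0 < z. Proof. by rewrite zE ltr_wpDl// subr_ge0. Qed.
Let z1 : z <= 1. Proof. by rewrite zE -addrA gerDl addrC subr_le0. Qed.

(** What has to be shown is that [xi] is bounded, without which [Xi] would be a default value:
    incomplete Beta integrals are replaced by complete ones and [(t / T)^z] by 1. *)
Lemma xi_le_Xi t : 0 < t <= T -> xi T a g z t <= Xi T a g z.
Proof.
move=> tT; apply: ub_le_sup; last by exists t => //=; rewrite in_itv.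
have a01' : 0 < a <= 1 by rewrite a0 ltW//; case/andP: a01.
have g01' : 0 < g <= 1 by rewrite g0.
have [_ Gag] := kbeta_Gamma a01' g01'.
exists (Gamma g * T `^ a / Gamma (g + a) + T `^ a / Gamma (a + 1) *
  (`|1 - g - a| * kbeta z g + z * kbeta g z)) => _ [s /= sT <-].
have {sT} /andP[s0 sT] : 0 < s <= T by move: sT; rewrite in_itv.
have x01 : 0 <= s / T <= 1.
  by apply/andP; split; [rewrite divr_ge0// ltW|rewrite ler_pdivrMr// mul1r].
have x01' : 0 <= 1 - s / T <= 1.
  by case/andP: x01 => u v; rewrite subr_ge0 v gerBl.
have G1 : 0 < Gamma (a + 1) by rewrite (GammaS a01') (mulr_gt0 a0 (Gamma_gt0 a01')).
rewrite /xi; apply: lerD.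
  rewrite ler_wpM2r ?invr_ge0; last 2 first.
  - by rewrite addrC (ltW Gag).
  - by rewrite ler_wpM2l ?(ltW (Gamma_gt0 g01'))// ler_powR_base// ltW.
  by [].
have B1 := inc_beta_le g0 z0 x01.
have B2 := inc_beta_le z0 g0 x01'.
have C0 : 0 <= T `^ a / Gamma (a + 1) := divr_ge0 (powR_ge0 _ _) (ltW G1).
have xz1 : (s / T) `^ z <= 1.
  apply: (@le_trans _ _ (1 `^ z)); last by rewrite powR1.
  by case/andP: x01 => u v; apply: ler_powR_base => //; exact: ltW.
set X := `|1 - g - a| * kbeta z g + z * kbeta g z.
have X0 : 0 <= X by rewrite addr_ge0// mulr_ge0 ?kbeta_ge0// ltW.
rewrite -mulrA -mulrA; apply: (@le_trans _ _ ((s / T) `^ z * (T `^ a / Gamma (a + 1) * X))).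
  rewrite ler_wpM2l ?powR_ge0// mulrA ler_wpM2l//; apply: lerD.
    apply: (le_trans (ler_norm _)); rewrite normrM (ger0_norm (inc_beta_ge0 _ _ _)).
    exact: (ler_wpM2l (normr_ge0 _) B1).
  by rewrite ler_wpM2l// ltW.
by rewrite ler_piMl// mulr_ge0.
Qed.

Section left_endpoint.
Variable b : R.
Hypotheses (b0 : 0 <= b) (bT : b < T).

Lemma TopE y t : Cw g b T y -> b <= t <= T ->
  Top T a z b y t = periodic_op T a z (trunc b T y) t.
Proof.
move=> cy btT; have bTT : b <= T <= T by rewrite ltW//= lexx.
rewrite /Top (RLintE b0 a cy btT) (RLintE b0 z cy bTT).
have a01' : 0 < a <= 1 by rewrite a0 ltW//; case/andP: a01.
have z01' : 0 < z <= 1 by rewrite z0.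
have Ga := Gamma_gt0 a01'; have Gz := Gamma_gt0 z01'.
rewrite /periodic_op !GammaS//.
have Tz : T `^ z != 0 by rewrite gt_eqF// powR_gt0.
move: (gt_eqF Ga) (gt_eqF Gz) (gt_eqF a0) Tz.
move: (rconv _ _ _) (rconv _ _ _) (t `^ a) (T `^ z) (Gamma a) (Gamma z).
by move=> u v w x y1 y2 h1 h2 h3 h4; field; rewrite h1 h2 h3 h4.
Qed.

Lemma Cw_Top_continuous y : Cw g b T y ->
  {within `[b, T], continuous (fun t => t `^ (1 - g) * Top T a z b y t)}.
Proof.
move=> cy; have [M M0 hM] := Cw_bounded bT cy.
have hY := dominated_trunc b0 cy M0 hM.
apply: (holder_within_continuous a0 (C := M * periodic_holder T a g z)) => s t bs st tT.
rewrite !TopE//; last 2 first.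
- by rewrite bs (le_trans st).
- by rewrite (le_trans bs st).
have s0 : 0 <= s by exact: le_trans bs.
exact: (weighted_periodic_holder T0 a01 ag g1 zE M0 hY s0 st tT).
Qed.

Lemma Cw_Top y : Cw g b T y -> Cw g b T (Top T a z b y).
Proof. by move=> cy; apply: Cw_of_continuous; exact: Cw_Top_continuous. Qed.

Lemma TopB y y' t : Cw g b T y -> Cw g b T y' -> b <= t <= T ->
  Top T a z b (y \- y') t = Top T a z b y t - Top T a z b y' t.
Proof.
move=> cy cy' btT; have cyy' := CwB cy cy'.
have [M M0 hM] := Cw_bounded bT cy; have [M' M0' hM'] := Cw_bounded bT cy'.
rewrite !TopE// truncB.
exact: (periodic_opB T a01 ag g1 zE t M0 M0' (dominated_trunc b0 cy M0 hM)
  (dominated_trunc b0 cy' M0' hM')).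
Qed.

Lemma Top_bound y M : Cw g b T y -> 0 <= M ->
  (forall t, b < t <= T -> `|t `^ (1 - g) * y t| <= M) ->
  forall t, b < t <= T -> `|t `^ (1 - g) * Top T a z b y t| <= Xi T a g z * M.
Proof.
move=> cy M0 hM t /andP[bt tT]; have t0 := le_lt_trans b0 bt.
rewrite TopE ?(ltW bt)// (le_trans (periodic_op_bound T0 a01 ag g1 zE M0
  (dominated_trunc b0 cy M0 hM) _)) ?t0//.
by rewrite ler_wpM2r// xi_le_Xi ?t0.
Qed.

Lemma Top_diff_bound y y' M : Cw g b T y -> Cw g b T y' -> 0 <= M ->
  (forall t, b < t <= T -> `|t `^ (1 - g) * (y t - y' t)| <= M) ->
  forall t, b < t <= T ->
    `|t `^ (1 - g) * (Top T a z b y t - Top T a z b y' t)| <= Xi T a g z * M.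
Proof.
move=> cy cy' M0 hM t /andP[bt tT]; rewrite -TopB ?(ltW bt)//.
by apply: Top_bound; rewrite ?bt//; exact: CwB.
Qed.

Lemma Top_Omega y M t t' : Cw g b T y -> 0 <= M -> 0 < b ->
  (forall t, b < t <= T -> `|t `^ (1 - g) * y t| <= M) ->
  b <= t -> t <= t' -> t' <= T ->
  `|t' `^ (1 - g) * Top T a z b y t' - t `^ (1 - g) * Top T a z b y t| <=
  Omega T a g z t t' * M.
Proof.
move=> cy M0 b00 hM bt tt' t'T.
rewrite !TopE//; [|by rewrite bt (le_trans tt')|by rewrite (le_trans bt tt')].
apply: (weighted_periodic_Omega T0 a01 ag g1 zE M0 (dominated_trunc b0 cy M0 hM)) => //.
exact: lt_le_trans bt.
Qed.

End left_endpoint.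

Lemma Cw_restrict b y : 0 <= b -> b < T -> Cw g 0 T y -> Cw g b T y.
Proof.
move=> b0 bT [h ch hy]; exists h.
  move/continuous_itv_distP: ch => ch; apply/continuous_itv_distP => s /andP[bs sT] e e0.
  have [|del del0 H] := ch s _ e e0; first by rewrite sT (le_trans b0).
  by exists del => // t /andP[bt tT]; apply: H; rewrite tT (le_trans b0).
by move=> t; rewrite in_itv/= => /andP[bt tT]; rewrite hy// in_itv/= tT (le_lt_trans b0).
Qed.

(** By linearity the difference is the periodic operator applied to the part of [y] on []0, b]], so
    the truncation estimate applies. *)
Lemma Top_truncation y M b t : Cw g 0 T y -> 0 <= M ->
  (forall t, 0 < t <= T -> `|t `^ (1 - g) * y t| <= M) -> 0 < b -> b < t -> t <= T ->
  `|t `^ (1 - g) * (Top T a z 0 y t - Top T a z b y t)| <=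
  M * periodic_trunc a g z * b `^ a.
Proof.
move=> cy M0 hM b0 bt tT; have bT := lt_le_trans bt tT.
have cyb : Cw g b T y by apply: Cw_restrict => //; exact: ltW.
have hMb s : b < s <= T -> `|s `^ (1 - g) * y s| <= M.
  by move=> /andP[bs sT]; apply: hM; rewrite sT (lt_trans b0).
rewrite !TopE ?(ltW bt)//; [|exact: ltW|by rewrite ltW// (lt_trans b0)].
have d0 := dominated_trunc (lexx 0) cy M0 hM.
have db := dominated_trunc (ltW b0) cyb M0 hMb.
rewrite -(periodic_opB T a01 ag g1 zE t M0 M0 d0 db).
apply: (weighted_periodic_trunc T0 a01 ag g1 zE M0) => //; last exact: ltW.
  split; first by apply: measurable_funB; [case: d0|case: db].
  move=> s; rewrite /trunc; have [bs|bs] := ltP b s.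
    rewrite (lt_trans b0 bs)/=; case: ifP; rewrite subrr normr0 => _;
    by rewrite mulr_ge0// kpow_ge0.
  by rewrite /= subr0; exact: d0.2.
by move=> s bs; rewrite /trunc bs (lt_trans b0 bs) subrr.
Qed.

End top_operator.

(** * Bernstein splines *)

Section bernstein_moments.
Context {R : realFieldType}.
Implicit Types (n : nat) (x y : R) (f : nat -> R).

(** For nonnegative [x], [y] with [x + y = 1], the expectation of [f] under the binomial law with
    parameters [n] and [x]. *)
Definition bernstein_mean n x y f : R :=
  \sum_(j < n.+1) f j * ('C(n, j)%:R * x ^+ j * y ^+ (n - j)).

Lemma bernstein_mean1 n x y : x + y = 1 -> bernstein_mean n x y (fun=> 1) = 1.
Proof.
move=> xy; transitivity ((y + x) ^+ n); last by rewrite addrC xy expr1n.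
rewrite exprDn; apply: eq_bigr => j _.
by rewrite mul1r mulr_natl mulrnAl mulrC.
Qed.

(** The absorption identity [j * C(n+1, j) = (n+1) * C(n, j-1)], from which the first two moments
    follow. *)
Lemma bernstein_mean_shift n x y f :
  bernstein_mean n.+1 x y (fun j => j%:R * f j) =
  n.+1%:R * x * bernstein_mean n x y (fun j => f j.+1).
Proof.
rewrite /bernstein_mean big_ord_recl /= !mul0r add0r mulr_sumr.
apply: eq_bigr => j _; rewrite /bump/= add1n subSS exprS.
have E : j.+1%:R * 'C(n.+1, j.+1)%:R = n.+1%:R * 'C(n, j)%:R :> R.
  by rewrite -!natrM mul_bin_diag.
transitivity ((j.+1%:R * 'C(n.+1, j.+1)%:R) * (f j.+1 * (x * x ^+ j * y ^+ (n - j)))).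
  ring.
rewrite E; ring.
Qed.

Lemma bernstein_meanD n x y f f' : bernstein_mean n x y (fun j => f j + f' j) =
  bernstein_mean n x y f + bernstein_mean n x y f'.
Proof. by rewrite -big_split; apply: eq_bigr => j _; rewrite mulrDl. Qed.

Lemma bernstein_meanZ n x y c f : bernstein_mean n x y (fun j => c * f j) =
  c * bernstein_mean n x y f.
Proof. by rewrite /bernstein_mean mulr_sumr; apply: eq_bigr => j _; rewrite !mulrA. Qed.

Lemma eq_bernstein_mean n x y f f' : (forall j, f j = f' j) ->
  bernstein_mean n x y f = bernstein_mean n x y f'.
Proof. by move=> e; apply: eq_bigr => j _; rewrite e. Qed.

Lemma bernstein_meanX n x y : x + y = 1 ->
  bernstein_mean n x y (fun j => j%:R) = n%:R * x.
Proof.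
move=> xy; rewrite (@eq_bernstein_mean _ _ _ _ (fun j => j%:R * 1)); last first.
  by move=> j; rewrite mulr1.
case: n => [|n]; first by rewrite /bernstein_mean big_ord1 !mul0r.
by rewrite bernstein_mean_shift bernstein_mean1// mulr1.
Qed.

Lemma bernstein_variance n x y : x + y = 1 ->
  bernstein_mean n x y (fun j => (j%:R - n%:R * x) ^+ 2) = n%:R * x * y.
Proof.
move=> xy; have yE : y = 1 - x by rewrite -xy addrAC subrr add0r.
rewrite (@eq_bernstein_mean _ _ _ _ (fun j => j%:R * j%:R +
   ((- (2 * n%:R * x)) * j%:R + (n%:R * x) ^+ 2 * 1))); last by move=> j; ring.
rewrite !bernstein_meanD !bernstein_meanZ bernstein_meanX// bernstein_mean1//.
case: n => [|n]; first by rewrite /bernstein_mean big_ord1 expr2 !(mul0r, mulr0, addr0).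
rewrite bernstein_mean_shift (@eq_bernstein_mean _ _ _ _ (fun j => j%:R + 1)); last first.
  by move=> j; rewrite -natr1.
by rewrite bernstein_meanD bernstein_meanX// bernstein_mean1// yE -natr1; ring.
Qed.

Lemma bernstein_mean_le n x y f f' : 0 <= x -> 0 <= y ->
  (forall j, (j <= n)%N -> f j <= f' j) ->
  bernstein_mean n x y f <= bernstein_mean n x y f'.
Proof.
move=> x0 y0 ff'; apply: ler_sum => j _; apply: ler_wpM2r; last by apply: ff'; rewrite -ltnS.
by rewrite !mulr_ge0// exprn_ge0.
Qed.

Lemma norm_bernstein_mean_le n x y f : 0 <= x -> 0 <= y ->
  `|bernstein_mean n x y f| <= bernstein_mean n x y (fun j => `|f j|).
Proof.
move=> x0 y0; rewrite (le_trans (ler_norm_sum _ _ _))//; apply: ler_sum => j _.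
by rewrite normrM [X in _ * X <= _]ger0_norm// !mulr_ge0// exprn_ge0.
Qed.

End bernstein_moments.

Section bernstein_error.
Context {R : realType}.
Implicit Types (q n : nat) (a b s t S del : R) (f : R -> R).

Lemma modulus_chain a b del S f n :
  (forall s t, a <= s <= b -> a <= t <= b -> `|s - t| <= del -> `|f s - f t| <= S) ->
  forall s t, a <= s <= b -> a <= t <= b -> `|s - t| <= n.+1%:R * del ->
    `|f s - f t| <= n.+1%:R * S.
Proof.
move=> H; elim: n => [|n IHn] s t sab tab st.
  by rewrite mul1r; apply: H; rewrite ?mul1r// -[del]mul1r.
(* The point [u] cuts off the first of [n.+2] equal steps from [s] to [t]; it stays in [[a, b]] by
   convexity and leaves [n.+1] steps to the induction hypothesis. *)
pose l : R := n.+2%:R^-1.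
have l0 : 0 < l by rewrite invr_gt0.
have ln : n.+2%:R * l = 1 by rewrite mulfV.
have l1 : l <= 1 by rewrite invf_le1// ler1n.
pose u := s + l * (t - s).
have us : s - u = l * (s - t) by rewrite /u; ring.
have ut : u - t = (1 - l) * (s - t) by rewrite /u; ring.
have uab : a <= u <= b.
  case/andP: sab => a1 a2; case/andP: tab => a3 a4.
  by rewrite /u; apply/andP; split; nra.
have -> : f s - f t = (f s - f u) + (f u - f t) by ring.
rewrite (le_trans (ler_normD _ _))// -natr1 mulrDl mul1r addrC lerD//.
  apply: IHn => //; rewrite ut normrM ger0_norm ?subr_ge0//.
  apply: (le_trans (ler_wpM2l _ st)); rewrite ?subr_ge0//.
  rewrite mulrA le_eqVlt; apply/orP; left; apply/eqP; congr (_ * _).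
  by rewrite mulrBl mul1r mulrC ln -natr1 addrK.
apply: H => //; rewrite us normrM gtr0_norm//.
apply: (le_trans (ler_wpM2l (ltW l0) st)).
by rewrite mulrA (mulrC l) ln mul1r.
Qed.

Lemma bernsteinE q a b f t :
  bernstein q a b f t = bernstein_mean q ((t - a) / (b - a)) ((b - t) / (b - a))
    (fun j => f (a + j%:R * (b - a) / q%:R)).
Proof. by apply: eq_bigr => j _; rewrite !mulrA. Qed.

Lemma bernstein_coord a b t : a < b -> (t - a) / (b - a) + (b - t) / (b - a) = 1.
Proof. by move=> ab; field; rewrite subr_eq0 gt_eqF. Qed.

(* The [floor r + 1] steps of the modulus cost at most [1 + r ^ 2], whose Bernstein
   mean is [1 + x (1 - x) <= 5 / 4]. *)
Lemma bernstein_error q a b f S t : (0 < q)%N -> a < b ->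
  (forall s s', a <= s <= b -> a <= s' <= b -> `|s - s'| <= (b - a) / Num.sqrt q%:R ->
     `|f s - f s'| <= S) ->
  a <= t <= b -> `|bernstein q a b f t - f t| <= 5 / 4 * S.
Proof.
move=> q0 ab H tab.
have ba0 : 0 < b - a by rewrite subr_gt0.
have q0R : 0 < q%:R :> R by rewrite ltr0n.
have sq0 : 0 < Num.sqrt q%:R :> R by rewrite sqrtr_gt0.
have sqE : Num.sqrt q%:R * Num.sqrt q%:R = q%:R :> R by rewrite -expr2 sqr_sqrtr// ltW.
have S0 : 0 <= S.
  have := H t t tab tab; rewrite !subrr !normr0; apply.
  by rewrite divr_ge0 ?(ltW ba0)// ltW.
have xy := bernstein_coord t ab.
rewrite bernsteinE; set x := (t - a) / (b - a) in xy *; set y := (b - t) / (b - a) in xy *.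
have x0 : 0 <= x by case/andP: tab => ? ?; rewrite divr_ge0 ?subr_ge0// ltW.
have y0 : 0 <= y by case/andP: tab => ? ?; rewrite divr_ge0 ?subr_ge0// ltW.
have -> : f t = bernstein_mean q x y (fun=> f t * 1).
  by rewrite bernstein_meanZ bernstein_mean1// mulr1.
rewrite -[X in `|_ - X|]mul1r -mulNr -bernstein_meanZ -bernstein_meanD.
apply: (le_trans (norm_bernstein_mean_le _ _ x0 y0)).
apply: (@le_trans _ _ (bernstein_mean q x y
  (fun j => S * (1 + q%:R^-1 * (j%:R - q%:R * x) ^+ 2)))); last first.
  rewrite bernstein_meanZ mulrC ler_wpM2r// bernstein_meanD bernstein_mean1//.
  rewrite bernstein_meanZ bernstein_variance//.
  rewrite (_ : q%:R^-1 * (q%:R * x * y) = x * y); last by field; rewrite gt_eqF.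
  have -> : y = 1 - x by rewrite -xy addrAC subrr add0r.
  by rewrite -subr_ge0 (_ : _ - _ = (x - 1 / 2) ^+ 2) ?sqr_ge0//; field.
apply: bernstein_mean_le => // j jq; rewrite mulr1 mulN1r.
set u := a + _.
have jq1 : j%:R / q%:R <= 1 :> R by rewrite ler_pdivrMr// mul1r ler_nat.
have jq0 : 0 <= j%:R / q%:R :> R by rewrite divr_ge0// ltW.
have uab : a <= u <= b.
  by rewrite /u mulrAC; apply/andP; split; nra.
(* The distance from the node to [t] in units of [(b - a) / sqrt q]; its mean square is the binomial
   variance divided by [q]. *)
pose r := `|j%:R - q%:R * x| / Num.sqrt q%:R.
have r0 : 0 <= r by rewrite divr_ge0// ltW.
have ur : `|u - t| = r * ((b - a) / Num.sqrt q%:R).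
  rewrite /r (_ : u - t = (j%:R - q%:R * x) * ((b - a) / q%:R)); last first.
    by rewrite /u /x; field; rewrite !gt_eqF//.
  rewrite normrM (ger0_norm (_ : 0 <= (b - a) / q%:R)); last by rewrite divr_ge0// ltW.
  rewrite -[RHS]mulrA; congr (_ * _); rewrite -[in LHS]sqE.
  by move: (gt_eqF sq0); move: (Num.sqrt _) => w w0; field; rewrite w0.
pose n := Num.truncn r.
have nr : n%:R <= r by rewrite truncn_le.
have rn : r <= n.+1%:R by rewrite ltW// truncnS_gt.
have := @modulus_chain a b _ S f n H u t uab tab.
rewrite ur ler_wpM2r ?divr_ge0 ?(ltW ba0) ?(ltW sq0)// => /(_ isT) hf.
apply: (le_trans hf); rewrite mulrC ler_wpM2l// -natr1 addrC lerD2l.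
have -> : q%:R^-1 * (j%:R - q%:R * x) ^+ 2 = r ^+ 2.
  by rewrite /r expr_div_n real_normK ?num_real// expr2 expr2 sqE mulrC.
apply: (@le_trans _ _ (n%:R ^+ 2)); last by rewrite lerXn2r// nnegrE.
by rewrite -natrX ler_nat; case: (n) => // k; rewrite expnS expn1 leq_pmulr.
Qed.

Lemma bernstein_left q a b f : (0 < q)%N -> a < b -> bernstein q a b f a = f a.
Proof.
move=> q0 ab; rewrite /bernstein big_ord_recl/= subrr mul0r expr0 subn0 divff; last first.
  by rewrite subr_eq0 gt_eqF.
rewrite expr1n !mul0r addr0 bin0 !mulr1 big1 ?addr0// => j _.
by rewrite /bump/= add1n exprS mul0r mulr0 mul0r.
Qed.

Lemma bernstein_right q a b f : (0 < q)%N -> a < b -> bernstein q a b f b = f b.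
Proof.
move=> q0 ab; rewrite /bernstein big_ord_recr/= subrr mul0r subnn expr0 divff; last first.
  by rewrite subr_eq0 gt_eqF.
rewrite big1 => [|j _]; last first.
  have : (0 < q - j)%N by rewrite subn_gt0.
  by case: (q - j)%N => // k _; rewrite exprS mul0r mulr0.
rewrite add0r expr1n binn !mulr1; congr f.
by field; rewrite pnatr_eq0 -lt0n.
Qed.

Lemma continuous_bernstein q a b f : continuous (bernstein q a b f).
Proof.
move=> t; rewrite /bernstein; apply: (cvg_big (@add_continuous R^o)) => j _.
have c1 : ((s - a) / (b - a)) ^+ j @[s --> t] --> ((t - a) / (b - a)) ^+ j.
  apply: (@continuous_comp _ _ _ (fun s => (s - a) / (b - a)) (fun x => x ^+ j)).
    by apply: cvgM; [apply: cvgB; [exact: cvg_id|exact: cvg_cst]|exact: cvg_cst].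
  exact: exprn_continuous.
have c2 : ((b - s) / (b - a)) ^+ (q - j) @[s --> t] --> ((b - t) / (b - a)) ^+ (q - j).
  apply: (@continuous_comp _ _ _ (fun s => (b - s) / (b - a)) (fun x => x ^+ (q - j))).
    by apply: cvgM; [apply: cvgB; [exact: cvg_cst|exact: cvg_id]|exact: cvg_cst].
  exact: exprn_continuous.
by apply: cvgM => //; apply: cvgM => //; exact: cvg_cst.
Qed.

End bernstein_error.

(** * Cells of a knot collection *)

Section knot_cells.
Context {R : realType} (eps T : R) (A : knots eps T).
Implicit Types (i j : nat) (s t S : R) (f h : R -> R).
Local Notation k := (nknot A).

Lemma knot_mono i j : (i <= j)%N -> (j <= k.+1)%N -> knot A i <= knot A j.
Proof.
elim: j => [|j IHj]; first by rewrite leqn0 => /eqP ->.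
rewrite leq_eqVlt => /predU1P[-> //|ij] jk.
apply: (le_trans (IHj _ (ltnW jk))) => //.
exact: ltW (knot_lt _).
Qed.

Lemma knot_in i : (i <= k.+1)%N -> eps <= knot A i <= T.
Proof.
move=> ik; rewrite -[X in X <= _ <= _](knot_first A) -[X in _ <= _ <= X](knot_last A).
by rewrite !knot_mono.
Qed.

Lemma cell_closed i t : cell A i t -> knot A i <= t <= knot A i.+1.
Proof. by rewrite /cell; case: ifP => _ /=; rewrite in_itv//= => /andP[-> /ltW ->]. Qed.

Lemma cellP i t : (i <= k)%N -> knot A i <= t < knot A i.+1 -> cell A i t.
Proof.
move=> ik /andP[it ti]; rewrite /cell; case: ifP => _ /=; rewrite in_itv/= it//.
exact: ltW.
Qed.

Lemma cell_disjoint i j t : (i < j)%N -> (j <= k)%N -> cell A i t -> ~ cell A j t.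
Proof.
move=> ij jk; rewrite {1}/cell ifF; last first.
  by apply/negbTE; rewrite neq_ltn (leq_trans ij jk).
rewrite /= in_itv/= => /andP[_ ti] /cell_closed/andP[jt _].
have : knot A i.+1 <= knot A j by rewrite knot_mono// (leq_trans jk).
by rewrite leNgt (le_lt_trans jt).
Qed.

Lemma spline_cell q f i t : (i <= k)%N -> cell A i t ->
  spline A q f t = bernstein q (knot A i) (knot A i.+1) f t.
Proof.
move=> ik it; rewrite /spline (bigD1 (Ordinal (ik : i < k.+1)%N))//=.
rewrite indicE mem_set// mul1r big1 ?addr0// => j ji.
rewrite indicE memNset ?mul0r//.
have [ij|ij|ij] := ltngtP i j.
- by apply: (cell_disjoint ij) => //; rewrite -ltnS.
- by move=> jt; exact: (cell_disjoint ij ik jt it).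
- by move: ji; rewrite -val_eqE/= ij eqxx.
Qed.

(** At a right endpoint the value comes from the next cell, but Bernstein polynomials interpolate at
    both end nodes, so the two polynomials agree there. The last cell contains its right endpoint.
    Continuity of the spline rests on this. *)
Lemma spline_closed_cell q f i t : (0 < q)%N -> (i <= k)%N ->
  knot A i <= t <= knot A i.+1 ->
  spline A q f t = bernstein q (knot A i) (knot A i.+1) f t.
Proof.
move=> q0 ik /andP[it]; rewrite le_eqVlt => /predU1P[->|ti]; last first.
  by apply: spline_cell => //; apply: cellP; rewrite ?it.
rewrite bernstein_right ?knot_lt//.
move: ik; rewrite leq_eqVlt => /predU1P[ik|ik].
  rewrite (@spline_cell q f i)// ?ik//; last first.
    by rewrite /cell eqxx /= in_itv/= lexx andbT -ik ltW// knot_lt// ik.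
  by rewrite -ik bernstein_right// knot_lt// ik.
rewrite (@spline_cell q f i.+1)//; first by rewrite bernstein_left// knot_lt.
by apply: cellP => //; rewrite lexx knot_lt.
Qed.

Lemma knot_cover t : eps <= t <= T ->
  exists2 i, (i <= k)%N & knot A i <= t <= knot A i.+1.
Proof.
move=> /andP[et tT].
suff H n : (n <= k)%N -> t <= knot A n.+1 ->
    exists2 i, (i <= k)%N & knot A i <= t <= knot A i.+1.
  by apply: (H k) => //; rewrite knot_last.
elim: n => [|n IHn] nk tn; first by exists 0%N => //; rewrite knot_first et.
have [|nt] := leP t (knot A n.+1); first by apply: IHn; exact: ltnW.
by exists n.+1 => //; rewrite ltW.
Qed.

Lemma spline_continuous q f : (0 < q)%N ->
  {within `[eps, T], continuous (spline A q f)}.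
Proof.
move=> q0.
suff H n : (n <= k)%N -> {within `[knot A 0, knot A n.+1], continuous (spline A q f)}.
  by have := H k (leqnn k); rewrite knot_first knot_last.
have cc i : (i <= k)%N -> {within `[knot A i, knot A i.+1], continuous (spline A q f)}.
  move=> ik; apply/continuous_itv_distP => s sk e e0.
  have := @continuous_bernstein R q (knot A i) (knot A i.+1) f s.
  move=> /cvgrPdist_lt/(_ _ e0)/nbhs_ballP[del /= del0 B].
  exists del => // t tk st; rewrite !(@spline_closed_cell q f i)//.
  exact: B.
elim: n => [|n IHn] nk; first exact: cc.
have k01 : knot A 0 <= knot A n.+1 by rewrite knot_mono// ltnW.
have k12 : knot A n.+1 <= knot A n.+2 by rewrite knot_mono.
rewrite (_ : `[knot A 0, knot A n.+2]%classic =
  `[knot A 0, knot A n.+1] `|` `[knot A n.+1, knot A n.+2]); last first.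
  apply/seteqP; split => t /=; rewrite !in_itv/=.
    move=> /andP[-> ->]; rewrite andbT.
    by case: (leP t (knot A n.+1)) => [|/ltW ->]; [left|right].
  move=> [/andP[-> t1]|/andP[t1 ->]]; first exact: le_trans t1 k12.
  by rewrite andbT (le_trans k01).
apply: withinU_continuous; [exact: itv_closed|exact: itv_closed|exact: IHn (ltnW nk)|].
exact: cc.
Qed.

Lemma spline_error q f S t : (0 < q)%N ->
  (forall i s s', (i <= k)%N -> knot A i <= s -> s <= s' -> s' <= knot A i.+1 ->
     s' - s <= cell_size A i / Num.sqrt q%:R -> `|f s' - f s| <= S) ->
  eps <= t <= T -> `|spline A q f t - f t| <= 5 / 4 * S.
Proof.
move=> q0 H /knot_cover[i ik it]; rewrite (spline_closed_cell _ q0 ik it).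
apply: bernstein_error => //; first exact: knot_lt.
move=> s s' /andP[is1 si] /andP[is1' s'i]; have [ss'|s's] := leP s s'.
  by rewrite distrC ger0_norm ?subr_ge0// distrC => ?; apply: (H i).
by rewrite ger0_norm ?subr_ge0 ?(ltW s's)// => ?; apply: (H i) => //; exact: ltW.
Qed.

Lemma cell_size_gt0 i : (i <= k)%N -> 0 < cell_size A i.
Proof. by move=> ik; rewrite subr_gt0 knot_lt. Qed.

Lemma cell_size_le_mesh i : (i <= k)%N -> cell_size A i <= mesh A.
Proof.
move=> ik; apply: ub_le_sup; last by exists i.
exists (T - eps) => _ [j /= jk <-].
have /andP[_ h1] : eps <= knot A j.+1 <= T by exact: knot_in.
have /andP[h2 _] : eps <= knot A j <= T by apply: knot_in; exact: leqW.
exact: lerB.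
Qed.

Lemma mesh_gt0 : 0 < mesh A.
Proof. exact: lt_le_trans (cell_size_gt0 (leq0n _)) (cell_size_le_mesh (leq0n _)). Qed.

End knot_cells.

Lemma sqrtr_natn_ge1 (R : realType) (q : nat) : (0 < q)%N -> 1 <= Num.sqrt (q%:R : R).
Proof. by move=> q0; rewrite -[leLHS]sqrtr1 ler_wsqrtr// ler1n. Qed.

(** * Size of Omega and the spline error *)

Section omega_bounds.
Context {R : realType}.
Variables (eps T a g z : R) (A : knots eps T).
Hypotheses (e0 : 0 < eps) (eT : eps < T) (a01 : 0 < a < 1) (ag : a <= g) (g1 : g <= 1)
  (zE : z = 1 - g + a).
Implicit Types (i : nat) (s t M : R) (f y : R -> R).
Local Notation k := (nknot A).

Let T0 : 0 < T. Proof. exact: lt_trans eT. Qed.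
Let a0 : 0 < a. Proof. by case/andP: a01. Qed.
Let g0 : 0 < g. Proof. exact: lt_le_trans ag. Qed.
Let z0 : 0 < z. Proof. by rewrite zE ltr_wpDl// subr_ge0. Qed.
Let az : a <= z. Proof. by rewrite zE lerDr subr_ge0. Qed.
Let Ga0 : 0 < Gamma (a + 1).
Proof.
have a01' : 0 < a <= 1 by rewrite a0 ltW//; case/andP: a01.
by rewrite GammaS// mulr_gt0// Gamma_gt0.
Qed.
Let b1 : 0 <= a * beta_fn g a.
Proof. by rewrite mulr_ge0 ?(ltW a0)// inc_beta_ge0. Qed.
Let b2 : 0 <= z * beta_fn g z.
Proof. by rewrite mulr_ge0 ?(ltW z0)// inc_beta_ge0. Qed.

(** Comes from [Omega] by [t' / t <= T / eps]. It depends on [eps] but not on the knots or [q],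
    which makes the rate uniform in them. *)
Definition omega_cst : R :=
  (a * beta_fn g a + 2 * (T / eps) `^ (1 - g) + z * beta_fn g z) / Gamma (a + 1).

Lemma omega_cst_ge0 : 0 <= omega_cst.
Proof.
apply: (divr_ge0 _ (ltW Ga0)); apply: (addr_ge0 _ b2); apply: (addr_ge0 b1).
exact: (mulr_ge0 _ (powR_ge0 _ _)).
Qed.

Lemma Omega_le s t : eps <= s -> s <= t -> t <= T ->
  Omega T a g z s t <= omega_cst * (t - s) `^ a.
Proof.
move=> es st tT; have s0 := lt_le_trans e0 es; have t0 := lt_le_trans s0 st.
rewrite /Omega /omega_cst.
have D0 : 0 <= (t - s) `^ a by exact: powR_ge0.
have h1 : (t / s) `^ (1 - g) <= (T / eps) `^ (1 - g).
  apply: ler_powR_base; rewrite ?subr_ge0 ?divr_ge0 ?(ltW t0) ?(ltW s0)//.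
  by apply: ler_pM; rewrite ?(ltW t0) ?invr_ge0 ?(ltW s0)// lef_pV2.
have h2 : (t - s) `^ z * T `^ a / T `^ z <= (t - s) `^ a.
  have E x : (t - s) `^ x / T `^ x = ((t - s) / T) `^ x.
    rewrite powRM ?subr_ge0 ?invr_ge0 ?(ltW T0)//; congr (_ * _).
    by rewrite -(powR_inv1 (ltW T0)) -powRrM mulN1r powRN.
  rewrite mulrAC -ler_pdivlMr ?powR_gt0// !E.
  move: st; rewrite le_eqVlt => /predU1P[->|st1].
    by rewrite subrr mul0r !powR0 ?gt_eqF.
  apply: ger_powR => //; rewrite divr_gt0 ?subr_gt0//= ler_pdivrMr// mul1r.
  by rewrite lerBlDr (le_trans tT)// lerDl ltW.
have Gi : 0 <= (Gamma (a + 1))^-1 by rewrite invr_ge0 ltW.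
move: b1 b2 D0 h1 h2 Gi; rewrite invfM.
move: (a * beta_fn g a) (z * beta_fn g z) ((t - s) `^ a) ((t / s) `^ _) ((T / eps) `^ _)
  (Gamma (a + 1))^-1 ((t - s) `^ z) (T `^ a) (T `^ z)^-1 => b b' D x X G u v w.
move=> b0 b'0 D0 xX h2 G0.
have -> : D * G * (b + 2 * x) + u * v * (G * w) * b' =
  G * (D * (b + 2 * x) + (u * v * w) * b') by ring.
rewrite [leRHS](_ : _ = G * (D * (b + 2 * X) + D * b')); last by ring.
by rewrite ler_wpM2l// lerD//; [rewrite ler_wpM2l// lerD2l ler_wpM2l|rewrite ler_wpM2r].
Qed.

Lemma Omega_refl s : Omega T a g z s s = 0.
Proof. by rewrite /Omega subrr !powR0 ?gt_eqF// !mul0r addr0. Qed.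

Lemma Omega_ge s t : eps <= s -> s <= t ->
  2 / Gamma (a + 1) * (t - s) `^ a <= Omega T a g z s t.
Proof.
move=> es st; have s0 := lt_le_trans e0 es; have t0 := lt_le_trans s0 st.
have h1 : 1 <= (t / s) `^ (1 - g).
  apply: (@le_trans _ _ (1 `^ (1 - g))); first by rewrite powR1.
  by apply: ler_powR_base; rewrite ?subr_ge0// ler_pdivlMr// mul1r.
have X0 : 0 <= (t - s) `^ z * T `^ a / (Gamma (a + 1) * T `^ z) * (z * beta_fn g z).
  by rewrite mulr_ge0// divr_ge0 ?mulr_ge0 ?powR_ge0// ltW.
rewrite /Omega (le_trans _ (lerD (lexx _) X0))// addr0.
rewrite [leLHS](_ : _ = (t - s) `^ a / Gamma (a + 1) * 2); last first.
  by move: (_ `^ _) (Gamma _)^-1 => *; ring.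
rewrite ler_wpM2l ?divr_ge0 ?powR_ge0 ?(ltW Ga0)//.
by move: b1 h1; move: (a * beta_fn g a) (_ `^ _) => u x *; lra.
Qed.

Let inner q i : set R := [set Omega T a g z p.1 p.2 |
  p in [set p | [/\ cell A i p.1, cell A i p.2, p.1 <= p.2 &
                 p.2 - p.1 <= cell_size A i / Num.sqrt q%:R]]].

Let inner_ub q i : (i <= k)%N ->
  ubound (inner q i) (omega_cst * (mesh A / Num.sqrt q%:R) `^ a).
Proof.
move=> ik _ [[s t] /= [/cell_closed/andP[s1 s2] /cell_closed/andP[t1 t2] st sth] <-].
have /andP[eA _] : eps <= knot A i <= T by apply: knot_in; exact: leqW.
have /andP[_ AT] : eps <= knot A i.+1 <= T by exact: knot_in.
have es := le_trans eA s1; have tT := le_trans t2 AT.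
apply: (le_trans (Omega_le es st tT)); rewrite ler_wpM2l ?omega_cst_ge0//.
apply: ler_powR_base; rewrite ?subr_ge0 ?(ltW a0)// (le_trans sth)//.
by rewrite ler_wpM2r ?invr_ge0 ?sqrtr_ge0// cell_size_le_mesh.
Qed.

Let inner_mem0 q i : (i <= k)%N -> inner q i 0.
Proof.
move=> ik; have ci : cell A i (knot A i) by apply: cellP => //; rewrite lexx knot_lt.
exists (knot A i, knot A i); last by rewrite /= Omega_refl.
by split => //=; rewrite subrr divr_ge0 ?sqrtr_ge0// ltW// cell_size_gt0.
Qed.

Lemma Omega_knots_le q :
  Omega_knots A a g z q <= 5 / 4 * (omega_cst * (mesh A / Num.sqrt q%:R) `^ a).
Proof.
rewrite /Omega_knots ler_wpM2l//; apply: ge_sup.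
  by exists (sup (inner q 0)), 0%N.
move=> _ [i /= ik <-]; apply: ge_sup; first by exists 0; exact: inner_mem0.
exact: inner_ub.
Qed.

Lemma Omega_le_knots q i s t : (i <= k)%N -> cell A i s -> cell A i t -> s <= t ->
  t - s <= cell_size A i / Num.sqrt q%:R ->
  5 / 4 * Omega T a g z s t <= Omega_knots A a g z q.
Proof.
move=> ik si ti st sth; rewrite /Omega_knots ler_wpM2l//.
apply: (@le_trans _ _ (sup (inner q i))).
  apply: ub_le_sup; last by exists (s, t).
  by exists (omega_cst * (mesh A / Num.sqrt q%:R) `^ a); exact: inner_ub.
apply: ub_le_sup; last by exists i.
exists (omega_cst * (mesh A / Num.sqrt q%:R) `^ a) => _ [j /= jk <-].
by apply: ge_sup; [exists 0; exact: inner_mem0|exact: inner_ub].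
Qed.

(** Strict positivity leaves room for other pairs: by [Omega_knots_le], any fine enough mesh or
    large enough order has a smaller Omega and so inherits the hypotheses stated for the given
    pair. *)
Lemma Omega_knots_gt0 q : (0 < q)%N -> 0 < Omega_knots A a g z q.
Proof.
move=> q0; have sq1 : 1 <= Num.sqrt q%:R :> R by exact: sqrtr_natn_ge1.
have sq0 : 0 < Num.sqrt q%:R :> R by exact: lt_le_trans sq1.
have h0 : 0 < cell_size A 0 by exact: cell_size_gt0.
(* Half of the admissible length, so that [eps + d] lies strictly inside the first cell, which may
   be half-open, even for [q = 1]. *)
pose d := cell_size A 0 / Num.sqrt q%:R / 2.
have d0 : 0 < d by rewrite !divr_gt0.
have dq : d <= cell_size A 0 / Num.sqrt q%:R by rewrite ler_pdivrMr// ler_peMr ?ler1n// ltW// divr_gt0.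
have dh : d < cell_size A 0.
  rewrite (@le_lt_trans _ _ (cell_size A 0 / 2))//; last by rewrite ltr_pdivrMr// ltr_pMr// ltr1n.
  by rewrite ler_wpM2r ?invr_ge0// ler_pdivrMr// ler_peMr// ltW.
have c0 : cell A 0 eps by apply: cellP => //; rewrite knot_first lexx -[ltLHS](knot_first A) knot_lt.
have cd : cell A 0 (eps + d).
  apply: cellP => //; rewrite knot_first lerDl (ltW d0)/= -ltrBrDl.
  by rewrite -[X in _ - X](knot_first A).
have := @Omega_le_knots q 0 eps (eps + d) (leq0n _) c0 cd.
rewrite addrAC subrr add0r lerDl (ltW d0) => /(_ isT dq).
apply: lt_le_trans; rewrite mulr_gt0//.
apply: (lt_le_trans _ (@Omega_ge eps (eps + d) (lexx _) _)); rewrite ?lerDl ?(ltW d0)//.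
by rewrite addrAC subrr add0r mulr_gt0 ?powR_gt0// divr_gt0.
Qed.

(** [Omega_knots] already contains the constant 5/4, so increments are compared with 4/5 of it. It
    takes pairs from half-open cells only, whereas the Bernstein estimate needs closed ones;
    continuity of [f] bridges the gap. *)
Lemma spline_Omega_error q f M t : (0 < q)%N -> 0 <= M ->
  {within `[eps, T], continuous f} ->
  (forall s s', eps <= s -> s <= s' -> s' <= T ->
     `|f s' - f s| <= Omega T a g z s s' * M) ->
  eps <= t <= T -> `|spline A q f t - f t| <= Omega_knots A a g z q * M.
Proof.
move=> q0 M0 cf fO tT.
have -> : Omega_knots A a g z q * M = 5 / 4 * (4 / 5 * Omega_knots A a g z q * M).
  by move: (Omega_knots _ _ _ _ _) => x; field.
apply: spline_error => // i s s' ik is1 ss' s'i s'sh.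
set S := 4 / 5 * _ * M.
have /andP[eA _] : eps <= knot A i <= T by apply: knot_in; exact: leqW.
have /andP[_ AT] : eps <= knot A i.+1 <= T by exact: knot_in.
have key u : s <= u -> u <= s' -> cell A i s -> cell A i u -> `|f u - f s| <= S.
  move=> su us' cs cu.
  apply: (le_trans (fO _ _ (le_trans eA is1) su (le_trans us' (le_trans s'i AT)))).
  rewrite ler_wpM2r//.
  have : u - s <= cell_size A i / Num.sqrt q%:R by apply: le_trans s'sh; rewrite lerD2r.
  move=> /(Omega_le_knots ik cs cu su).
  move: (Omega T a g z s u) (Omega_knots A a g z q) => x y h; lra.
have S0 : 0 <= S.
  by rewrite /S mulr_ge0// mulr_ge0//; exact: ltW (Omega_knots_gt0 q0).
move: (ss'); rewrite le_eqVlt => /predU1P[->|ss1]; first by rewrite subrr normr0.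
have cs : cell A i s by apply: cellP => //; rewrite is1 (lt_le_trans ss1).
move: (s'i); rewrite le_eqVlt => /predU1P[s'E|s'i1]; last first.
  by apply: key => //; apply: cellP => //; rewrite s'i1 (le_trans is1).
(* Here [s'] is the right end of the cell; it is approached by a point [u] of the cell, at the cost
   of an arbitrary [e]. *)
apply/ler_addgt0Pr => e e'0.
have s'T : eps <= s' <= T by rewrite (le_trans eA (le_trans is1 ss'))//= (le_trans s'i).
move/continuous_itv_distP: cf => /(_ _ s'T _ e'0)[del del0 H].
pose u := Num.max s (s' - del / 2).
have su : s <= u by rewrite le_max lexx.
have us' : u < s' by rewrite gt_max ss1/= ltrBlDr ltrDl divr_gt0.
have uT : eps <= u <= T.
  by rewrite (le_trans (le_trans eA is1) su)/= (le_trans (ltW us'))//; case/andP: s'T.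
have us : `|s' - u| < del.
  rewrite ger0_norm ?subr_ge0 ?(ltW us')// ltrBlDr -ltrBlDl.
  by rewrite /u lt_max; apply/orP; right; rewrite ltrD2l ltrN2 ltr_pdivrMr// ltr_pMr// ltr1n.
have cu : cell A i u by apply: cellP => //; rewrite (le_trans is1 su)/= (lt_le_trans us').
have -> : f s' - f s = (f u - f s) + (f s' - f u) by ring.
rewrite (le_trans (ler_normD _ _))// lerD//; first by apply: key => //; exact: ltW.
by apply: ltW; exact: H.
Qed.

End omega_bounds.

(** * Weights from the spectral radius *)

Section spectral_weight.
Context {R : realType}.
Local Notation C := (complex R).
Local Notation normc := (@Normc.normc R).
Local Notation toC := (real_complex R).

Lemma normc_ge0 (x : C) : 0 <= normc x.
Proof. by case: x => x y; exact: sqrtr_ge0. Qed.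

Lemma normcD_le (x y : C) : normc (x + y) <= normc x + normc y.
Proof. exact: (@le_normcD R x y). Qed.

Lemma normc_real (x : R) : normc (toC x) = `|x|.
Proof. by rewrite /Normc.normc /= expr0n addr0 sqrtr_sqr. Qed.

Section powers.
Variables (n : nat) (M : 'M[C]_n.+1).
Implicit Types (v u : 'cV[C]_n.+1) (s : seq C).

Definition decays v : Prop := exists c r : R, [/\ 0 <= c, 0 <= r < 1 &
  forall k i, normc ((M ^+ k *m v) i 0) <= c * r ^+ k].

(* Decay is pulled back through one linear factor of the characteristic polynomial;
   Cayley-Hamilton then makes all vectors decay. *)
Lemma decays_eigen l v : normc l < 1 -> decays (M *m v - l *: v) -> decays v.
Proof.
move=> l1 [c [r [c0 /andP[r0 r1] H]]].
have l0 := normc_ge0 l.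
pose m := Num.max r (normc l).
have m1 : m < 1 by rewrite gt_max r1.
have rm : r <= m by rewrite le_max lexx.
have lm : normc l <= m by rewrite le_max lexx orbT.
(* If [r = normc l], the recursion can produce [k * r ^ k], so a rate strictly above [m] is taken.
   The constant [c'] is large enough for [m * c' + c <= r' * c'] and for the initial vector. *)
pose r' := (1 + m) / 2.
have mr' : m < r' by rewrite /r'; lra.
have r'1 : r' < 1 by rewrite /r'; lra.
have r'0 : 0 < r' by apply: le_lt_trans mr'; exact: le_trans rm.
pose c' := \sum_i normc (v i 0) + c / (r' - m).
have rm0 : 0 < r' - m by rewrite subr_gt0.
have S0 : 0 <= \sum_i normc (v i 0) by apply: sumr_ge0 => i _; exact: normc_ge0.
have c'0 : 0 <= c' by rewrite addr_ge0// divr_ge0// ltW.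
exists c', r'; split; rewrite ?c'0 ?(ltW r'0)//.
elim=> [|k IHk] i.
  rewrite expr0 mul1mx expr0 mulr1 /c' (bigD1 i)//= -addrA lerDl addr_ge0 ?divr_ge0 ?(ltW rm0)//.
  by apply: sumr_ge0 => j _; exact: normc_ge0.
have -> : M ^+ k.+1 *m v = l *: (M ^+ k *m v) + M ^+ k *m (M *m v - l *: v).
  by rewrite mulmxBr exprSr -scalemxAr addrC subrK mulmxA.
rewrite !mxE (le_trans (normcD_le _ _))//.
apply: (@le_trans _ _ (normc l * (c' * r' ^+ k) + c * r' ^+ k)).
  apply: lerD.
    by have := IHk i; rewrite mxE Normc.normcM => /ler_wpM2l; apply.
  have := H k i; rewrite mxE => /le_trans; apply; rewrite ler_wpM2l//.
  by rewrite lerXn2r ?nnegrE ?(ltW r'0)// (le_trans rm)// ltW.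
rewrite exprS [X in X + _]mulrA -mulrDl [leRHS]mulrA ler_wpM2r ?exprn_ge0 ?(ltW r'0)//.
apply: (@le_trans _ _ (m * c' + c)); first by rewrite lerD2r ler_wpM2r.
rewrite -lerBrDl (mulrC m) -mulrBr.
by rewrite /c' mulrDl divfK ?gt_eqF// lerDr mulr_ge0// ltW.
Qed.

Lemma decays_annihilated s v : all (fun l => normc l < 1) s ->
  horner_mx M (\prod_(l <- s) ('X - l%:P)) *m v = 0 -> decays v.
Proof.
elim: s v => [|l s IHs] v /=.
  rewrite big_nil rmorph1 mul1mx => _ ->.
  exists 0, 0; split; rewrite ?lexx ?ltr01// => k i.
  by rewrite mulmx0 mxE Normc.normc0 mul0r.
move=> /andP[l1 sl]; rewrite big_cons mulrC rmorphM /= rmorphB /= horner_mx_X horner_mx_C.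
move=> H; apply: (@decays_eigen l) => //; apply: IHs => //.
by rewrite -mul_scalar_mx -mulmxBl mulmxA.
Qed.

End powers.

(** The set of moduli must be bounded for its [sup] to be meaningful; the sum of the moduli of all
    characteristic roots is a bound. *)
Lemma spectral_radius_bound d (M : 'M[R]_d.+1) l :
  root (char_poly (map_mx toC M)) l -> normc l <= spectral_radius M.
Proof.
move=> rl; apply: ub_le_sup; last by exists l => //=; rewrite eigenvalue_root_char.
have [s sE] := closed_field_poly_normal (char_poly (map_mx toC M)).
exists (\sum_(l <- s) normc l) => _ [l' /= /[!eigenvalue_root_char] rl' <-].
have ls : l' \in s.
  move: rl'; rewrite sE (monicP (char_poly_monic _)) scale1r root_prod_XsubC.
  by [].
rewrite (big_rem _ ls)/= lerDl; apply: sumr_ge0 => j _; exact: normc_ge0.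
Qed.

(** By Cayley-Hamilton the vector of ones is annihilated by the product of linear factors, hence
    decays under the powers of [M]. The value 1/2 stands for any bound below 1. *)
Lemma spectral_radius_pow d (M : 'M[R]_d.+1) : spectral_radius M < 1 ->
  exists N, forall i, ((M ^+ N) *m const_mx 1 : 'cV[R]_d.+1) i 0 <= 1 / 2.
Proof.
move=> M1; pose Mc := map_mx toC M.
have [s sE] := closed_field_poly_normal (char_poly Mc).
rewrite (monicP (char_poly_monic _)) scale1r in sE.
have sl : all (fun l => normc l < 1) s.
  apply/allP => l ls; apply: le_lt_trans M1; apply: spectral_radius_bound.
  by rewrite -/Mc sE root_prod_XsubC.
have := @decays_annihilated d Mc s (const_mx 1) sl.
rewrite -sE Cayley_Hamilton mul0mx => /(_ erefl)[c [r [c0 /andP[r0 r1] H]]].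
have : c * r ^+ k @[k --> \oo] --> 0.
  rewrite -[X in _ --> X](mulr0 c); apply: cvgM; first exact: cvg_cst.
  by apply: cvg_expr; rewrite ger0_norm.
move=> /cvgrPdist_lt/(_ (1 / 2))[]; first by rewrite divr_gt0.
move=> N _ /(_ N (leqnn N)) /=; rewrite sub0r normrN => cr.
exists N => i; apply: le_trans (ler_norm _) _; rewrite -normc_real.
apply: (@le_trans _ _ (c * r ^+ N)); last first.
  by apply: ltW; apply: le_lt_trans cr; exact: ler_norm.
have E : toC ((M ^+ N *m const_mx 1 : 'cV[R]_d.+1) i 0) =
    (Mc ^+ N *m const_mx 1 : 'cV[C]_d.+1) i 0.
  have -> : const_mx 1 = map_mx toC (const_mx 1) :> 'cV[C]_d.+1.
    by apply/matrixP => a b; rewrite !mxE.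
  have -> : Mc ^+ N = map_mx toC (M ^+ N) by rewrite /Mc rmorphXn.
  by rewrite -map_mxM [RHS]mxE.
by rewrite E; exact: H.
Qed.

(** A strictly positive weight is needed to divide by; a Perron eigenvector may have zero entries
    when the matrix is reducible. *)
Lemma spectral_weight d (M : 'M[R]_d) : (forall i j, 0 <= M i j) ->
  spectral_radius M < 1 ->
  exists (w : 'cV[R]_d) (r : R), [/\ 0 <= r < 1, forall i, 0 < w i 0 &
    forall i, (M *m w) i 0 <= r * w i 0].
Proof.
case: d M => [|d] M M0 M1.
  exists 0, 0; split; rewrite ?lexx ?ltr01//; by move=> [].
have [N HN] := spectral_radius_pow M1.
pose p k : 'cV[R]_d.+1 := M ^+ k *m const_mx 1.
have p0 : p 0%N = const_mx 1 by rewrite /p expr0 mul1mx.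
have pS k : p k.+1 = M *m p k by rewrite /p exprS mulmxA.
have p_ge0 k i : 0 <= p k i 0.
  elim: k i => [|k IHk] i; first by rewrite p0 mxE.
  by rewrite pS mxE; apply: sumr_ge0 => j _; rewrite mulr_ge0.
have N0 : (0 < N)%N.
  rewrite lt0n; apply/eqP => N0; have := HN 0; rewrite N0 -/(p 0%N) p0 mxE; lra.
(* A truncated Neumann series: [M w = w - 1 + M ^ N 1 <= w - 1 / 2]. *)
pose w := \sum_(k < N) p k.
have w1 i : 1 <= w i 0.
  rewrite /w summxE; case: (N) N0 => // N' _.
  by rewrite big_ord_recl/= p0 mxE lerDl; apply: sumr_ge0 => k _; exact: p_ge0.
have w0 i : 0 < w i 0 by exact: lt_le_trans (w1 i).
have Mw : M *m w = w - const_mx 1 + p N.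
  rewrite /w mulmx_sumr; under eq_bigr do rewrite -pS.
  rewrite -p0; case: (N) N0 => // N' _.
  by rewrite big_ord_recr [in RHS]big_ord_recl/= [X in X - _]addrC addrK.
pose W := \sum_i w i 0.
have wW i : w i 0 <= W by rewrite /W (bigD1 i)//= lerDl; apply: sumr_ge0 => j _; exact: ltW.
have W1 : 1 <= W by exact: le_trans (w1 0) (wW 0).
have W0 : 0 < W by exact: lt_le_trans W1.
have Wi : W^-1 <= 1 by rewrite invf_le1.
have Wi0 : 0 < W^-1 by rewrite invr_gt0.
(* The absolute gain 1/2 becomes relative: [w i <= W] gives [1 / 2 >= w i / (2 W)]. *)
exists w, (1 - W^-1 / 2); split => //.
  apply/andP; split; lra.
move=> i; rewrite Mw.
have -> : (w - const_mx 1 + p N) i 0 = w i 0 - 1 + p N i 0 by rewrite !mxE.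
have pN : p N i 0 <= 1 / 2 := HN i.
have : W^-1 * w i 0 <= 1 by rewrite mulrC ler_pdivrMr// mul1r.
move: pN; move: (p N i 0) (w i 0) (W^-1) => x y u; lra.
Qed.

End spectral_weight.

(** * Riemann-Liouville derivatives *)

Section semigroup.
Context {R : realType}.
Local Notation mu := (@lebesgue_measure R).
Local Notation R2 := (measurableTypeR R * measurableTypeR R)%type.
Implicit Types (p q g t s M : R) (Y : R -> R).

Lemma rconvE p g M Y t : 0 < p -> 0 < g -> 0 <= M -> dominated g M Y ->
  (\int[mu]_s (kpow p (t - s) * Y s)%:E = (rconv p Y t)%:E)%E.
Proof.
move=> p0 g0 M0 hY; rewrite /rconv /Rintegral fineK//.
exact: (integrable_fin_num measurableT (integrable_rconv t p0 g0 M0 hY)).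
Qed.

Lemma measurable_rconv_ge0 p g M Y : 0 < p -> 0 < g -> 0 <= M -> dominated g M Y ->
  (forall s, 0 <= Y s) -> measurable_fun [set: R] (rconv p Y).
Proof.
move=> p0 g0 M0 hY Y0; apply/measurable_EFinP.
pose F (z : R2) : \bar R := (kpow p (z.1 - z.2) * Y z.2)%:E.
have mF : measurable_fun [set: R2] F.
  apply/measurable_EFinP; apply: measurable_funM.
    exact: (measurable_sub_comp (measurable_kpow p)).
  by apply: measurable_snd_comp; case: hY.
have F0 z : (0 <= F z)%E by rewrite lee_fin mulr_ge0// kpow_ge0.
have -> : EFin \o rconv p Y = fubini_F mu F.
  by apply/funext => t; rewrite /fubini_F/= (rconvE t p0 g0 M0 hY).
exact: measurable_fun_fubini_tonelli_F.
Qed.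

Lemma dominated_rconv_ge0 p g M Y : 0 < p -> 0 < g -> 0 <= M -> dominated g M Y ->
  (forall s, 0 <= Y s) -> dominated (p + g) (M * kbeta p g) (rconv p Y).
Proof.
move=> p0 g0 M0 hY Y0; split; first exact: (measurable_rconv_ge0 p0 g0 M0 hY Y0).
by move=> t; rewrite -mulrA; exact: rconv_le.
Qed.

Lemma rconvA_ge0 p q g M Y t : 0 < p -> 0 < q -> 0 < g -> 0 <= M -> dominated g M Y ->
  (forall s, 0 <= Y s) -> rconv p (rconv q Y) t = kbeta p q * rconv (p + q) Y t.
Proof.
move=> p0 q0 g0 M0 hY Y0; apply: EFin_inj.
have pq0 : 0 < p + q by exact: addr_gt0.
have qg0 : 0 < q + g by exact: addr_gt0.
have Mb0 : 0 <= M * kbeta q g by rewrite mulr_ge0// kbeta_ge0.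
rewrite -(rconvE t p0 qg0 Mb0 (dominated_rconv_ge0 q0 g0 M0 hY Y0)).
rewrite [RHS]EFinM -(rconvE t pq0 g0 M0 hY) -(integral_kpow_conv2 _ p0 q0)//; last by case: hY.
by apply: eq_integral => r _; rewrite EFinM (rconvE r q0 g0 M0 hY).
Qed.

(** Writes [Y] as a difference of two nonnegative dominated functions, which carries the
    Tonelli-based statements over to functions of variable sign. *)
Lemma rconv_decomp p g M Y t : 0 < p -> 0 < g -> 0 <= M -> dominated g M Y ->
  rconv p Y t = rconv p (fun s => Y s + M * kpow g s) t - rconv p (fun s => M * kpow g s) t.
Proof.
move=> p0 g0 M0 hY; have [mY hYs] := hY.
have h2 : dominated g M (fun s => M * kpow g s).
  split; first by apply: measurable_funM => //; exact: measurable_kpow.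
  by move=> s; rewrite ger0_norm// mulr_ge0// kpow_ge0.
have h1 : dominated g (M + M) (fun s => Y s + M * kpow g s).
  split; first by apply: measurable_funD => //; case: h2.
  by move=> s; rewrite mulrDl (le_trans (ler_normD _ _))// lerD//; case: h2.
rewrite -(rconvB t p0 g0 (addr_ge0 M0 M0) M0 h1 h2).
by congr (rconv p _ t); apply/funext => s; rewrite addrK.
Qed.

Lemma dominatedZ g M Y (c : R) : dominated g M Y -> dominated g (`|c| * M) (fun s => c * Y s).
Proof.
move=> [mY hY]; split; first exact: measurable_funM.
by move=> s; rewrite normrM -mulrA ler_wpM2l.
Qed.

Lemma dominated_rconv p g M Y : 0 < p -> 0 < g -> 0 <= M -> dominated g M Y ->
  dominated (p + g) (M * kbeta p g) (rconv p Y).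
Proof.
move=> p0 g0 M0 hY; split; last by move=> t; rewrite -mulrA; exact: rconv_le.
have [mY hYs] := hY; have MM0 := addr_ge0 M0 M0.
have Y20 s : 0 <= M * kpow g s by rewrite mulr_ge0// kpow_ge0.
have Y10 s : 0 <= Y s + M * kpow g s.
  by have := hYs s; rewrite ler_norml => /andP[h _]; rewrite -lerBlDr sub0r.
have h2 : dominated g M (fun s => M * kpow g s).
  split; first by apply: measurable_funM => //; exact: measurable_kpow.
  by move=> s; rewrite ger0_norm.
have h1 : dominated g (M + M) (fun s => Y s + M * kpow g s).
  split; first by apply: measurable_funD => //; case: h2.
  by move=> s; rewrite mulrDl (le_trans (ler_normD _ _))// lerD//; case: h2.
have -> : rconv p Y = (fun t => rconv p (fun s => Y s + M * kpow g s) t -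
    rconv p (fun s => M * kpow g s) t).
  by apply/funext => t; rewrite (rconv_decomp t p0 g0 M0 hY).
apply: measurable_funB; first exact: (measurable_rconv_ge0 p0 g0 MM0 h1 Y10).
exact: (measurable_rconv_ge0 p0 g0 M0 h2 Y20).
Qed.

Lemma rconvB2 p g g' M M' Y Y' t : 0 < p -> 0 < g -> 0 < g' -> 0 <= M -> 0 <= M' ->
  dominated g M Y -> dominated g' M' Y' ->
  rconv p (fun s => Y s - Y' s) t = rconv p Y t - rconv p Y' t.
Proof.
move=> p0 g0 g'0 M0 M0' hY hY'; rewrite /rconv -RintegralB//.
- by apply: eq_Rintegral => s _; rewrite mulrBr.
- exact: (integrable_rconv t p0 g0 M0 hY).
- exact: (integrable_rconv t p0 g'0 M0' hY').
Qed.

(** The semigroup law of Riemann-Liouville integrals; [kbeta p q] makes up for the omitted Gamma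
    factors. *)
Lemma rconvA p q g M Y t : 0 < p -> 0 < q -> 0 < g -> 0 <= M -> dominated g M Y ->
  rconv p (rconv q Y) t = kbeta p q * rconv (p + q) Y t.
Proof.
move=> p0 q0 g0 M0 hY; have [mY hYs] := hY.
have pq0 : 0 < p + q by exact: addr_gt0.
have qg0 : 0 < q + g by exact: addr_gt0.
have MM0 := addr_ge0 M0 M0.
pose Y1 s := Y s + M * kpow g s; pose Y2 s := M * kpow g s.
have Y20 s : 0 <= Y2 s by rewrite mulr_ge0// kpow_ge0.
have Y10 s : 0 <= Y1 s.
  by have := hYs s; rewrite ler_norml => /andP[h _]; rewrite /Y1 -lerBlDr sub0r.
have h2 : dominated g M Y2.
  split; first by apply: measurable_funM => //; exact: measurable_kpow.
  by move=> s; rewrite ger0_norm.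
have h1 : dominated g (M + M) Y1.
  split; first by apply: measurable_funD => //; case: h2.
  by move=> s; rewrite mulrDl (le_trans (ler_normD _ _))//; apply: lerD; [exact: hYs|exact: (h2.2 s)].
have -> : rconv q Y = (fun r => rconv q Y1 r - rconv q Y2 r).
  by apply/funext => r; rewrite (rconv_decomp r q0 g0 M0 hY).
have b0 := kbeta_ge0 q g.
rewrite (rconvB t p0 qg0 (mulr_ge0 MM0 b0) (mulr_ge0 M0 b0)
  (dominated_rconv_ge0 q0 g0 MM0 h1 Y10) (dominated_rconv_ge0 q0 g0 M0 h2 Y20)).
rewrite (rconvA_ge0 t p0 q0 g0 MM0 h1 Y10) (rconvA_ge0 t p0 q0 g0 M0 h2 Y20).
by rewrite -mulrBr -(rconv_decomp t pq0 g0 M0 hY).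
Qed.

End semigroup.

Lemma slope_dist_le (R : realFieldType) (x c d e : R) : 0 < d ->
  `|x - c * d| <= e * d -> `|c - x / d| <= e.
Proof.
move=> d0 H; rewrite -[c](mulfK (lt0r_neq0 d0)) -mulrBl normrM normfV.
by rewrite (gtr0_norm d0) ler_pdivrMr// distrC.
Qed.

Section riemann_liouville_derivative.
Context {R : realType}.
Local Notation mu := (@lebesgue_measure R).
Variables (g T : R).
Hypotheses (g0 : 0 < g) (g1 : g <= 1) (T0 : 0 < T).
Implicit Types (p t s M th c e : R) (h u v y : R -> R).

Lemma Cw_continuous_at y t : Cw g 0 T y -> 0 < t <= T -> forall e, 0 < e ->
  exists2 del, 0 < del & forall s, 0 < s <= T -> `|t - s| < del -> `|y t - y s| < e.
Proof.
move=> [h ch hy] /andP[t0 tT] e e0.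
have yE s : 0 < s <= T -> y s = s `^ (g - 1) * h s.
  move=> sT; rewrite -hy ?in_itv// mulrA -powRD; last first.
    by case/andP: sT => s0 _; rewrite (gt_eqF s0) implybT.
  by rewrite (_ : g - 1 + (1 - g) = 0) ?powRr0 ?mul1r//; ring.
have ct : h s @[s --> within `[0, T] (nbhs t)] --> h t.
  by move/subspace_continuousP : ch; apply; rewrite /= in_itv/= tT ltW.
have : s `^ (g - 1) * h s @[s --> within `[0, T] (nbhs t)] --> t `^ (g - 1) * h t.
  have c1 : s `^ (g - 1) @[s --> within `[0, T] (nbhs t)] --> t `^ (g - 1).
    by apply: cvg_within_filter; exact: cvg_powR.
  by apply: cvgM; [exact: c1|exact: ct].
move=> /cvgrPdist_lt/(_ _ e0); rewrite near_withinE => /nbhs_ballP[del /= del0 B].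
exists del => // s sT st; rewrite !yE ?t0//.
by apply: B => //=; rewrite in_itv/=; case/andP: sT => /ltW -> ->.
Qed.

(** [kpow 1] is the indicator of the positive reals, so the difference of the convolutions is the
    integral of [h] from [t] to [t']. *)
Lemma rconv1_diff h t t' c e : Cw g 0 T h -> 0 < t -> t <= t' -> t' <= T -> 0 <= e ->
  (forall s, t <= s <= t' -> `|h s - c| <= e) ->
  `|rconv 1 (trunc 0 T h) t' - rconv 1 (trunc 0 T h) t - c * (t' - t)| <= e * (t' - t).
Proof.
move=> ch t0 tt' t'T e0 he; set Y := trunc 0 T h.
have [M M0 hM] := Cw_bounded T0 ch.
have hY := dominated_trunc (lexx 0) ch M0 hM.
pose D s := kpow 1 (t' - s) * (t <= s)%R%:R : R.
have mD : measurable_fun [set: R] D.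
  by apply: measurable_funM; [exact: measurable_kpow_sub|exact: measurable_ger].
have D0 s : 0 <= D s by rewrite mulr_ge0// kpow_ge0.
have ID : (\int[mu]_s (D s)%:E = (t' - t)%:E)%E.
  rewrite /D integral_kpow_tail// powRr1 ?subr_ge0// divr1//.
have iD : mu.-integrable [set: R] (EFin \o D).
  by apply: (@integrable_of_bound R D D (t' - t)) => //; [move=> s; rewrite ger0_norm|rewrite ID].
have kD s : kpow 1 (t' - s) - kpow 1 (t - s) = D s.
  rewrite /D; have [ts|st] := leP t s; first by rewrite mulr1 (@kpow_le0 _ 1 (t - s)) ?subr0// subr_le0.
  by rewrite mulr0 !kpow_gt0 ?subr_gt0// ?(lt_le_trans st)// subrr !powRr0 subrr.
pose f s := (kpow 1 (t' - s) * Y s - kpow 1 (t - s) * Y s) - c * D s.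
have fE : \int[mu]_s f s = rconv 1 Y t' - rconv 1 Y t - c * (t' - t).
  rewrite /rconv -RintegralB//; last 2 first.
  - exact: (integrable_rconv t' ltr01 g0 M0 hY).
  - exact: (integrable_rconv t ltr01 g0 M0 hY).
  have -> : c * (t' - t) = \int[mu]_s (c * D s).
    by rewrite RintegralZl// /Rintegral ID.
  rewrite -RintegralB//.
  - exact: (integrableB measurableT (integrable_rconv t' ltr01 g0 M0 hY)
      (integrable_rconv t ltr01 g0 M0 hY)).
  - exact: (integrableZl measurableT c iD).
rewrite -fE.
apply: (@norm_Rintegral_le1 R f (fun s => e * D s)).
- apply: measurable_funB; last exact: measurable_funM.
  by apply: measurable_funB; apply: measurable_rconv_integrand; case: hY.
- exact: measurable_funM.
- move=> s; rewrite /f -mulrBl kD (mulrC c) -mulrBr normrM ger0_norm// mulrC.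
  have [tst'|] := boolP (t <= s < t').
    rewrite ler_wpM2r//; have /andP[ts st'] := tst'.
    have s0 := lt_le_trans t0 ts.
    by rewrite /Y trunc_id ?s0 ?(le_trans (ltW st'))//; apply: he; rewrite ts ltW.
  rewrite negb_and -ltNge -leNgt => /orP[st|t's].
    by rewrite /D (leNgt t s) st !mulr0.
  by rewrite /D kpow_le0 ?subr_le0// mul0r !mulr0.
- by rewrite ge0_integral_scale// ID -EFinM.
Qed.

(** The fundamental theorem of calculus through difference quotients, in the form of [is_RLderiv]:
    the limit is taken within []0, T]], hence one-sided at [T], and [h] may be singular at 0. *)
Lemma is_RLderiv_primitive th u h : Cw g 0 T h ->
  (forall t, 0 < t <= T -> RLint 0 t (1 - th) u t = rconv 1 (trunc 0 T h) t) ->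
  is_RLderiv T th u h.
Proof.
move=> ch H t; rewrite in_itv/= => /andP[t0 tT].
apply/cvgrPdist_le => e e0.
have t0T : 0 < t <= T by rewrite t0.
have [del del0 B] := Cw_continuous_at ch t0T e0.
rewrite near_withinE near_withinE; apply/nbhs_ballP; exists del => //= s st st' .
rewrite in_itv/= => /andP[s0 sT]; rewrite !H ?s0 ?t0//.
have near_t (r : R) : 0 < r -> r <= T -> `|t - r| <= `|t - s| -> `|h r - h t| <= e.
  move=> r0 rT rst; rewrite distrC; apply: ltW; apply: B; first by rewrite r0.
  exact: le_lt_trans st.
have [ts|st1|E] := ltgtP t s; last by move: st'; rewrite E eqxx.
  have d0 : 0 < s - t by rewrite subr_gt0.
  have X : `|rconv 1 (trunc 0 T h) s - rconv 1 (trunc 0 T h) t - h t * (s - t)| <= e * (s - t).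
    apply: (rconv1_diff ch t0 (ltW ts) sT (ltW e0)) => r /andP[tr rs].
    apply: near_t; [exact: lt_le_trans tr|exact: le_trans sT|].
    by rewrite !(distrC t) !ger0_norm ?subr_ge0 ?(ltW ts)// lerD2r.
  exact: slope_dist_le d0 X.
have d0 : 0 < t - s by rewrite subr_gt0.
have X : `|rconv 1 (trunc 0 T h) t - rconv 1 (trunc 0 T h) s - h t * (t - s)| <= e * (t - s).
  apply: (rconv1_diff ch s0 (ltW st1) tT (ltW e0)) => r /andP[sr rt].
  apply: near_t; [exact: lt_le_trans sr|exact: le_trans tT|].
  by rewrite !ger0_norm ?subr_ge0 ?(ltW st1)// lerD2l lerN2.
rewrite [_ / _](_ : _ = (rconv 1 (trunc 0 T h) t - rconv 1 (trunc 0 T h) s) / (t - s)).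
  exact: slope_dist_le d0 X.
by move: (rconv 1 _ s) (rconv 1 _ t) => x y; rewrite -(opprB t s) -(opprB y x) invrN mulrNN.
Qed.

End riemann_liouville_derivative.

Section riemann_liouville_regularity.
Context {R : realType}.
Variables (T a g z : R).
Hypotheses (T0 : 0 < T) (a01 : 0 < a < 1) (ag : a <= g) (g1 : g <= 1)
  (zE : z = 1 - g + a).
Implicit Types (t s p : R) (u y : R -> R).

Let a0 : 0 < a. Proof. by case/andP: a01. Qed.
Let g0 : 0 < g. Proof. exact: lt_le_trans ag. Qed.
Let z0 : 0 < z. Proof. by rewrite zE ltr_wpDl// subr_ge0. Qed.

Lemma Cw_RL0 u : Cw g 0 T u -> Cw_RL g 0 T u.
Proof.
move=> cu; split => //; exists u => //.
apply: (is_RLderiv_primitive g0 T0 cu) => t /andP[t0 tT].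
by rewrite subr0 (RLintE (lexx 0) 1 cu) ?(ltW t0)// Gamma1 invr1 mul1r.
Qed.

Lemma Cw_powR p : 0 <= p -> p <= g -> Cw g 0 T (fun s => s `^ p).
Proof.
move=> p0 pg; apply: Cw_of_continuous.
(* In this case [g = 1] and [p = 0], and the weighted function is constantly 1, also at 0 where
   [0 ^ 0] is 1. *)
have [E|E] := eqVneq (1 - g + p) 0.
  move/eqP: E; rewrite paddr_eq0 ?subr_ge0// => /andP[/eqP -> /eqP ->].
  rewrite (_ : (fun _ => _) = fun=> 1); last by apply/funext => s; rewrite !powRr0 mulr1.
  by move=> x; exact: cst_continuous.
rewrite (_ : (fun _ => _) = fun s => s `^ (1 - g + p)); last first.
  by apply/funext => s; rewrite [RHS]powRD// (negbTE E).
have e0 : 0 < 1 - g + p by rewrite lt_neqAle eq_sym E/= addr_ge0// subr_ge0.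
apply: (holder_within_continuous e0 (C := 1)) => s t s0 st tT.
rewrite mul1r ger0_norm; first by apply: powR_subD => //; rewrite -addrA gerDl addrC subr_le0.
by rewrite subr_ge0; apply: ler_powR_base => //; exact: ltW.
Qed.

Lemma Cw_rconv p y : 0 < p -> p <= g -> Cw g 0 T y -> Cw g 0 T (rconv p (trunc 0 T y)).
Proof.
move=> p0 pg cy; apply: Cw_of_continuous.
have [M M0 hM] := Cw_bounded T0 cy.
have hY := dominated_trunc (lexx 0) cy M0 hM.
apply: (holder_within_continuous p0 (C := M * holder_cst p g)) => s t s0 st tT.
exact: weighted_rconv_holder.
Qed.

(** The integral of order [1 + p] is the primitive of the one of order [p]. Order 0 is the identity
    rather than a convolution with [kpow 0], whence the separate case. *)
Lemma rconv_primitive p y : 0 <= p -> p <= g -> Cw g 0 T y ->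
  exists h c, Cw g 0 T h /\ forall t, 0 < t <= T ->
    rconv (1 + p) (trunc 0 T y) t = c * rconv 1 (trunc 0 T h) t.
Proof.
move=> p0 pg cy; have [M M0 hM] := Cw_bounded T0 cy.
have hY := dominated_trunc (lexx 0) cy M0 hM.
have [E|pn0] := eqVneq p 0.
  by exists y, 1; split => // t _; rewrite E addr0 mul1r.
have {p0}p0 : 0 < p by rewrite lt_neqAle eq_sym pn0.
have p01 : 0 < p <= 1 by rewrite p0 (le_trans pg).
have h11 : (0 < 1 :> R) && (1 <= 1 :> R) by rewrite ltr01 lexx.
have b0 := kbeta_gt0 h11 p01.
exists (rconv p (trunc 0 T y)), (kbeta 1 p)^-1; split; first exact: Cw_rconv.
move=> t /andP[t0 tT].
rewrite (@eq_rconv _ 1 _ (rconv p (trunc 0 T y))).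
  by rewrite (rconvA t ltr01 p0 g0 M0 hY) mulKf// gt_eqF.
move=> s st; rewrite /trunc; case: ifPn => //; rewrite negb_and -!leNgt.
move=> /orP[s0|]; first by rewrite (rconv_npos p hY s0).
by rewrite (le_trans (ltW st) tT).
Qed.

Lemma kpow_primitive p : 0 <= p ->
  exists c, forall t, 0 < t <= T ->
    kpow (1 + (p + 1)) t = c * rconv 1 (trunc 0 T (fun s => s `^ p)) t.
Proof.
move=> p0; have p10 : 0 < p + 1 by exact: ltr_wpDl.
exists (p + 1) => t /andP[t0 tT].
rewrite (@eq_rconv _ 1 _ (kpow (p + 1))).
  rewrite rconv_kpow//; have := kbeta1 p10; rewrite kbetaC => ->.
  by rewrite mulVKf// gt_eqF.
move=> s st; rewrite /trunc /kpow addrK (le_trans (ltW st) tT) andbT.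
by [].
Qed.

(** The condition [g - a <= a] makes the integral of order [z = 1 - (g - a)] of an image of [Top]
    have total order at least 1, so that its derivative stays in the weighted space. *)
Lemma Cw_RL_Top y u : g - a <= a -> Cw g 0 T y ->
  (forall t, 0 < t <= T -> u t = Top T a z 0 y t) -> Cw_RL g (g - a) T u.
Proof.
move=> ga cy uE.
have cu : Cw g 0 T u.
  apply: (eq_Cw (u := Top T a z 0 y)); first by move=> t /uE.
  exact: (Cw_Top T0 a01 ag g1 zE (lexx 0) T0 cy).
split => //.
have [M M0 hM] := Cw_bounded T0 cy.
have hY := dominated_trunc (lexx 0) cy M0 hM.
set Y := trunc 0 T y in hY.
(* Composition with the integral of order [1 - (g - a) = z] gives the orders [1 + del]
   and [1 + (del + 1)], hence primitives. *)
pose del := 2 * a - g.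
have del0 : 0 <= del by rewrite /del; lra.
have delg : del <= g by rewrite /del lerBlDr mulr_natl mulr2n lerD.
have a10 : 0 < a + 1 by exact: addr_gt0.
have zdel : z + a = 1 + del by rewrite zE /del; ring.
have zdel1 : z + (a + 1) = 1 + (del + 1) by rewrite addrA zdel -addrA.
have ag0 : 0 < a + g by exact: addr_gt0.
have [h1 [c1 [ch1 E1]]] := rconv_primitive del0 delg cy.
have [c2 E2] := kpow_primitive del0.
have ch2 := Cw_powR del0 delg.
have [M1 M10 hM1] := Cw_bounded T0 ch1; have [M2 M20 hM2] := Cw_bounded T0 ch2.
have hY1 := dominated_trunc (lexx 0) ch1 M10 hM1.
have hY2 := dominated_trunc (lexx 0) ch2 M20 hM2.
pose kap := z / a / T `^ z * rconv z Y T.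
pose k1 := (Gamma z)^-1 * ((Gamma a)^-1 * (kbeta z a * c1)).
pose k2 := (Gamma z)^-1 * ((Gamma a)^-1 * kap * (kbeta z (a + 1) * c2)).
pose h s := k1 * h1 s - k2 * s `^ del.
have cZ c v : Cw g 0 T v -> Cw g 0 T (fun s => c * v s).
  move=> [k ck kv]; exists (fun s => c * k s).
    by move=> s; apply: cvgM; [exact: cvg_cst|exact: ck].
  by move=> s sT; rewrite mulrCA kv.
have ch : Cw g 0 T h by exact: (CwB (cZ k1 _ ch1) (cZ k2 _ ch2)).
exists h => //.
apply: (is_RLderiv_primitive g0 T0 ch) => t t0T; have /andP[t0 tT] := t0T.
rewrite (_ : 1 - (g - a) = z); last by rewrite zE; ring.
rewrite (RLintE (lexx 0) z cu) ?(ltW t0)//.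
have hV1 := dominatedZ (Gamma a)^-1 (dominated_rconv a0 g0 M0 hY).
have hV2 := dominatedZ ((Gamma a)^-1 * kap) (dominated_kpow (a + 1)).
have Mb0 : 0 <= M * kbeta a g by rewrite mulr_ge0// kbeta_ge0.
have -> : rconv z (trunc 0 T u) t =
    rconv z (fun s => (Gamma a)^-1 * rconv a Y s - (Gamma a)^-1 * kap * kpow (a + 1) s) t.
  apply: eq_rconv => s st; have sT := le_trans (ltW st) tT.
  have [s0|s0] := leP s 0.
    by rewrite /trunc ltNge s0/= (rconv_npos a hY s0) (kpow_le0 _ s0) !mulr0 subrr.
  rewrite trunc_id ?s0// uE ?s0// (TopE T0 a01 ag g1 zE (lexx 0) T0 cy) ?(ltW s0)//.
  rewrite kpow_gt0// addrK /periodic_op -/Y /kap.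
  by move: (Gamma a)^-1 (rconv a Y s) (rconv z Y T) (s `^ a) (T `^ z)^-1 => *; ring.
rewrite (rconvB2 t z0 ag0 a10 (mulr_ge0 (normr_ge0 _) Mb0)
  (mulr_ge0 (normr_ge0 _) ler01) hV1 hV2).
rewrite (rconvZ _ t z0 ag0 Mb0 (dominated_rconv a0 g0 M0 hY)).
rewrite (rconvZ _ t z0 a10 ler01 (dominated_kpow (a + 1))).
rewrite (rconvA t z0 a0 g0 M0 hY) rconv_kpow// zdel zdel1 E1// E2//.
have -> : trunc 0 T h = (fun s => k1 * trunc 0 T h1 s - k2 * trunc 0 T (fun s => s `^ del) s).
  by apply/funext => s; rewrite /trunc; case: ifP; rewrite ?mulr0 ?subrr.
rewrite (rconvB t ltr01 g0 (mulr_ge0 (normr_ge0 _) M10) (mulr_ge0 (normr_ge0 _) M20)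
  (dominatedZ k1 hY1) (dominatedZ k2 hY2)).
rewrite (rconvZ _ t ltr01 g0 M10 hY1) (rconvZ _ t ltr01 g0 M20 hY2) /k1 /k2.
move: (rconv 1 _ t) (rconv 1 _ t) => i1 i2; move: (kbeta _ _) (kbeta _ _) => k3 k4.
by move: (Gamma a)^-1 (Gamma z)^-1 => *; ring.
Qed.

End riemann_liouville_regularity.

(** * Picard iterations *)

Section uniform_limits.
Context {R : realType}.
Implicit Types (a b t e C r B : R) (n : nat) (h : R -> R).

Lemma geometric_small C r e : 0 <= r < 1 -> 0 < e -> exists n, C * r ^+ n < e.
Proof.
move=> /andP[r0 r1] e0.
have : C * r ^+ k @[k --> \oo] --> 0.
  rewrite -[X in _ --> X](mulr0 C); apply: cvgM; first exact: cvg_cst.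
  by apply: cvg_expr; rewrite ger0_norm.
move=> /cvgrPdist_lt/(_ _ e0)[N _ /(_ N (leqnn N))] /=; rewrite sub0r normrN => H.
by exists N; exact: le_lt_trans (ler_norm _) H.
Qed.

(** [E n] is the sum of the remaining increments. The intervals of radius [E n] around [y n] are
    nested, and the supremum of their left ends lies in all of them, which yields the rate along
    with the limit. *)
Lemma geometric_limit (y : nat -> R) C r : 0 <= C -> 0 <= r < 1 ->
  (forall n, `|y n.+1 - y n| <= C * r ^+ n) ->
  exists l, forall n, `|y n - l| <= C / (1 - r) * r ^+ n.
Proof.
move=> C0 /andP[r0 r1] H.
have r10 : 0 < 1 - r by rewrite subr_gt0.
pose E n := C / (1 - r) * r ^+ n.
have ES n : E n - E n.+1 = C * r ^+ n.
  by rewrite /E exprS; field; rewrite gt_eqF.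
have E0 n : 0 <= E n by rewrite mulr_ge0 ?exprn_ge0// divr_ge0// ltW.
have lo n k : y n - E n <= y (n + k)%N - E (n + k)%N.
  elim: k => [|k IHk]; first by rewrite addn0.
  rewrite addnS (le_trans IHk)//; have := H (n + k)%N; rewrite -ES ler_norml.
  by move=> /andP[+ _]; lra.
have up n k : y (n + k)%N + E (n + k)%N <= y n + E n.
  elim: k => [|k IHk]; first by rewrite addn0.
  rewrite addnS (le_trans _ IHk)//; have := H (n + k)%N; rewrite -ES ler_norml.
  by move=> /andP[_]; lra.
have lu n k : y n - E n <= y k + E k.
  have h1 := lo n k; have h2 := up k n; rewrite addnC in h2.
  by have := E0 (n + k)%N; lra.
pose S := [set y n - E n | n in [set: nat]].
have ubS k : ubound S (y k + E k) by move=> _ [n _ <-].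
exists (sup S) => n; rewrite ler_norml.
have h1 : sup S <= y n + E n by apply: ge_sup => //; exists (y 0%N - E 0%N), 0%N.
have h2 : y n - E n <= sup S.
  by apply: ub_le_sup; [exists (y n + E n)|exists n].
by rewrite -/(E n); apply/andP; split; lra.
Qed.

Lemma within_norm_le_closure a b h B : a < b -> {within `[a, b], continuous h} ->
  (forall t, a < t <= b -> `|h t| <= B) -> forall t, a <= t <= b -> `|h t| <= B.
Proof.
move=> ab /continuous_itv_distP ch H t /andP[]; rewrite le_eqVlt => /predU1P[<- _|ta tb].
  apply/ler_addgt0Pr => e e0.
  have [|del del0 D] := ch a _ e e0; first by rewrite lexx ltW.
  pose s := Num.min (a + del / 2) b.
  have as_ : a < s by rewrite lt_min ab ltrDl divr_gt0.
  have sb : s <= b by rewrite ge_min lexx orbT.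
  have sd : s <= a + del / 2 by rewrite ge_min lexx.
  have := D s; rewrite (ltW as_) sb => /(_ isT) hs.
  have {}hs : `|h a - h s| < e.
    apply: hs; rewrite distrC ger0_norm ?subr_ge0 ?(ltW as_)// ltrBlDl.
    by rewrite (le_lt_trans sd)// ltrD2l ltr_pdivrMr// ltr_pMr// ltr1n.
  have -> : h a = h s + (h a - h s) by rewrite addrC subrK.
  rewrite (le_trans (ler_normD _ _))// lerD ?(ltW hs)//.
  by apply: H; rewrite as_.
by apply: H; rewrite ta.
Qed.

(** The continuous extensions to [[a, T]] are made to converge, since the functions themselves carry
    no information at [a]; a uniform limit of continuous functions is continuous. *)
Lemma Cw_uniform_limit g a T (x : nat -> R -> R) C r : 0 <= a -> a < T ->
  0 <= C -> 0 <= r < 1 -> (forall n, Cw g a T (x n)) ->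
  (forall n t, a < t <= T -> `|t `^ (1 - g) * (x n.+1 t - x n t)| <= C * r ^+ n) ->
  exists u, Cw g a T u /\
    forall n t, a < t <= T -> `|t `^ (1 - g) * (x n t - u t)| <= C / (1 - r) * r ^+ n.
Proof.
move=> a0 aT C0 r01 cx H.
have /choice[h hP] n : exists h : R -> R, {within `[a, T], continuous h} /\
    forall t, a < t <= T -> t `^ (1 - g) * x n t = h t.
  have [h ch hx] := cx n; exists h; split => // t tT; apply: hx; by rewrite in_itv.
have hS n t : a <= t <= T -> `|h n.+1 t - h n t| <= C * r ^+ n.
  apply: (@within_norm_le_closure a T (fun t => h n.+1 t - h n t)) => //.
    by move=> s; apply: cvgB; [exact: (hP n.+1).1|exact: (hP n).1].
  by move=> s sT; rewrite -!(hP _).2// -mulrBr; exact: H.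
have /choice[l lP] t : exists l, a <= t <= T ->
    forall n, `|h n t - l| <= C / (1 - r) * r ^+ n.
  have [tT|_] := boolP (a <= t <= T); last by exists 0.
  have [l hl] := @geometric_limit (fun n => h n t) C r C0 r01 (fun n => hS n t tT).
  by exists l.
have cl : {within `[a, T], continuous l}.
  apply/continuous_itv_distP => s sT e e0.
  have e30 : 0 < e / 3 by rewrite divr_gt0.
  have [n hn] := geometric_small (C / (1 - r)) r01 e30.
  have /continuous_itv_distP/(_ s sT _ e30)[del del0 D] := (hP n).1.
  exists del => // t tT st.
  have := lP s sT n; have := lP t tT n; have := D t tT st.
  have -> : l s - l t = (h n s - h n t) + (h n t - l t) - (h n s - l s) by ring.
  move=> h1 h2 h3.
  rewrite (le_lt_trans (ler_normB _ _))// (le_lt_trans (lerD (ler_normD _ _) (lexx _)))//.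
  move: (le_lt_trans h2 hn) (le_lt_trans h3 hn) h1; lra.
have wK t : a < t -> t `^ (1 - g) * (t `^ (g - 1) * l t) = l t.
  move=> at_; have t0 := le_lt_trans a0 at_.
  rewrite mulrA -powRD ?(gt_eqF t0) ?implybT//.
  by rewrite (_ : 1 - g + (g - 1) = 0) ?powRr0 ?mul1r//; ring.
exists (fun t => t `^ (g - 1) * l t); split.
  exists l => // t; rewrite in_itv/= => /andP[at_ _]; exact: wK.
move=> n t tT; have /andP[at_ tT'] := tT.
by rewrite mulrBr wK// (hP n).2//; apply: lP; rewrite ltW.
Qed.

End uniform_limits.

Section weighted_comparison.
Context {R : realType} {d : nat}.
Implicit Types (v w N : 'cV[R]_d) (M K : 'M[R]_d).

Lemma lev_mulmx M v w : (forall i j, 0 <= M i j) -> lev v w -> lev (M *m v) (M *m w).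
Proof.
by move=> M0 vw i; rewrite !mxE; apply: ler_sum => j _; rewrite ler_wpM2l.
Qed.

(** At an index maximizing [N i / w i], with maximum [B], the hypothesis reads [B <= E + B * r]. *)
Lemma weighted_comparison M N w (E r : R) : (forall i j, 0 <= M i j) ->
  (forall i, 0 < w i 0) -> 0 <= r < 1 -> (forall i, (M *m w) i 0 <= r * w i 0) ->
  0 <= E -> (forall i, N i 0 <= E * w i 0 + (M *m N) i 0) ->
  forall i, N i 0 <= E / (1 - r) * w i 0.
Proof.
move=> M0 w0 /andP[r0 r1] Mw E0 HN i0.
pose i := [arg max_(i > i0) (N i 0 / w i 0)]%O.
pose B := N i 0 / w i 0.
have NB j : N j 0 <= B * w j 0.
  rewrite -ler_pdivrMr// /B /i; case: arg_maxP => // k _ Hk; exact: Hk.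
have r10 : 0 < 1 - r by rewrite subr_gt0.
have NB' : N i 0 = B * w i 0 by rewrite /B divfK// gt_eqF.
suff BE : B <= E / (1 - r).
  by apply: (le_trans (NB i0)); rewrite ler_wpM2r// ltW.
have [B0|B0] := leP B 0; first by rewrite (le_trans B0)// divr_ge0// ltW.
have MN : (M *m N) i 0 <= B * (r * w i 0).
  apply: (@le_trans _ _ ((M *m (B *: w)) i 0)).
    by apply: lev_mulmx => // j; rewrite mxE.
  by rewrite -scalemxAr mxE ler_wpM2l// ltW.
have := HN i; rewrite {1}NB' => h.
have : B * w i 0 <= (E + B * r) * w i 0.
  by apply: (le_trans h); rewrite mulrDl lerD2l -mulrA.
by rewrite ler_pM2r// ler_pdivlMr// => ?; lra.
Qed.

End weighted_comparison.

Lemma entryB (R : realType) (d : nat) (u v : R -> 'cV[R]_d) i t :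
  entry (u \- v) i t = entry u i t - entry v i t.
Proof. by rewrite /entry !mxE. Qed.

(** * Picard iteration for an abstract operator of norm [c] *)

Section picard_iteration.
Context {R : realType} {d : nat}.
Variables (g a T c r : R) (op : (R -> R) -> R -> R) (xt m w : 'cV[R]_d).
Variables (D : set 'cV[R]_d) (f : R -> 'cV[R]_d -> 'cV[R]_d) (K : 'M[R]_d).
Implicit Types (u v : R -> 'cV[R]_d) (t B L : R) (N : 'cV[R]_d) (n : nat) (i : 'I_d).
Local Notation x0 := (init_sol g xt).

Hypotheses (a0 : 0 <= a) (aT : a < T).
Hypothesis opC : forall y, Cw g a T y -> Cw g a T (op y).
Hypothesis opB : forall y B, Cw g a T y -> 0 <= B ->
  (forall t, a < t <= T -> `|t `^ (1 - g) * y t| <= B) ->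
  forall t, a < t <= T -> `|t `^ (1 - g) * op y t| <= c * B.
Hypothesis opD : forall y y' B, Cw g a T y -> Cw g a T y' -> 0 <= B ->
  (forall t, a < t <= T -> `|t `^ (1 - g) * (y t - y' t)| <= B) ->
  forall t, a < t <= T -> `|t `^ (1 - g) * (op y t - op y' t)| <= c * B.
Hypothesis c0 : 0 <= c.
Hypothesis m0 : lev 0 m.
Hypothesis K0 : forall i j, 0 <= K i j.
Hypothesis ball : ball_in_XD g a T D xt (c *: m).
Hypothesis bnd : bounded_on_XD g a T D f m.
Hypothesis lip : lipschitz_on_XD g a T D f K.
Hypothesis w0 : forall i, 0 < w i 0.
Hypothesis r01 : 0 <= r < 1.
Hypothesis Kw : forall i, ((c *: K) *m w) i 0 <= r * w i 0.

Definition picard_step u : R -> 'cV[R]_d := x0 \+ lift_op op (superpos f u).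

Lemma picard_stepE u i t :
  entry (picard_step u) i t = entry x0 i t + op (entry (superpos f u) i) t.
Proof. by rewrite /entry /picard_step /lift_op !mxE. Qed.

Lemma weighted_init i t : 0 < t -> t `^ (1 - g) * entry x0 i t = xt i 0 / Gamma g.
Proof.
move=> t0; rewrite /entry /init_sol mxE !mulrA -powRD ?(gt_eqF t0) ?implybT//.
by rewrite (_ : 1 - g + (g - 1) = 0) ?powRr0 ?mul1r 1?mulrC//; ring.
Qed.

Lemma Cwv_init : Cwv g a T x0.
Proof.
move=> i; exists (fun=> xt i 0 / Gamma g); first by move=> t; exact: cst_continuous.
by move=> t; rewrite in_itv/= => /andP[at_ _]; apply: weighted_init; exact: le_lt_trans at_.
Qed.

Lemma XD_of_bound u : Cwv g a T u ->
  (forall i t, a < t <= T -> `|t `^ (1 - g) * (entry u i t - entry x0 i t)| <= c * m i 0) ->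
  XD g a T D u.
Proof.
move=> cu H; apply: ball => // i; rewrite !mxE; apply: normw_le => // t tT.
by have := H i t tT; rewrite /entry !mxE.
Qed.

Lemma superpos_bound u i t : XD g a T D u -> a < t <= T ->
  `|t `^ (1 - g) * entry (superpos f u) i t| <= m i 0.
Proof.
move=> /bnd[cF nF] tT; apply: (le_trans (le_normw aT (cF i) tT)).
by have := nF i; rewrite mxE.
Qed.

Lemma picard_step_bound u : XD g a T D u -> forall i t, a < t <= T ->
  `|t `^ (1 - g) * (entry (picard_step u) i t - entry x0 i t)| <= c * m i 0.
Proof.
move=> Du i t tT; rewrite picard_stepE addrAC subrr add0r.
apply: opB => //; [exact: (bnd Du).1|by have := m0 i; rewrite mxE|].
by move=> s sT; exact: superpos_bound.
Qed.

Lemma Cwv_picard_step u : Cwv g a T (superpos f u) -> Cwv g a T (picard_step u).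
Proof.
move=> cF i; apply: (eq_Cw (u := entry x0 i \+ op (entry (superpos f u) i))).
  by move=> t _; rewrite picard_stepE.
by apply: CwD; [exact: Cwv_init|apply: opC; exact: cF].
Qed.

Lemma XD_picard_step u : XD g a T D u -> XD g a T D (picard_step u).
Proof.
move=> Du; apply: XD_of_bound; last exact: picard_step_bound.
by apply: Cwv_picard_step; exact: (bnd Du).1.
Qed.

Lemma XD_init : XD g a T D x0.
Proof.
apply: XD_of_bound; first exact: Cwv_init.
by move=> i t _; rewrite subrr mulr0 normr0 mulr_ge0//; have := m0 i; rewrite mxE.
Qed.

Lemma superpos_lip u v N B : XD g a T D u -> XD g a T D v ->
  (forall j t, a < t <= T -> `|t `^ (1 - g) * (entry u j t - entry v j t)| <= B * N j 0) ->
  forall i t, a < t <= T ->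
  `|t `^ (1 - g) * (entry (superpos f u) i t - entry (superpos f v) i t)| <= B * (K *m N) i 0.
Proof.
move=> Du Dv H i t tT; have := lip Du Dv (t := t); rewrite in_itv/= => /(_ tT i).
rewrite !mxE => h; rewrite normrM ger0_norm ?powR_ge0//.
apply: (le_trans (ler_wpM2l (powR_ge0 _ _) h)); rewrite !mulr_sumr; apply: ler_sum => j _.
rewrite mulrCA [leRHS]mulrCA ler_wpM2l//; have := H j t tT.
by rewrite normrM ger0_norm ?powR_ge0// /entry !mxE.
Qed.

Lemma picard_step_contraction u v B : 0 <= B -> XD g a T D u -> XD g a T D v ->
  (forall j t, a < t <= T -> `|t `^ (1 - g) * (entry u j t - entry v j t)| <= B * w j 0) ->
  forall i t, a < t <= T ->
  `|t `^ (1 - g) * (entry (picard_step u) i t - entry (picard_step v) i t)| <= B * r * w i 0.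
Proof.
move=> B0 Du Dv H i t tT; rewrite !picard_stepE opprD addrACA subrr add0r.
have Kw0 : 0 <= (K *m w) i 0.
  by rewrite mxE; apply: sumr_ge0 => j _; rewrite mulr_ge0// ltW.
apply: (@le_trans _ _ (c * (B * (K *m w) i 0))).
  apply: opD => //; [exact: (bnd Du).1|exact: (bnd Dv).1|exact: mulr_ge0|].
  by move=> s sT; exact: superpos_lip.
rewrite mulrCA -mulrA ler_wpM2l//.
by have := Kw i; rewrite -scalemxAl mxE.
Qed.

Lemma picardS n : picard op f x0 n.+1 = picard_step (picard op f x0 n).
Proof. by []. Qed.

Lemma XD_picard n : XD g a T D (picard op f x0 n).
Proof. by elim: n => [|n IHn]; [exact: XD_init|rewrite picardS; exact: XD_picard_step]. Qed.

(** The limit [v] is determined on []a, T]] only. Its image [u] agrees with it there and takes at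
    [a] the value prescribed by the operator. *)
Lemma picard_limit : exists u v, [/\ XD g a T D u, XD g a T D v,
  forall t, a < t <= T -> u t = v t, u = picard_step v &
  cvgwv g a T (picard op f x0) u].
Proof.
have /andP[r0 r1] := r01; have r10 : 0 < 1 - r by rewrite subr_gt0.
pose x n := picard op f x0 n.
have mi i : 0 <= m i 0 by have := m0 i; rewrite mxE.
(* Bounds the first increment in the weighted norm; a sum replaces the maximum over components. *)
pose L := \sum_i c * m i 0 / w i 0.
have Li i : c * m i 0 <= L * w i 0.
  rewrite -ler_pdivrMr// /L (bigD1 i)//= lerDl; apply: sumr_ge0 => j _.
  by rewrite divr_ge0 ?(ltW (w0 _))// mulr_ge0.
have L0 : 0 <= L by apply: sumr_ge0 => j _; rewrite divr_ge0 ?(ltW (w0 _))// mulr_ge0.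
have step n i t : a < t <= T ->
    `|t `^ (1 - g) * (entry (x n.+1) i t - entry (x n) i t)| <= L * r ^+ n * w i 0.
  elim: n i t => [|n IHn] i t tT.
    rewrite expr0 mulr1; apply: le_trans (Li i).
    by apply: picard_step_bound => //; exact: XD_init.
  rewrite exprSr mulrA; apply: picard_step_contraction => //.
  - by rewrite mulr_ge0// exprn_ge0.
  - exact: (XD_picard n.+1).
  - exact: XD_picard.
have cx n i : Cw g a T (entry (x n) i) by exact: (XD_picard n).1.
have /choice[l lP] i : exists l, Cw g a T l /\ forall n t, a < t <= T ->
    `|t `^ (1 - g) * (entry (x n) i t - l t)| <= L * w i 0 / (1 - r) * r ^+ n.
  apply: Cw_uniform_limit => //; first by rewrite mulr_ge0// ltW.
  by move=> n t tT; rewrite mulrAC; exact: step.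
pose v t : 'cV[R]_d := \col_i l i t.
have vE i t : entry v i t = l i t by rewrite /entry mxE.
have cv : Cwv g a T v.
  by move=> i; apply: (eq_Cw (u := l i)); [move=> t _; rewrite vE|exact: (lP i).1].
have xv n i t : a < t <= T -> `|t `^ (1 - g) * (entry (x n) i t - entry v i t)| <=
    L / (1 - r) * r ^+ n * w i 0.
  move=> tT; rewrite vE (le_trans ((lP i).2 n t tT))// le_eqVlt; apply/orP; left.
  by apply/eqP; ring.
have E0 : 0 <= L / (1 - r) by rewrite divr_ge0// ltW.
have wS i k n : (n <= k)%N -> L / (1 - r) * r ^+ k * w i 0 <= L / (1 - r) * w i 0 * r ^+ n.
  move=> nk; rewrite mulrAC; apply: ler_wpM2l; first by rewrite mulr_ge0// ltW.
  by apply: ler_wiXn2l => //; exact: ltW.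
(* All iterates lie in the ball of radius [c * m] around the initial function; this bound passes to
   the limit, and the ball lies in [XD]. *)
have Dv : XD g a T D v.
  apply: XD_of_bound => // i t tT; apply/ler_addgt0Pr => e e0.
  have [n hn] := geometric_small (L / (1 - r) * w i 0) r01 e0.
  have b1 : `|t `^ (1 - g) * (entry (x n.+1) i t - entry x0 i t)| <= c * m i 0.
    by apply: picard_step_bound => //; exact: XD_picard.
  have b2 := xv n.+1 i t tT.
  have b3 : L / (1 - r) * r ^+ n.+1 * w i 0 <= e.
    by apply: ltW; apply: le_lt_trans hn; exact: wS.
  have -> : t `^ (1 - g) * (entry v i t - entry x0 i t) =
    t `^ (1 - g) * (entry (x n.+1) i t - entry x0 i t)
    - t `^ (1 - g) * (entry (x n.+1) i t - entry v i t) by ring.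
  by rewrite (le_trans (ler_normB _ _))// lerD// (le_trans b2).
pose u := picard_step v.
have Du : XD g a T D u by exact: XD_picard_step.
have uv t : a < t <= T -> u t = v t.
  move=> tT; have t0 : 0 < t by case/andP: tT => /(le_lt_trans a0).
  apply/matrixP => i j; rewrite ord1 {j}.
  suff : `|t `^ (1 - g) * (entry u i t - entry v i t)| <= 0.
    rewrite normr_le0 mulf_eq0 gt_eqF ?powR_gt0//= subr_eq0 => /eqP; exact.
  apply/ler_addgt0Pr => e e0; rewrite add0r.
  have e20 : 0 < e / 2 by rewrite divr_gt0.
  have [n hn] := geometric_small (L / (1 - r) * w i 0) r01 e20.
  have hn' : L / (1 - r) * r ^+ n.+1 * w i 0 < e / 2.
    by apply: le_lt_trans hn; exact: wS.
  have b1 : `|t `^ (1 - g) * (entry (x n.+1) i t - entry u i t)| <=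
      L / (1 - r) * r ^+ n * r * w i 0.
    apply: picard_step_contraction => //.
    - by rewrite mulr_ge0// exprn_ge0.
    - exact: XD_picard.
    - by move=> j s sT; exact: xv.
  rewrite -mulrA -mulrA (mulrA (r ^+ n)) -exprSr mulrA in b1.
  have b2 := xv n.+1 i t tT.
  have -> : t `^ (1 - g) * (entry u i t - entry v i t) =
    t `^ (1 - g) * (entry (x n.+1) i t - entry v i t)
    - t `^ (1 - g) * (entry (x n.+1) i t - entry u i t) by ring.
  by rewrite (le_trans (ler_normB _ _))//; lra.
exists u, v; split => //; split.
- by move=> n; exact: (XD_picard n).1.
- exact: Du.1.
- move=> i; apply/cvgrPdist_le => e e0.
  have [N hN] := geometric_small (L / (1 - r) * w i 0) r01 e0.
  exists N => // n /= Nn; rewrite sub0r normrN mxE ger0_norm ?normw_ge0//.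
  apply: normw_le => // t tT.
  rewrite entryB (_ : entry u i t = entry v i t); last by rewrite /entry uv.
  apply: (le_trans (xv n i t tT)); apply: le_trans (ltW hN).
  exact: wS.
Qed.

(** Inserting the step from [u'] splits the difference into the defect of [u], at most [L * w], and
    a Lipschitz term [c K N], with [N] the vector of norms; [weighted_comparison] then absorbs the
    latter. Only [op], which fixes [v], has to contract, and [u] may come from any other
    operator. *)
Lemma fixed_point_perturbation u u' v v' L : 0 <= L ->
  XD g a T D u' -> XD g a T D v' ->
  (forall t, a < t <= T -> u t = u' t) -> (forall t, a < t <= T -> v t = v' t) ->
  (forall i t, a < t <= T ->
    `|t `^ (1 - g) * (entry u i t - entry (picard_step u') i t)| <= L * w i 0) ->
  (forall t, a < t <= T -> v t = picard_step v' t) ->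
  forall i, normwv g a T (u \- v) i 0 <= L / (1 - r) * w i 0.
Proof.
move=> L0 Du Dv uu' vv' Hu Hv; set N := normwv _ _ _ _.
have cuv j : Cw g a T (entry (u \- v) j).
  apply: (eq_Cw (u := entry u' j \- entry v' j)); last by apply: CwB; [exact: Du.1|exact: Dv.1].
  by move=> t tT; rewrite entryB /entry /= uu'// vv'.
have uvN j t : a < t <= T -> `|t `^ (1 - g) * (entry u j t - entry v j t)| <= N j 0.
  by move=> tT; rewrite -entryB mxE; exact: le_normw.
have N0 j : 0 <= N j 0 by rewrite mxE normw_ge0.
apply: (@weighted_comparison _ _ (c *: K)) => //.
  by move=> i j; rewrite mxE mulr_ge0.
move=> i; rewrite [leLHS]mxE; apply: normw_le => // t tT.
have -> : entry (u \- v) i t = (entry u i t - entry (picard_step u') i t) +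
    (entry (picard_step u') i t - entry (picard_step v') i t).
  by rewrite entryB addrA subrK /entry Hv.
rewrite mulrDr (le_trans (ler_normD _ _))// lerD//; first exact: Hu.
rewrite !picard_stepE opprD addrACA subrr add0r -scalemxAl mxE.
apply: opD => //; [exact: (bnd Du).1|exact: (bnd Dv).1| |].
  by rewrite mxE; apply: sumr_ge0 => j _; rewrite mulr_ge0.
move=> s sT; rewrite -[leRHS]mul1r; apply: superpos_lip => // j x xT.
by rewrite mul1r /entry -uu'// -vv'//; exact: uvN.
Qed.

End picard_iteration.

(** * The spline operator on weighted spaces *)

Section spline_operator.
Context {R : realType}.
Variables (eps T a g z : R) (A : knots eps T) (q : nat).
Hypotheses (e0 : 0 < eps) (eT : eps < T) (a01 : 0 < a < 1) (ag : a <= g) (g1 : g <= 1)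
  (zE : z = 1 - g + a) (q0 : (0 < q)%N).
Implicit Types (s t M : R) (f y : R -> R).

Let T0 : 0 < T. Proof. exact: lt_trans eT. Qed.
Let e0' : 0 <= eps. Proof. exact: ltW. Qed.

Local Notation wTop y := (fun s => s `^ (1 - g) * Top T a z eps y s).
Local Notation TopS := (Top_spline a g z q A).

Lemma weighted_Top_spline y t : 0 < t ->
  t `^ (1 - g) * TopS y t = spline A q (wTop y) t.
Proof.
move=> t0; rewrite /Top_spline mulrA -powRD ?(gt_eqF t0) ?implybT//.
by rewrite (_ : 1 - g + (g - 1) = 0) ?powRr0 ?mul1r//; ring.
Qed.

Lemma continuous_weighted_Top_spline y :
  {within `[eps, T], continuous (fun t => t `^ (1 - g) * TopS y t)}.
Proof.
have /continuous_itv_distP H := @spline_continuous R eps T A q (wTop y) q0.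
apply/continuous_itv_distP => s sT e ep; have [del del0 D] := H s sT e ep.
exists del => // t tT st; rewrite !weighted_Top_spline; first exact: D.
- by case/andP: tT => /(lt_le_trans e0).
- by case/andP: sT => /(lt_le_trans e0).
Qed.

Lemma Cw_Top_spline y : Cw g eps T (TopS y).
Proof. by apply: Cw_of_continuous; exact: continuous_weighted_Top_spline. Qed.

Lemma within_continuous_powRM f : {within `[eps, T], continuous f} -> forall p,
  {within `[eps, T], continuous (fun t => t `^ p * f t)}.
Proof.
move=> /subspace_continuousP cf p; apply/subspace_continuousP => s /= sT.
apply: cvgM; last exact: cf.
apply: cvg_within_filter; apply: cvg_powR.
by move: sT; rewrite in_itv/= => /andP[/(lt_le_trans e0)].
Qed.

Lemma Top_spline_continuous y : {within `[eps, T], continuous (TopS y)}.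
Proof. by apply: within_continuous_powRM; exact: spline_continuous. Qed.

Lemma Top_spline_error y M t : Cw g eps T y -> 0 <= M ->
  (forall t, eps < t <= T -> `|t `^ (1 - g) * y t| <= M) -> eps < t <= T ->
  `|t `^ (1 - g) * (TopS y t - Top T a z eps y t)| <= Omega_knots A a g z q * M.
Proof.
move=> cy M0 hM /andP[et tT]; rewrite mulrBr weighted_Top_spline; last exact: lt_trans et.
apply: (spline_Omega_error A e0 eT a01 g1 zE (f := wTop y)) => //.
- exact: Cw_Top_continuous.
- by move=> s s' es ss' s'T; exact: (Top_Omega T0 a01 ag g1 zE e0' eT).
- by rewrite (ltW et).
Qed.

Lemma eq_spline f f' t : (forall s, eps <= s <= T -> f s = f' s) ->
  spline A q f t = spline A q f' t.
Proof.
move=> ff'; apply: eq_bigr => i _; congr (_ * _).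
apply: eq_bigr => j _; congr (_ * _ * _ * _); apply: ff'.
have ik : (i <= nknot A)%N by rewrite -ltnS.
have jq : (j <= q)%N by rewrite -ltnS.
have /andP[h1 _] := @knot_in R eps T A _ (leqW ik); have /andP[_ h2] := @knot_in R eps T A i.+1 ik.
have h3 := @cell_size_gt0 R eps T A _ ik; rewrite /cell_size in h3.
have q0' : 0 < q%:R :> R by rewrite ltr0n.
apply/andP; split.
  by rewrite (le_trans h1)// lerDl divr_ge0 ?mulr_ge0// ltW.
rewrite (le_trans _ h2)// -lerBrDl ler_pdivrMr// mulrC ler_wpM2l ?ler_nat//.
exact: ltW.
Qed.

Lemma bernsteinB p s s' f f' t : bernstein p s s' (fun s => f s - f' s) t =
  bernstein p s s' f t - bernstein p s s' f' t.
Proof.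
by rewrite /bernstein -sumrB; apply: eq_bigr => j _; rewrite !mulrBl.
Qed.

Lemma splineB f f' t :
  spline A q (fun s => f s - f' s) t = spline A q f t - spline A q f' t.
Proof. by rewrite /spline -sumrB; apply: eq_bigr => j _; rewrite bernsteinB mulrBr. Qed.

Lemma Top_splineB y y' t : Cw g eps T y -> Cw g eps T y' -> eps <= t <= T ->
  TopS (y \- y') t = TopS y t - TopS y' t.
Proof.
move=> cy cy' tT; rewrite /Top_spline -mulrBr -splineB; congr (_ * _).
apply: eq_spline => // s sT.
by rewrite (TopB T0 a01 ag g1 zE e0' eT cy cy') ?mulrBr.
Qed.

(** The triangle inequality around T^eps: [Xi] bounds the operator and Omega its spline error,
    whence the constant [Xi + Omega]. *)
Lemma Top_spline_bound y M : Cw g eps T y -> 0 <= M ->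
  (forall t, eps < t <= T -> `|t `^ (1 - g) * y t| <= M) -> forall t, eps < t <= T ->
  `|t `^ (1 - g) * TopS y t| <= (Xi T a g z + Omega_knots A a g z q) * M.
Proof.
move=> cy M0 hM t tT.
have -> : t `^ (1 - g) * TopS y t = t `^ (1 - g) * Top T a z eps y t +
  t `^ (1 - g) * (TopS y t - Top T a z eps y t) by ring.
rewrite mulrDl (le_trans (ler_normD _ _))// lerD//.
  exact: (Top_bound T0 a01 ag g1 zE e0' eT).
exact: Top_spline_error.
Qed.

Lemma Top_spline_diff_bound y y' M : Cw g eps T y -> Cw g eps T y' -> 0 <= M ->
  (forall t, eps < t <= T -> `|t `^ (1 - g) * (y t - y' t)| <= M) ->
  forall t, eps < t <= T -> `|t `^ (1 - g) * (TopS y t - TopS y' t)| <=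
    (Xi T a g z + Omega_knots A a g z q) * M.
Proof.
move=> cy cy' M0 hM t /andP[et tT]; rewrite -Top_splineB ?(ltW et)//.
by apply: Top_spline_bound; rewrite ?et//; exact: CwB.
Qed.

End spline_operator.

(** * Passing from []0, T]] to []e, T]] *)

Section extension.
Context {R : realType} {d : nat}.
Variables (g T e : R).
Hypotheses (e0 : 0 < e) (eT : e < T).
Implicit Types (u v : R -> 'cV[R]_d) (P D : set 'cV[R]_d) (s t B : R) (i : 'I_d).

Lemma continuous_max (h : R -> R) : {within `[e, T], continuous h} ->
  {within `[0, T], continuous (fun t => h (Num.max t e))}.
Proof.
move=> /continuous_itv_distP ch; apply/continuous_itv_distP => s sT x x0.
have mT t : 0 <= t <= T -> e <= Num.max t e <= T.
  by move=> /andP[_ tT]; rewrite le_max lexx orbT/= ge_max tT ltW.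
have [del del0 D] := ch (Num.max s e) (mT s sT) x x0.
exists del => // t tT st; apply: D; first exact: mT.
apply: le_lt_trans st; have := ler_norm (s - t); have := ler_norm (t - s).
rewrite (distrC t s) => h1 h2; rewrite ler_norml.
by case: (leP s e) => ?; case: (leP t e) => ?; apply/andP; split; lra.
Qed.

Lemma closed_right_limit P (H : R -> 'cV[R]_d) : closed P ->
  (forall i, {within `[e, T], continuous (entry H i)}) ->
  (forall t, e < t <= T -> P (H t)) -> P (H e).
Proof.
move=> cP cH HP.
apply: (@closed_cvg _ _ (e^'+) _ H P cP); last first.
  apply/cvg_ballP => x x0.
  suff : \forall t \near e^'+, forall i, `|H e i 0 - H t i 0| < x.
    by apply: filterS => t h; split=> // i j; rewrite ord1; exact: h.
  apply: filter_forall => i.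
  have eT' : e <= e <= T by rewrite lexx ltW.
  have /continuous_itv_distP/(_ e eT' x x0)[del del0 D] := cH i.
  have d'0 : 0 < Num.min del (T - e) by rewrite lt_min del0 subr_gt0.
  near=> t; apply: D.
    by apply/andP; split; near: t; [exact: nbhs_right_ge|exact: nbhs_right_le].
  rewrite distrC ger0_norm; last by rewrite subr_ge0; near: t; exact: nbhs_right_ge.
  by rewrite ltrBlDl; near: t; apply: nbhs_right_lt; rewrite ltrDl.
near=> t; apply: HP; apply/andP; split; near: t; first exact: nbhs_right_gt.
exact: nbhs_right_le.
Unshelve. all: by end_near. Qed.

(* A general closed [P] serves both for [D] and for balls. *)
Lemma Cwv_extend u : Cwv g e T u -> exists U, [/\ Cwv g 0 T U,
  forall t, e < t <= T -> U t = u t & forall P, closed P ->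
    (forall t, e < t <= T -> P (t `^ (1 - g) *: u t)) ->
    forall t, 0 < t <= T -> P (t `^ (1 - g) *: U t)].
Proof.
move=> cu.
have /choice[h hP] i : exists h, {within `[e, T], continuous h} /\
    forall t, t \in `]e, T] -> t `^ (1 - g) * entry u i t = h t.
  by have [h ch hE] := cu i; exists h.
pose H t : 'cV[R]_d := \col_i h i t.
pose U t := if e < t then u t else t `^ (g - 1) *: H e.
have WU t : 0 < t <= T -> t `^ (1 - g) *: U t = H (Num.max t e).
  move=> /andP[t0 tT]; rewrite /U; case: ltP => [et|te].
    by apply/matrixP => i j; rewrite ord1 !mxE -(hP i).2// in_itv/= et.
  rewrite scalerA -powRD ?(gt_eqF t0) ?implybT//.
  by rewrite (_ : 1 - g + (g - 1) = 0) ?powRr0 ?scale1r//; ring.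
exists U; split.
- move=> i; exists (fun t => h i (Num.max t e)).
    by apply: continuous_max; exact: (hP i).1.
  move=> t; rewrite in_itv/= => /WU/matrixP/(_ i 0).
  by rewrite /entry !mxE.
- by move=> t /andP[et _]; rewrite /U et.
- move=> P cP HP.
  have HP' t : e < t <= T -> P (H t).
    move=> /andP[et tT]; have := WU t; rewrite tT (lt_trans e0 et) => /(_ isT).
    by rewrite /U et max_l ?(ltW et)// => <-; apply: HP; rewrite et.
  move=> t tT; rewrite WU//; case: (leP t e) => [te|et]; last first.
    by apply: HP'; rewrite et; case/andP: tT.
  apply: closed_right_limit => // i; rewrite (_ : entry H i = h i); first exact: (hP i).1.
  by apply/funext => s; rewrite /entry mxE.
Qed.

Lemma Cwv_restrict u : Cwv g 0 T u -> Cwv g e T u.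
Proof. by move=> cu i; apply: Cw_restrict (cu i) => //; exact: ltW. Qed.

Lemma XD_extend D u : closed D -> XD g e T D u ->
  exists2 U, XD g 0 T D U & forall t, e < t <= T -> U t = u t.
Proof.
move=> cD [cu Du]; have [U [cU Uu HU]] := Cwv_extend cu.
exists U => //; split => // t; rewrite in_itv/=; exact: HU.
Qed.

Lemma closed_entry_ball i (c B : R) : closed [set x : 'cV[R]_d | `|x i 0 - c| <= B].
Proof.
rewrite (_ : [set _ | _] = (fun x : 'cV[R]_d => x i 0) @^-1` [set y | `|y - c| <= B])//.
apply: preimage_closed; first by move=> x _; exact: coord_continuous.
rewrite (_ : [set _ | _] = closed_ball_ (fun x => `|x|) c B); last first.
  by apply/seteqP; split => y /=; rewrite distrC.
exact: closed_closed_ball_.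
Qed.

(** The initial function has constant weighted value, so extending [u] with constant weight adds to
    the weighted difference only its limit at [e]; the closed entry balls keep this limit within the
    radius. *)
Lemma ball_in_XD_restrict D xt r : closed D ->
  ball_in_XD g 0 T D xt r -> ball_in_XD g e T D xt r.
Proof.
move=> cD ball u cu nu; have [U [cU Uu HU]] := Cwv_extend cu.
have T0 : 0 < T := lt_trans e0 eT.
have [_ DU] : XD g 0 T D U.
  apply: ball => // i; rewrite !mxE; apply: normw_le => // t tT.
  have tT' := tT; case/andP: tT => t0 _.
  rewrite entryB mulrBr weighted_init//.
  have := HU _ (@closed_entry_ball i (xt i 0 / Gamma g) (r i 0)).
  move=> /(_ _ t tT')/=; rewrite mxE; apply => s sT /=.
  have s0 : 0 < s by case/andP: sT => /(lt_trans e0).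
  rewrite mxE -(weighted_init g xt i s0) -/(entry u i s) -mulrBr -entryB.
  apply: (@le_trans _ _ (normwv g e T (u \- init_sol g xt) i 0)); last exact: nu.
  rewrite mxE; apply: le_normw => //.
  apply: (eq_Cw (u := entry u i \- entry (init_sol g xt) i)).
    by move=> x _; rewrite entryB.
  by apply: CwB => //; apply: Cwv_init; exact: ltW.
split => // t; rewrite in_itv/= => /andP[et tT].
rewrite -Uu ?et//; apply: DU; by rewrite in_itv/= tT (lt_trans e0).
Qed.

Lemma bounded_on_XD_restrict D f (m : 'cV[R]_d) : closed D ->
  bounded_on_XD g 0 T D f m -> bounded_on_XD g e T D f m.
Proof.
move=> cD bnd u /(XD_extend cD)[U /bnd[cF nF] Uu].
have FE i t : e < t <= T -> entry (superpos f U) i t = entry (superpos f u) i t.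
  by move=> tT; rewrite /entry /superpos Uu.
have T0 : 0 < T := lt_trans e0 eT.
split=> i; first by apply: eq_Cw (FE i) _; exact: Cwv_restrict.
rewrite mxE; apply: normw_le => // t tT; rewrite -FE//.
apply: le_trans (nF i); rewrite mxE; apply: le_normw => //.
by case/andP: tT => et ->; rewrite (lt_trans e0).
Qed.

Lemma lipschitz_on_XD_restrict D f (K : 'M[R]_d) : closed D ->
  lipschitz_on_XD g 0 T D f K -> lipschitz_on_XD g e T D f K.
Proof.
move=> cD lip u v /(XD_extend cD)[U DU Uu] /(XD_extend cD)[V DV Vv] t.
rewrite in_itv/= => tT; rewrite -Uu// -Vv//; apply: lip => //.
by rewrite in_itv/=; case/andP: tT => et ->; rewrite (lt_trans e0).
Qed.

End extension.

(** * Limits of the iterations and their distances *)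

Section perturbed_problem.
Context {R : realType} {d : nat}.
Variables (T a g z r : R) (xt m w : 'cV[R]_d) (D : set 'cV[R]_d).
Variables (f : R -> 'cV[R]_d -> 'cV[R]_d) (K : 'M[R]_d).
Hypotheses (T0 : 0 < T) (a01 : 0 < a < 1) (ag : a <= g) (g1 : g <= 1)
  (zE : z = 1 - g + a).
Local Notation x0 := (init_sol g xt).
Local Notation Xi := (Xi T a g z).
Implicit Types (e t L C : R) (u v x : R -> 'cV[R]_d) (op : (R -> R) -> R -> R) (i : 'I_d).

(** Read off from the operator bound for [t^(g-1)], because in the formula of [xi] the coefficient
    [1 - g - a] can be negative. *)
Lemma Xi_ge0 : 0 <= Xi.
Proof.
pose y t : R := t `^ (g - 1).
have yE t : 0 < t <= T -> t `^ (1 - g) * y t = 1.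
  move=> /andP[t0 _]; rewrite -powRD ?(gt_eqF t0) ?implybT//.
  by rewrite (_ : 1 - g + (g - 1) = 0) ?powRr0//; ring.
have cy : Cw g 0 T y.
  exists (fun=> 1); first by move=> t; exact: cst_continuous.
  by move=> t; rewrite in_itv; exact: yE.
have y1 t : 0 < t <= T -> `|t `^ (1 - g) * y t| <= 1 by move=> /yE ->; rewrite normr1.
have := Top_bound T0 a01 ag g1 zE (lexx 0) T0 cy ler01 y1 (t := T).
by rewrite T0 lexx mulr1 => /(_ isT); apply: le_trans.
Qed.

Lemma normwvC e u v : normwv g e T (u \- v) = normwv g e T (v \- u).
Proof.
apply/matrixP => i j; rewrite !mxE /normw; congr sup; apply: eq_imagel => t _.
by rewrite !entryB -normrN -mulrN opprB.
Qed.

(* Membership only concerns [`]e, T]]; asking [u] to be the image of another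
   representative [u'] of the limit also fixes its value at [e]. *)
Definition is_picard_limit op e u := exists u', [/\ XD g e T D u', u = picard_step g op xt f u',
  forall t, e < t <= T -> u t = u' t & cvgwv g e T (picard op f x0) u].

Hypotheses (cD : closed D) (m0 : lev 0 m) (K0 : forall i j, 0 <= K i j).
Hypotheses (ball0 : ball_in_XD g 0 T D xt (Xi *: m)) (bnd0 : bounded_on_XD g 0 T D f m)
  (lip0 : lipschitz_on_XD g 0 T D f K).
Hypotheses (w0 : forall i, 0 < w i 0) (r01 : 0 <= r < 1)
  (Kw : forall i, ((Xi *: K) *m w) i 0 <= r * w i 0).

Let r10 : 0 < 1 - r. Proof. by rewrite subr_gt0; case/andP: r01. Qed.
(** [m <= S * w] and [w <= W] turn estimates in the weighted norm into bounds by one scalar constant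
    for all components. *)
Let W := \sum_i w i 0.
Let S := \sum_i m i 0 / w i 0.
Let mi0 i : 0 <= m i 0. Proof. by have := m0 i; rewrite mxE. Qed.
Let W0 : 0 <= W. Proof. by apply: sumr_ge0 => i _; exact: ltW. Qed.
Let S0 : 0 <= S. Proof. by apply: sumr_ge0 => i _; rewrite divr_ge0// ltW. Qed.
Let wW i : w i 0 <= W.
Proof. by rewrite /W (bigD1 i)//= lerDl; apply: sumr_ge0 => j _; exact: ltW. Qed.
Let mS i : m i 0 <= S * w i 0.
Proof.
rewrite -ler_pdivrMr// /S (bigD1 i)//= lerDl; apply: sumr_ge0 => j _.
by rewrite divr_ge0// ltW.
Qed.

Let bndE e : 0 <= e -> e < T -> bounded_on_XD g e T D f m.
Proof.
rewrite le_eqVlt => /predU1P[<- //|e0] eT; exact: bounded_on_XD_restrict.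
Qed.

Let lipE e : 0 <= e -> e < T -> lipschitz_on_XD g e T D f K.
Proof.
rewrite le_eqVlt => /predU1P[<- //|e0] eT; exact: lipschitz_on_XD_restrict.
Qed.

Lemma Top_picard_limit e : 0 <= e -> e < T -> exists u, is_picard_limit (Top T a z e) e u.
Proof.
move=> e0 eT.
have ball : ball_in_XD g e T D xt (Xi *: m).
  move: e0; rewrite le_eqVlt => /predU1P[<- //|e0']; exact: ball_in_XD_restrict.
have [|||u [v [Du Dv uv uE ucvg]]] := @picard_limit R d g e T Xi r (Top T a z e) xt m w D f K
  e0 eT _ _ _ Xi_ge0 m0 K0 ball (bndE e0 eT) (lipE e0 eT) w0 r01 Kw.
- by move=> y; exact: Cw_Top.
- by move=> y B cy B0 hB; exact: (Top_bound T0 a01 ag g1 zE e0 eT cy B0 hB).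
- by move=> y y' B cy cy' B0 hB; exact: (Top_diff_bound T0 a01 ag g1 zE e0 eT cy cy' B0 hB).
by exists u, v.
Qed.

(** Common to both comparisons: [op] is the spline operator on [[eps, T]] in one, and the operator
    with lower limit 0 in the other. *)
Lemma Top_limit_perturbation op e u u' v L : 0 <= e -> e < T -> 0 <= L ->
  XD g e T D u' -> (forall t, e < t <= T -> u t = u' t) ->
  u = picard_step g op xt f u' ->
  (forall i t, e < t <= T -> `|t `^ (1 - g) * (op (entry (superpos f u') i) t -
    Top T a z e (entry (superpos f u') i) t)| <= L * m i 0) ->
  is_picard_limit (Top T a z e) e v ->
  forall i, normwv g e T (u \- v) i 0 <= S / (1 - r) * W * L.
Proof.
move=> e0 eT L0 Du' uu' uE opL [v' [Dv' vE vv' _]] i.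
have SL : 0 <= L * S by rewrite mulr_ge0.
apply: (@le_trans _ _ (L * S / (1 - r) * w i 0)); last first.
  by rewrite [leRHS]mulrC !mulrA ler_wpM2l// divr_ge0// ltW.
apply: (@fixed_point_perturbation R d g e T Xi r (Top T a z e) xt m w D f K eT _ Xi_ge0 K0
  (bndE e0 eT) (lipE e0 eT) w0 r01 Kw u u' v v') => //.
- by move=> y y' B cy cy' B0 hB; exact: (Top_diff_bound T0 a01 ag g1 zE e0 eT cy cy' B0 hB).
- move=> j t tT; rewrite uE !picard_stepE opprD addrACA subrr add0r.
  by rewrite (le_trans (opL j t tT))// -mulrA ler_wpM2l.
- by move=> t _; rewrite vE.
Qed.

(** On []e, T]] the limit [x] is the perturbed object, with the truncation error as defect, and [xe]
    the fixed point. The rate [r] and the weight [w] serve every [e], so [C] does not depend on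
    [e]. *)
Lemma Top_limit_distance x : is_picard_limit (Top T a z 0) 0 x -> exists2 C, 0 <= C &
  forall e xe i, 0 < e -> e < T -> is_picard_limit (Top T a z e) e xe ->
    normwv g e T (xe \- x) i 0 <= C * e `^ a.
Proof.
move=> [x' [Dx' xE xx' _]].
exists (S / (1 - r) * W * `|periodic_trunc a g z|).
  by rewrite mulr_ge0// mulr_ge0// divr_ge0// ltW.
move=> e xe i e0 eT xeL; rewrite normwvC -[leRHS]mulrA.
have sub t : e < t <= T -> 0 < t <= T by move=> /andP[et ->]; rewrite (lt_trans e0).
apply: (@Top_limit_perturbation (Top T a z 0) e x x') => //; first exact: ltW.
- by rewrite mulr_ge0// powR_ge0.
- split; first by apply: Cwv_restrict => //; exact: Dx'.1.
  by move=> t; rewrite in_itv => tT; apply: Dx'.2; rewrite in_itv/=; exact: sub.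
- by move=> t /sub; exact: xx'.
- move=> j t tT; have /andP[et tT'] := tT.
  apply: (@le_trans _ _ (m j 0 * periodic_trunc a g z * e `^ a)).
    apply: (Top_truncation T0 a01 ag g1 zE) => //; first exact: (bnd0 Dx').1.
    by move=> s sT; exact: (superpos_bound T0 bnd0).
  by rewrite mulrAC [leRHS]mulrC -mulrA ler_wpM2l// mulrC ler_wpM2r ?powR_ge0// ler_norm.
Qed.

(** If [g = a] the derivative has order 0 and returns [x]. In the other case the initial term
    [t^(g-1)] vanishes and [x] is an image of [Top]. *)
Lemma Top_limit_RLderiv x : is_picard_limit (Top T a z 0) 0 x ->
  g = a \/ xt = 0 /\ g - a <= a -> Cwv_RL g (g - a) T x.
Proof.
move=> [x' [Dx' xE xx' xcvg]] [ga|[xt0 ga]] i.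
  rewrite ga subrr -ga; apply: (Cw_RL0 T0 a01) => //.
  by have [_ + _] := xcvg; exact.
apply: (Cw_RL_Top T0 a01 ag g1 zE (y := entry (superpos f x') i)) => //.
  exact: (bnd0 Dx').1.
by move=> t _; rewrite xE picard_stepE /entry /init_sol xt0 scaler0 mxE add0r.
Qed.

Section spline_limits.
Variables (eps r' c : R) (w' : 'cV[R]_d).
Hypotheses (e0 : 0 < eps) (eT : eps < T).
Hypotheses (ballS : ball_in_XD g eps T D xt ((Xi + c) *: m)).
Hypotheses (w'0 : forall i, 0 < w' i 0) (r'01 : 0 <= r' < 1)
  (Kw' : forall i, (((Xi + c) *: K) *m w') i 0 <= r' * w' i 0).
Implicit Types (A : knots eps T) (q : nat).

(** The ball condition and the weight inequality for [Xi + c] persist when [c] decreases, so one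
    [w'] and one [r'] serve all pairs with [Omega_knots] at most [c]. *)
Lemma Top_spline_picard_limit A q : (0 < q)%N -> Omega_knots A a g z q <= c ->
  exists u, is_picard_limit (Top_spline a g z q A) eps u.
Proof.
move=> q0 Ac; have Om0 : 0 <= Xi + Omega_knots A a g z q.
  by rewrite addr_ge0 ?Xi_ge0// ltW// Omega_knots_gt0.
have cc : Xi + Omega_knots A a g z q <= Xi + c by rewrite lerD2l.
have ball : ball_in_XD g eps T D xt ((Xi + Omega_knots A a g z q) *: m).
  move=> u cu nu; apply: ballS => // i; apply: (le_trans (nu i)).
  by rewrite !mxE ler_wpM2r.
have Kw'' i : (((Xi + Omega_knots A a g z q) *: K) *m w') i 0 <= r' * w' i 0.
  apply: le_trans (Kw' i); rewrite -!scalemxAl [leLHS]mxE [leRHS]mxE ler_wpM2r//.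
  by rewrite mxE; apply: sumr_ge0 => j _; rewrite mulr_ge0// ltW.
have e0' := ltW e0.
have [|||u [v [Du Dv uv uE ucvg]]] := @picard_limit R d g eps T _ r' (Top_spline a g z q A)
  xt m w' D f K e0' eT _ _ _ Om0 m0 K0 ball (bndE e0' eT) (lipE e0' eT) w'0 r'01 Kw''.
- by move=> y _; exact: Cw_Top_spline.
- move=> y B cy B0 hB.
  exact: (Top_spline_bound A e0 eT a01 ag g1 zE q0 cy B0 hB).
- move=> y y' B cy cy' B0 hB.
  exact: (Top_spline_diff_bound A e0 eT a01 ag g1 zE q0 cy cy' B0 hB).
by exists u, v.
Qed.

(** The constant is built from [w] and [r], belonging to [Xi] alone, since T^eps is the contracting
    operator; it is therefore the same for all knots and orders. *)
Lemma Top_spline_limit_distance : exists2 C, 0 <= C &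
  forall A q u v i, (0 < q)%N -> is_picard_limit (Top_spline a g z q A) eps u ->
    is_picard_limit (Top T a z eps) eps v ->
    normwv g eps T (u \- v) i 0 <= C * (mesh A / Num.sqrt q%:R) `^ a.
Proof.
have oc0 := omega_cst_ge0 eps T a01 g1 zE.
exists (S / (1 - r) * W * (5 / 4 * omega_cst eps T a g z)).
  by rewrite mulr_ge0// mulr_ge0// divr_ge0// ltW.
move=> A q u v i q0 [u' [Du' uE uu' _]] vL; rewrite -[leRHS]mulrA.
apply: (@le_trans _ _ (S / (1 - r) * W * Omega_knots A a g z q)).
  apply: (@Top_limit_perturbation (Top_spline a g z q A) eps u u') => //; first exact: ltW.
    by rewrite ltW// Omega_knots_gt0.
  move=> j t tT; apply: (Top_spline_error A e0 eT a01 ag g1 zE q0) => //.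
    exact: (bndE (ltW e0) eT Du').1.
  by move=> s sT; exact: (superpos_bound eT (bndE (ltW e0) eT)).
apply: ler_wpM2l; first by rewrite mulr_ge0// divr_ge0// ltW.
by rewrite -[leRHS]mulrA; exact: Omega_knots_le.
Qed.

Lemma contv_init : contv eps T x0.
Proof.
move=> i; rewrite (_ : entry x0 i = fun t => t `^ (g - 1) * ((Gamma g)^-1 * xt i 0)).
  by apply: within_continuous_powRM => // t; exact: cst_continuous.
by apply/funext => t; rewrite /entry mxE mulrA.
Qed.

Lemma contv_Top_spline_step A q u : (0 < q)%N ->
  contv eps T (picard_step g (Top_spline a g z q A) xt f u).
Proof.
move=> q0 i.
rewrite (_ : entry _ i = entry x0 i \+ Top_spline a g z q A (entry (superpos f u) i)); last first.
  by apply/funext => t; rewrite picard_stepE.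
by move=> t; apply: cvgD; [exact: contv_init|exact: Top_spline_continuous].
Qed.

Lemma contv_Top_spline_picard A q n : (0 < q)%N ->
  contv eps T (picard (Top_spline a g z q A) f x0 n).
Proof.
by move=> q0; case: n => [|n]; [exact: contv_init|exact: contv_Top_spline_step].
Qed.

End spline_limits.

End perturbed_problem.

Section vanishing_powers.
Context {R : realType}.
Implicit Types (C e a x h : R).

Lemma powR_small C e a : 0 <= C -> 0 < e -> 0 < a ->
  exists2 del, 0 < del & forall x, 0 <= x -> x < del -> C * x `^ a < e.
Proof.
move=> C0 e0 a0; have C10 : 0 < C + 1 by rewrite ltr_wpDl.
have d0 : 0 < e / (C + 1) by rewrite divr_gt0.
exists ((e / (C + 1)) `^ a^-1); first by rewrite powR_gt0.
move=> x x0 xd; apply: (@le_lt_trans _ _ ((C + 1) * x `^ a)).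
  by rewrite ler_wpM2r ?powR_ge0// lerDl.
rewrite -ltr_pdivlMl// mulrC.
rewrite (_ : e / (C + 1) = ((e / (C + 1)) `^ a^-1) `^ a).
  by apply: gt0_ltr_powR; rewrite ?nnegrE ?powR_ge0.
by rewrite -powRrM mulVf ?gt_eqF// powRr1// ltW.
Qed.

Lemma div_sqrtn_small h e : 0 <= h -> 0 < e ->
  \forall p \near \oo, (0 < p)%N && (h / Num.sqrt p%:R < e).
Proof.
move=> h0 e0; near=> p.
have p0 : (0 < p)%N by near: p; exact: nbhs_infty_gt.
rewrite p0/= ltr_pdivrMr ?sqrtr_gt0 ?ltr0n// -ltr_pdivrMl// mulrC.
rewrite -[ltLHS]ger0_norm ?divr_ge0 ?(ltW e0)// -sqrtr_sqr ltr_sqrt ?ltr0n//.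
near: p; exact: nbhs_infty_gtr.
Unshelve. all: by end_near. Qed.

End vanishing_powers.

Theorem theorem4p1 (R : realType) (T eps alpha beta gamma zeta : R) (d q : nat)
    (xt : 'cV[R]_d) (D : set 'cV[R]_d) (f : R -> 'cV[R]_d -> 'cV[R]_d)
    (A : knots eps T) (m : 'cV[R]_d) (K : 'M[R]_d) :
  0 < T -> 0 < eps < T -> 0 < alpha < 1 -> 0 <= beta <= 1 ->
  gamma = alpha + beta - alpha * beta -> zeta = 1 - gamma + alpha ->
  (0 < q)%N -> closed D -> bounded_set D ->
  let Xi := Xi T alpha gamma zeta in
  let Om := Omega_knots A alpha gamma zeta q in
  let x0 := init_sol gamma xt in
  let xm := picard (Top T alpha zeta 0) f x0 in
  let xem e := picard (Top T alpha zeta e) f x0 in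
  let xqem p (B : knots eps T) :=
    picard (Top_spline alpha gamma zeta p B) f x0 in
  D ((Gamma gamma)^-1 *: xt) ->
  ball_in_XD gamma 0 T D xt (Xi *: m) ->
  lev 0 m -> (forall i j, 0 <= K i j) ->
  bounded_on_XD gamma 0 T D f m ->
  lipschitz_on_XD gamma 0 T D f K ->
  spectral_radius (Xi *: K) < 1 ->
  ball_in_XD gamma eps T D xt ((Xi + Om) *: m) ->
  bounded_on_XD gamma eps T D f m ->
  lipschitz_on_XD gamma eps T D f K ->
  spectral_radius ((Xi + Om) *: K) < 1 ->
  exists (xqe : nat -> knots eps T -> R -> 'cV[R]_d)
         (xe : R -> R -> 'cV[R]_d) (x : R -> 'cV[R]_d),
  [/\ cvgwv gamma eps T (xqem q A) (xqe q A) /\ contv eps T (xqe q A),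
      forall n, Cwv gamma eps T (xqem q A n) /\ contv eps T (xqem q A n),
      cvgwv gamma eps T (xem eps) (xe eps) /\
      [/\ (\forall p \near \oo, cvgwv gamma eps T (xqem p A) (xqe p A)) /\
          (forall i,
             normwv gamma eps T (xqe p A \- xe eps) i 0 @[p --> \oo] --> 0),
          (forall i e, 0 < e -> exists2 delta, 0 < delta &
             forall B, mesh B < delta ->
               cvgwv gamma eps T (xqem q B) (xqe q B) /\
               normwv gamma eps T (xqe q B \- xe eps) i 0 < e) &
          exists C delta, 0 < delta /\
             forall p B, (0 < p)%N -> mesh B / Num.sqrt p%:R < delta ->
               cvgwv gamma eps T (xqem p B) (xqe p B) /\
               forall i, normwv gamma eps T (xqe p B \- xe eps) i 0
                         <= C * (mesh B / Num.sqrt p%:R) `^ alpha] &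
      [/\ cvgwv gamma 0 T xm x,
          (beta = 0 \/ xt = 0 /\ beta * (1 - alpha) <= alpha ->
            Cwv_RL gamma (beta * (1 - alpha)) T x),
          (\forall e \near (0 : R)^'+, cvgwv gamma e T (xem e) (xe e)),
          (forall i, normwv gamma e T (xe e \- x) i 0 @[e --> (0 : R)^'+] --> 0) &
          exists C : R, \forall e \near (0 : R)^'+, forall i,
            normwv gamma e T (xe e \- x) i 0 <= C * e `^ alpha]].
Proof.
move=> T0 eT01 a01 b01 gE zE q0 cD _ Xi0 Om x0 xm xem xqem _ ball0 m0 K0 bnd0 lip0 rho0
  ballS _ _ rhoS.
have /andP[e0 eT] := eT01; have /andP[a0 a1] := a01; have /andP[b0 b1] := b01.
have ag : alpha <= gamma.
  by rewrite gE -addrA lerDl -{1}[beta]mul1r -mulrBl mulr_ge0// subr_ge0 ltW.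
have g1 : gamma <= 1.
  rewrite -subr_ge0 (_ : 1 - gamma = (1 - alpha) * (1 - beta)); last by rewrite gE; ring.
  by rewrite mulr_ge0 ?subr_ge0// ltW.
have gaE : beta * (1 - alpha) = gamma - alpha by rewrite gE; ring.
have XiOm0 : 0 <= Xi0 + Om.
  by rewrite addr_ge0 ?(Xi_ge0 T0 a01 ag g1 zE)// ltW// Omega_knots_gt0.
have XiK0 i j : 0 <= (Xi0 *: K) i j by rewrite mxE mulr_ge0// (Xi_ge0 T0 a01 ag g1 zE).
(* This weight serves the limits with unsplined operators and all comparisons; [w'] and [r'] below
   serve the existence of spline limits. *)
have [w [r [r01 w0 Kw]]] := spectral_weight XiK0 rho0.
have XiOmK0 i j : 0 <= ((Xi0 + Om) *: K) i j by rewrite mxE mulr_ge0.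
have [w' [r' [r'01 w'0 Kw']]] := spectral_weight XiOmK0 rhoS.
pose lim op e u := is_picard_limit T gamma xt D f op e u.
have limcvg op e u : lim op e u -> cvgwv gamma e T (picard op f x0) u by case=> ? [].
have TopL e : 0 <= e -> e < T -> exists u, lim (Top T alpha zeta e) e u.
  exact: (Top_picard_limit T0 a01 ag g1 zE cD m0 K0 ball0 bnd0 lip0 w0 r01 Kw).
have SplL p (B : knots eps T) : (0 < p)%N -> Omega_knots B alpha gamma zeta p <= Om ->
    exists u, lim (Top_spline alpha gamma zeta p B) eps u.
  exact: (Top_spline_picard_limit T0 a01 ag g1 zE cD m0 K0 bnd0 lip0 e0 eT ballS w'0 r'01 Kw').
(* Limits are chosen for all parameters at once, with the initial function as default where
   convergence is not guaranteed; the same holds for [xs]. *)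
have /choice[xe xeP] e : exists u, 0 <= e -> e < T -> lim (Top T alpha zeta e) e u.
  have [[h1 h2]|h] := pselect (0 <= e /\ e < T); last by exists x0 => ? ?; case: h.
  by have [u] := TopL e h1 h2; exists u.
have /choice[xs xsP] (pB : nat * knots eps T) : exists u, (0 < pB.1)%N ->
    Omega_knots pB.2 alpha gamma zeta pB.1 <= Om ->
    lim (Top_spline alpha gamma zeta pB.1 pB.2) eps u.
  have [[h1 h2]|h] := pselect ((0 < pB.1)%N /\ Omega_knots pB.2 alpha gamma zeta pB.1 <= Om).
    by have [u] := SplL _ _ h1 h2; exists u.
  by exists x0 => ? ?; case: h.
pose xqe p B := xs (p, B).
have xqeP p B : (0 < p)%N -> Omega_knots B alpha gamma zeta p <= Om ->
    lim (Top_spline alpha gamma zeta p B) eps (xqe p B) := xsP (p, B).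
have xeps := xeP eps (ltW e0) eT; have x0L := xeP 0 (lexx 0) T0.
have xqA := xqeP q A q0 (lexx _).
have [C C0 HC] : exists2 C, 0 <= C &
    forall p (B : knots eps T) i, (0 < p)%N -> Omega_knots B alpha gamma zeta p <= Om ->
    normwv gamma eps T (xqe p B \- xe eps) i 0 <= C * (mesh B / Num.sqrt p%:R) `^ alpha.
  have [C C0 HC] := Top_spline_limit_distance xt T0 a01 ag g1 zE cD m0 K0 bnd0 lip0 w0 r01 Kw e0 eT.
  by exists C => // p B i p0 Bp; exact: (HC _ _ _ _ _ p0 (xqeP p B p0 Bp) xeps).
have [C' C'0 HC'] := Top_limit_distance T0 a01 ag g1 zE cD m0 K0 bnd0 lip0 w0 r01 Kw x0L.
have Om0 : 0 < Om by exact: Omega_knots_gt0.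
have oc0 : 0 <= 5 / 4 * omega_cst eps T alpha gamma zeta.
  by rewrite mulr_ge0// omega_cst_ge0.
(* Below [del] every pair satisfies [Omega_knots <= Om], so its spline iteration converges under the
   hypotheses given for [A] and [q]. *)
have [del del0 Hdel] := powR_small oc0 Om0 a0.
have mp0 (B : knots eps T) p : 0 <= mesh B / Num.sqrt p%:R.
  by rewrite divr_ge0 ?sqrtr_ge0// ltW// mesh_gt0.
have small p (B : knots eps T) : mesh B / Num.sqrt p%:R < del -> Omega_knots B alpha gamma zeta p <= Om.
  move=> hd; apply: (le_trans (Omega_knots_le B e0 eT a01 g1 zE p)).
  by rewrite mulrA ltW// Hdel.
have mesh_le (B : knots eps T) : mesh B / Num.sqrt q%:R <= mesh B.
  have q1 := @sqrtr_natn_ge1 R q q0.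
  by rewrite ler_pdivrMr ?(lt_le_trans ltr01)// ler_peMr// ltW// mesh_gt0.
(* The solution on []0, T]] is the member [e = 0] of the family of limits. *)
exists xqe, xe, (xe 0); split.
- have [u' [_ uE _ ucvg]] := xqA; split => //.
  by rewrite uE; exact: contv_Top_spline_step.
- move=> n; have [u' [_ _ _ [+ _ _]]] := xqA => ucvg; split; first exact: ucvg.
  exact: contv_Top_spline_picard.
- have [_ [_ _ _ xecvg]] := xeps; split => //; split.
  + split.
      have := div_sqrtn_small (ltW (mesh_gt0 A)) del0.
      apply: filterS => p /andP[p0 hp].
      exact: limcvg (xqeP p A p0 (small p A hp)).
    move=> i; apply/cvgrPdist_lt => x x_gt0.
    have [del' del'0 Hdel'] := powR_small C0 x_gt0 a0.
    have d0 : 0 < Num.min del del' by rewrite lt_min del0.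
    have := div_sqrtn_small (ltW (mesh_gt0 A)) d0.
    apply: filterS => p /andP[p0]; rewrite lt_min => /andP[h1 h2].
    rewrite sub0r normrN mxE ger0_norm ?normw_ge0//.
    have := HC p A i p0 (small p A h1); rewrite mxE => /le_lt_trans; apply.
    exact: Hdel'.
  + move=> i x x_gt0; have [del' del'0 Hdel'] := powR_small C0 x_gt0 a0.
    exists (Num.min del del'); first by rewrite lt_min del0.
    move=> B; rewrite lt_min => /andP[h1 h2].
    have sB := small q B (le_lt_trans (mesh_le B) h1).
    split; first exact: limcvg (xqeP q B q0 sB).
    apply: le_lt_trans (HC q B i q0 sB) _; apply: Hdel' => //.
    exact: le_lt_trans (mesh_le B) h2.
  + exists C, del; split => // p B p0 hB; have sB := small p B hB.
    split; first exact: limcvg (xqeP p B p0 sB).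
    by move=> i; exact: HC.
- have nearT : \forall e \near (0 : R)^'+, 0 < e < T.
    near=> e; apply/andP; split; near: e; first exact: nbhs_right_gt.
    exact: nbhs_right_lt.
  split.
  + exact: limcvg x0L.
  + rewrite gaE => h; apply: (Top_limit_RLderiv T0 a01 ag g1 zE bnd0 x0L).
    by case: h => [beta0|]; [left; rewrite gE beta0; ring|right].
  + apply: filterS nearT => e /andP[e_gt0 e_ltT].
    exact: limcvg (xeP e (ltW e_gt0) e_ltT).
  + move=> i; apply/cvgrPdist_lt => x x_gt0.
    have [del' del'0 Hdel'] := powR_small C'0 x_gt0 a0.
    near=> e.
    have /andP[e_gt0 e_ltT] : 0 < e < T by near: e.
    rewrite sub0r normrN mxE ger0_norm ?normw_ge0//.
    have := HC' e (xe e) i e_gt0 e_ltT (xeP e (ltW e_gt0) e_ltT).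
    rewrite mxE => /le_lt_trans; apply; apply: Hdel'; first exact: ltW.
    by near: e; exact: nbhs_right_lt.
  + exists C'; apply: filterS nearT => e /andP[e_gt0 e_ltT] i.
    exact: (HC' _ _ _ e_gt0 e_ltT (xeP e (ltW e_gt0) e_ltT)).
Unshelve. all: by end_near. Qed.
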